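(* Let $\alpha\in(0,1)$, $T>0$, $n,n_u,n_v\in\mathbb{N}$, $R_0>0$, let $P\subset\mathbb{R}^{n_u}$ and $Q\subset\mathbb{R}^{n_v}$ be compact sets, and let $g:[0,T]\times\mathbb{R}^n\times P\times Q\to\mathbb{R}^n$ satisfy the following conditions: (i) $g$ is continuous; (ii) for any $r\ge0$ there exists $\lambda_g>0$ such that $\|g(t,x,u,v)-g(t,y,u,v)\|\le\lambda_g\|x-y\|$ for all $t\in[0,T]$, $x,y\in B(r)$, $u\in P$, $v\in Q$; (iii) there exists $c_g>0$ such that $\|g(t,x,u,v)\|\le(1+\|x\|)c_g$ for all $t\in[0,T]$, $x\in\mathbb{R}^n$, $u\in P$, $v\in Q$; (iv) for all $t\in[0,T]$ and $x,s\in\mathbb{R}^n$, $\displaystyle\min_{u\in P}\max_{v\in Q}\langle s,g(t,x,u,v)\rangle=\max_{v\in Q}\min_{u\in P}\langle s,g(t,x,u,v)\rangle$. Then for any $\varepsilon>0$ there exist $h_\ast>0$ and $\delta_\ast>0$ such that, for any initial value $x_0\in B(R_0)$, any $h\in(0,h_\ast]$, any partition $\Delta$ of $[0,T]$ with $\operatorname{diam}(\Delta)\le\delta_\ast$ and any realizations $v(\cdot)\in\mathcal{V}$, $\widetilde u(\cdot)\in\mathcal{U}$, if the realizations $u(\cdot)\in\mathcal{U}$ and $\widetilde v(\cdot)\in\mathcal{V}$ are formed according to the mutual aiming procedure (described in the context) for $x_0$, $h$, $\Delta$, then the corresponding motion $x(\cdot)=x(\cdot;x_0;u(\cdot),v(\cdot))$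 of the system $$({}^CD^\alpha x)(t)=g(t,x(t),u(t),v(t)),\quad t\in[0,T],\qquad x(0)=x_0,$$ and the corresponding motion $y(\cdot)=y(\cdot;x_0;h;\widetilde u(\cdot),\widetilde v(\cdot))$ of the approximating system $$\dot y(t)=g\big(t,\,x_0+h^{\alpha-1}(\Delta_h^{1-\alpha}y)(t),\,\widetilde u(t),\,\widetilde v(t)\big),\quad t\in[0,T],\qquad y(0)=0,$$ satisfy the inequality $$\|x(t)-x_0-h^{\alpha-1}(\Delta_h^{1-\alpha}y)(t)\|\le\varepsilon,\quad t\in[0,T].$$
   Context: $\mathbb{R}^n$ carries the Euclidean scalar product $\langle\cdot,\cdot\rangle$ and norm $\|\cdot\|$; $B(r)$ is the closed ball in $\mathbb{R}^n$ centered at the origin with radius $r$. $L^\infty=L^\infty([0,T],\mathbb{R}^n)$ is the space of (classes of) essentially bounded Lebesgue measurable functions $[0,T]\to\mathbb{R}^n$. Riemann–Liouville integral: $(I^\alpha\varphi)(t)=\frac{1}{\Gamma(\alpha)}\int_0^t\frac{\varphi(\tau)}{(t-\tau)^{1-\alpha}}d\tau$, $t\in[0,T]$. $I^\alpha(L^\infty)$ is the set of functions $x:[0,T]\to\mathbb{R}^n$ such that $x(t)=(I^\alpha\varphi)(t)$ for all $t\in[0,T]$ for some $\varphi\in L^\infty$. $\{x_0\}+I^\alpha(L^\infty)$ is the set of functions $t\mapsto x_0+\overline{x}(t)$ with $\overline{x}(\cdot)\in I^\alpha(L^\infty)$; such functions automatically take the value $x_0$ at $t=0$. Caputo derivative: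 $({}^CD^\alpha x)(t)=\frac{1}{\Gamma(1-\alpha)}\frac{d}{dt}\int_0^t\frac{x(\tau)-x(0)}{(t-\tau)^\alpha}d\tau$; it exists for almost every $t\in[0,T]$ when $x(\cdot)\in\{x_0\}+I^\alpha(L^\infty)$. Fractional difference of order $\beta\in(0,1)$ with step $h>0$: $(\Delta_h^\beta y)(t)=\sum_{j=0}^{[t/h]}(-1)^j\binom{\beta}{j}y(t-jh)$, $t\in[0,T]$, where $[\tau]$ is the integer part of $\tau\ge0$ and $\binom{\beta}{j}$ are the generalized binomial coefficients. $\mathcal{U}$ and $\mathcal{V}$ are the sets of all measurable functions $[0,T)\to P$ and $[0,T)\to Q$, respectively (admissible realizations). The motion $x(\cdot;x_0;u(\cdot),v(\cdot))$ is the function $x(\cdot)\in\{x_0\}+I^\alpha(L^\infty)$ which, together with $u(\cdot)\in\mathcal{U}$, $v(\cdot)\in\mathcal{V}$, satisfies the fractional differential equation for almost every $t\in[0,T]$. The motion $y(\cdot;x_0;h;\widetilde u(\cdot),\widetilde v(\cdot))$ is the Lipschitz continuous function $y:[0,T]\to\mathbb{R}^n$ with $y(0)=0$ which, together with $\widetilde u(\cdot)\in\mathcal{U}$, $\widetilde v(\cdot)\in\mathcal{V}$, satisfies the approximating differential equation for almost every $t\in[0,T]$. Under conditions (i)–(iv) both motions exist and are unique for all $x_0\in B(R_0)$, $h>0$ and all admissible realizations. A partition of $[0,T]$ is a finite set $\Delta=\{\tau_j\}_{j=1}^{k+1}$, $k\in\mathbb{N}$, with $\tau_1=0$, $\tau_{j+1}>\tau_j$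 for $j=1,\dots,k$, and $\tau_{k+1}=T$; its diameter is $\operatorname{diam}(\Delta)=\max_{1\le j\le k}(\tau_{j+1}-\tau_j)$. Mutual aiming procedure (for given $x_0$, $h$, $\Delta$): the realizations $u(\cdot)$ and $\widetilde v(\cdot)$ are formed step by step. For $j\in\{1,\dots,k\}$, when the values $x(\tau_j)$ of the motion of the first system and $y(t)$, $t\in[0,\tau_j]$, of the motion of the approximating system have already been realized, put $$\widetilde s_j=x(\tau_j)-x_0-h^{\alpha-1}(\Delta_h^{1-\alpha}y)(\tau_j),$$ and for $t\in[\tau_j,\tau_{j+1})$ set $u(t)=u_j$ and $\widetilde v(t)=\widetilde v_j$, where $u_j$ and $\widetilde v_j$ are any constants with $$u_j\in\operatorname*{argmin}_{u\in P}\ \max_{v\in Q}\,\langle\widetilde s_j,g(\tau_j,x(\tau_j),u,v)\rangle,$$ $$\widetilde v_j\in\operatorname*{argmax}_{\widetilde v\in Q}\ \min_{\widetilde u\in P}\,\big\langle\widetilde s_j,g\big(\tau_j,\,x_0+h^{\alpha-1}(\Delta_h^{1-\alpha}y)(\tau_j),\,\widetilde u,\,\widetilde v\big)\big\rangle.$$ *)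

(* Defs.v *)
(* Functions on [0, T] or [0, T) are total functions of a real variable whose
   values outside the stated domain are never constrained and never matter. *)
From mathcomp Require Import all_boot all_order all_algebra.
From mathcomp Require Import all_classical all_reals all_analysis.

Set Implicit Arguments.
Unset Strict Implicit.
Unset Printing Implicit Defensive.

Import Order.TTheory GRing.Theory Num.Theory.
Import numFieldNormedType.Exports.

Local Open Scope classical_set_scope.
Local Open Scope ring_scope.

(* The library norm [`|x|] on ['rV[R]_n] is the sup norm, hence [dot] and
   [enorm]; the library topology on ['rV[R]_n] is the Euclidean one. *)
Definition dot (R : realType) (n : nat) (x y : 'rV[R]_n) : R :=
  \sum_(i < n) x 0 i * y 0 i.

Definition enorm (R : realType) (n : nat) (x : 'rV[R]_n) : R :=
  Num.sqrt (dot x x).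

(* [R] with the sigma-algebra of Lebesgue measurable sets; the default
   structure on [R] in the library only has the Borel sets. *)
Definition lebesgueType (R : realType) :=
  caratheodory_type (wlength (@idfun R))^*%mu.

Definition leb_measurable_fun (R : realType) (n : nat) (D : set R)
    (f : R -> 'rV[R]_n) : Prop :=
  forall i : 'I_n,
    measurable_fun (D : set (lebesgueType R))
      ((fun t => f t 0 i) : lebesgueType R -> measurableTypeR R).

Definition vintegral (R : realType) (n : nat) (D : set R)
    (f : R -> 'rV[R]_n) : 'rV[R]_n :=
  \row_(i < n) \int[@completed_lebesgue_measure R]_(t in D) f t 0 i.

Definition ae_on (R : realType) (D : set R) (Pr : R -> Prop) : Prop :=
  {ae @completed_lebesgue_measure R, forall t, D t -> Pr t}.

Definition Linfty (R : realType) (n : nat) (T : R) (phi : R -> 'rV[R]_n) : Prop :=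
  leb_measurable_fun `[0, T] phi /\
  exists M : R, ae_on `[0, T] (fun t => enorm (phi t) <= M).

Definition Gamma (R : realType) (z : R) : R :=
  \int[@completed_lebesgue_measure R]_(t in `[0, +oo[)
    (t `^ (z - 1) * expR (- t)).

Definition RLint (R : realType) (n : nat) (alpha : R) (phi : R -> 'rV[R]_n)
    (t : R) : 'rV[R]_n :=
  (Gamma alpha)^-1 *:
    vintegral `[0, t] (fun tau => ((t - tau) `^ (1 - alpha))^-1 *: phi tau).

(* The set {x0} + I^alpha(L^oo). *)
Definition RLspace (R : realType) (n : nat) (T alpha : R) (x0 : 'rV[R]_n)
    (x : R -> 'rV[R]_n) : Prop :=
  exists2 phi, Linfty T phi &
    forall t, t \in `[0, T] -> x t = x0 + RLint alpha phi t.

Definition caputo_primitive (R : realType) (n : nat) (alpha : R)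
    (x : R -> 'rV[R]_n) (t : R) : 'rV[R]_n :=
  vintegral `[0, t] (fun tau => ((t - tau) `^ alpha)^-1 *: (x tau - x 0)).

(* Meaningful only where [caputo_primitive alpha x] is derivable. *)
Definition caputo (R : realType) (n : nat) (alpha : R) (x : R -> 'rV[R]_n)
    (t : R) : 'rV[R]_n :=
  (Gamma (1 - alpha))^-1 *: derive1 (caputo_primitive alpha x) t.

Definition gbinom (R : realType) (beta : R) (j : nat) : R :=
  (\prod_(i < j) (beta - i%:R)) / (j`!)%:R.

Definition frac_diff (R : realType) (n : nat) (beta h : R) (y : R -> 'rV[R]_n)
    (t : R) : 'rV[R]_n :=
  \sum_(j < (Num.truncn (t / h)).+1)
    ((-1) ^+ j * gbinom beta j) *: y (t - j%:R * h).

(* h^(alpha - 1) (Delta_h^(1 - alpha) y)(t) *)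
Definition scaled_diff (R : realType) (n : nat) (alpha h : R)
    (y : R -> 'rV[R]_n) (t : R) : 'rV[R]_n :=
  h `^ (alpha - 1) *: frac_diff (1 - alpha) h y t.

Definition admissible (R : realType) (m : nat) (T : R) (A : set 'rV[R]_m)
    (u : R -> 'rV[R]_m) : Prop :=
  leb_measurable_fun `[0, T[ u /\ forall t, t \in `[0, T[ -> A (u t).

Definition is_motion (R : realType) (n nu nv : nat) (alpha T : R)
    (g : R -> 'rV[R]_n -> 'rV[R]_nu -> 'rV[R]_nv -> 'rV[R]_n)
    (x0 : 'rV[R]_n) (u : R -> 'rV[R]_nu) (v : R -> 'rV[R]_nv)
    (x : R -> 'rV[R]_n) : Prop :=
  [/\ RLspace T alpha x0 x,
      x 0 = x0 &
      ae_on `[0, T] (fun t =>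
        derivable (caputo_primitive alpha x) t 1 /\
        caputo alpha x t = g t (x t) (u t) (v t))].

Definition is_approx_motion (R : realType) (n nu nv : nat) (alpha T : R)
    (g : R -> 'rV[R]_n -> 'rV[R]_nu -> 'rV[R]_nv -> 'rV[R]_n)
    (x0 : 'rV[R]_n) (h : R) (u : R -> 'rV[R]_nu) (v : R -> 'rV[R]_nv)
    (y : R -> 'rV[R]_n) : Prop :=
  [/\ [lipschitz y t | t in `[0, T]],
      y 0 = 0 &
      ae_on `[0, T] (fun t =>
        derivable y t 1 /\
        derive1 y t = g t (x0 + scaled_diff alpha h y t) (u t) (v t))].

(* Only used for continuous [f] and nonempty compact [A], where the infimum and
   the supremum are attained. *)
Definition min_over (R : realType) (U : Type) (A : set U) (f : U -> R) : R :=
  inf (f @` A).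

Definition max_over (R : realType) (U : Type) (A : set U) (f : U -> R) : R :=
  sup (f @` A).

Definition argmin (R : realType) (U : Type) (A : set U) (f : U -> R) : set U :=
  [set a | A a /\ forall b, A b -> f a <= f b].

Definition argmax (R : realType) (U : Type) (A : set U) (f : U -> R) : set U :=
  [set a | A a /\ forall b, A b -> f b <= f a].

(* A partition of [0, T] is given by the increasing sequence [p] of its nodes
   other than 0, through the library's [itv_partition 0 T p]; [node p j] is
   the j-th node counted from [node p 0 = 0], and [node p (size p) = T]. *)
Definition node (R : realType) (p : seq R) (j : nat) : R := nth 0 (0 :: p) j.

Definition diam (R : realType) (p : seq R) : R :=
  \big[Num.max/0]_(j < size p) (node p j.+1 - node p j).

Definition mutual_aiming (R : realType) (n nu nv : nat) (alpha : R)
    (P : set 'rV[R]_nu) (Q : set 'rV[R]_nv)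
    (g : R -> 'rV[R]_n -> 'rV[R]_nu -> 'rV[R]_nv -> 'rV[R]_n)
    (x0 : 'rV[R]_n) (h : R) (p : seq R) (x y : R -> 'rV[R]_n)
    (u : R -> 'rV[R]_nu) (vt : R -> 'rV[R]_nv) : Prop :=
  forall j : nat, (j < size p)%N ->
  let tj := node p j in
  let sj := x tj - x0 - scaled_diff alpha h y tj in
  exists (uj : 'rV[R]_nu) (vj : 'rV[R]_nv),
    [/\ argmin P (fun a => max_over Q (fun b => dot sj (g tj (x tj) a b))) uj,
        argmax Q (fun b => min_over P (fun a =>
          dot sj (g tj (x0 + scaled_diff alpha h y tj) a b))) vj &
        forall t, t \in `[tj, node p j.+1[ -> u t = uj /\ vt t = vj].

(* Main.v *)
(* Let k_h be the step kernel h^(a-1) W_[r/h], where the W_j are the Taylor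
   coefficients of (1 - z)^(-a).  Wendel's inequality for Gamma squeezes Gamma(a) W_j
   between (j+1)^(a-1) and j^(a-1), so that k_h is within O(h^a) of the
   Riemann-Liouville kernel in L^1, and summation by parts turns h^(a-1) Delta_h^(1-a) y
   into the convolution of k_h with y'.  The Caputo equation says that the
   primitive Y of the fractional derivative of x solves an ordinary differential
   equation, and x - x0 is the limit of the same discrete operator applied to Y.
   Both systems are thus described by Lipschitz functions Y and y whose derivatives are
   given by g, and x - x0 - h^(a-1) Delta_h^(1-a) y is O(h^a)-close to the discrete
   fractional integral e of (Y - y)'.

   The weights inverse to W (the coefficients of (1 - z)^a) are nonpositive after the
   first one and have positive partial sums, hence
   |e_m|^2 <= 2 sum_l W_(m-l) <e_l, F_l> whenever e = W * F.  With F_l the increment of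
   Y - y over one step, mutual aiming and the saddle point condition bound <e_l, F_l>
   by h (2 lambda |e_l|^2 + eta), and a discrete fractional Gronwall inequality
   concludes. *)
Require Import Defs.
From HB Require Import structures.
From mathcomp Require Import all_boot all_order all_algebra.
From mathcomp Require Import all_classical all_reals all_analysis.
From mathcomp Require Import measurable_realfun.
From mathcomp Require Import ring lra.

Set Implicit Arguments.
Unset Strict Implicit.
Unset Printing Implicit Defensive.

Import Order.TTheory GRing.Theory Num.Theory.
Import numFieldNormedType.Exports.

Local Open Scope classical_set_scope.
Local Open Scope ring_scope.

(** * Gruenwald-Letnikov weights *)

(** The obstacle is the lack of a chain rule. Aiming controls the scalar product of the deviation
    with the derivative of [Y - y], but the deviation is a fractional integral of that derivative,
    with memory reaching back to time 0, so its square cannot simply be differentiated. A one-sided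
    substitute survives at the level of weights, where it is power series algebra and asks for no
    regularity. For each time [t] the sums run over the lattice [t - j h], which is unrelated to the
    nodes of the partition; the two meet only through moduli of continuity.

    Uniformity is the second difficulty: the Lipschitz constant and the approximation error that
    come with a motion depend on that motion. A bound on the states that does not see these
    constants comes first; the growth condition then gives a common velocity bound [M], and the
    errors are restated in terms of [M].

    Derivatives exist only almost everywhere. A one-sided mean value inequality for Lipschitz
    functions, obtained by real induction, takes the place of integrating the derivative. *)

Section Weights.
Context {R : realType}.
Implicit Types (a b g h t M : R) (i j k m N : nat) (f F Y : R -> R).

(* Taylor coefficients of [(1 - z) ^ (- g)]; [glw (- g)] are the Gruenwald-Letnikov
   weights [(-1) ^ j binom(g, j)] (see [gbinomE]). *)
Definition glw g m : R := \prod_(i < m) ((i%:R + g) / i.+1%:R).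

Lemma glw0 g : glw g 0 = 1.
Proof. by rewrite /glw big_ord0. Qed.

Lemma glwS g m : m.+1%:R * glw g m.+1 = (m%:R + g) * glw g m.
Proof.
by rewrite /glw big_ord_recr /= mulrC -mulrA divfK ?pnatr_eq0 // mulrC.
Qed.

Lemma glw_gt0 g m : 0 < g -> 0 < glw g m.
Proof.
move=> g0; apply: prodr_gt0 => i _; rewrite divr_gt0 ?ltr0n //.
by rewrite ltr_wpDl.
Qed.

Lemma glwSE g m : glw g m.+1 = glw g m * ((m%:R + g) / m.+1%:R).
Proof. by rewrite /glw big_ord_recr. Qed.

Lemma glwSB g m : glw g m - glw g m.+1 = (1 - g) / m.+1%:R * glw g m.
Proof.
have := pnatr_eq0 R m.+1; rewrite glwSE -natr1 /= => /negbT m0.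
by field.
Qed.

Lemma glw_le g m : 0 < g < 1 -> glw g m.+1 <= glw g m.
Proof.
move=> /andP[g0 g1]; rewrite -subr_ge0 glwSB.
by rewrite mulr_ge0 ?divr_ge0 ?(ltW (glw_gt0 _ _))// subr_ge0 ltW.
Qed.

(** Coefficient form of [(1 - z) f' = (a + b) f] for the product [f] of the two series: the
    convolution obeys the recurrence [glwS] of [glw (a + b)]. For [a + b] equal to 1 or 0 the
    solution is explicit. *)
Lemma glw_conv a b m :
  m.+1%:R * \sum_(i < m.+2) glw a i * glw b (m.+1 - i) =
  (m%:R + a + b) * \sum_(i < m.+1) glw a i * glw b (m - i).
Proof.
(* Leibniz rule: [m.+1] is split as [i + (m.+1 - i)], one summand for each factor. *)
transitivity (\sum_(i < m.+2) i%:R * glw a i * glw b (m.+1 - i) +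
  \sum_(i < m.+2) (m.+1 - i)%:R * glw b (m.+1 - i) * glw a i).
  rewrite mulr_sumr -big_split /=; apply: eq_bigr => i _.
  by rewrite natrB ?leq_ord //; ring.
rewrite big_ord_recl !mul0r add0r [X in _ + X]big_ord_recr /= subnn !mul0r addr0.
rewrite -big_split mulr_sumr /=; apply: eq_bigr => i _.
rewrite /bump /= add1n subSS glwS subSn ?leq_ord // glwS natrB ?leq_ord //.
ring.
Qed.

Lemma glw_conv1 g m : \sum_(i < m.+1) glw g i * glw (1 - g) (m - i) = 1.
Proof.
elim: m => [|m IHm]; first by rewrite big_ord1 !glw0 mulr1.
have /mulfI : m.+1%:R != 0 :> R by rewrite pnatr_eq0.
by apply; rewrite glw_conv IHm -addrA subrKC natr1.
Qed.

Lemma glw_conv0 g m :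
  \sum_(i < m.+1) glw g i * glw (- g) (m - i) = (m == 0)%N%:R.
Proof.
elim: m => [|m IHm]; first by rewrite big_ord1 !glw0 mulr1.
have /mulfI : m.+1%:R != 0 :> R by rewrite pnatr_eq0.
apply; rewrite glw_conv IHm -addrA subrr addr0 /= mulr0.
by case: m {IHm} => [|m]; rewrite ?mul0r // mulr0.
Qed.

Lemma glw_sum g m : g != 0 -> \sum_(j < m) glw g j = glw g m * m%:R / g.
Proof.
move=> g0; elim: m => [|m IHm]; first by rewrite big_ord0 mulr0 mul0r.
rewrite big_ord_recr /= IHm mulrC [glw _ m.+1 * _]mulrC glwS.
by field.
Qed.

(** The derivative of [(1 - z) ^ g] is [- g (1 - z) ^ (g - 1)]; this fixes the sign of the inverse
    weights. *)
Lemma glwNS g m : m.+1%:R * glw (- g) m.+1 = - g * glw (1 - g) m.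
Proof.
elim: m => [|m IHm]; first by rewrite glwS !glw0 add0r.
have m0 : m.+1%:R != 0 :> R by rewrite pnatr_eq0.
apply: (mulfI m0); rewrite glwS mulrCA IHm mulrCA [m.+1%:R * (_ * _)]mulrCA.
by rewrite glwS -natr1; ring.
Qed.

(** Coefficients of [(1 - z) ^ g = (1 - z) (1 - z) ^ (g - 1)]; the partial sums of the inverse
    weights telescope by it. *)
Lemma glwNSB g m : glw (- g) m.+1 = glw (1 - g) m.+1 - glw (1 - g) m.
Proof.
have m0 : m.+1%:R != 0 :> R by rewrite pnatr_eq0.
apply: (mulfI m0); rewrite mulrBr glwNS glwS -natr1; ring.
Qed.

Lemma gbinomE g m : (-1) ^+ m * gbinom g m = glw (- g) m.
Proof.
elim: m => [|m IHm]; first by rewrite /gbinom !big_ord0 fact0 divr1 mul1r glw0.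
rewrite glwSE -IHm /gbinom big_ord_recr /= factS natrM exprS invfM; ring.
Qed.

Lemma glwN_sum g m : \sum_(j < m.+1) glw (- g) j = glw (1 - g) m.
Proof.
elim: m => [|m IHm]; first by rewrite big_ord1 !glw0.
by rewrite big_ord_recr /= IHm glwNSB addrC subrK.
Qed.

Lemma glwN_le0 g m : 0 < g < 1 -> glw (- g) m.+1 <= 0.
Proof.
move=> /andP[g0 g1]; have m0 : 0 < m.+1%:R :> R by rewrite ltr0n.
rewrite -(pmulr_rle0 _ m0) glwNS mulNr oppr_le0 mulr_ge0 ?ltW//.
by rewrite glw_gt0 // subr_gt0.
Qed.

(** Weighted sums of shifts compose like power series in the shift. As [F] vanishes from [N] on,
    cutting all sums at [N] loses nothing. *)
Lemma toeplitz_comp (a b F : nat -> R) N :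
  (forall k, (N <= k)%N -> F k = 0) ->
  \sum_(i < N) a i * (\sum_(j < N) b j * F (i + j)%N) =
  \sum_(k < N) (\sum_(i < k.+1) a i * b (k - i)%N) * F k.
Proof.
move=> F0.
transitivity (\sum_(i < N) \sum_(k < N | (i <= k)%N) a i * b (k - i)%N * F k).
  apply: eq_bigr => i _; rewrite mulr_sumr.
  transitivity (\sum_(0 <= j < N - i) a i * (b j * F (i + j)%N)).
    rewrite -(big_mkord xpredT (fun j => a i * (b j * F (i + j)%N))).
    rewrite (@big_cat_nat _ _ _ (N - i)) ?leq_subr //= [X in _ + X]big1_seq ?addr0 //.
    move=> j /=; rewrite mem_index_iota => /andP[Nj _].
    by rewrite F0 ?mulr0 // -leq_subLR.
  rewrite -(big_mkord (fun k => (i <= k)%N) (fun k => a i * b (k - i)%N * F k)).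
  rewrite [RHS]big_mkcond (@big_cat_nat _ _ _ i) /=; [|by []|exact: ltnW].
  rewrite [X in _ = X + _]big1_seq ?add0r; last first.
    by move=> k; rewrite mem_index_iota => /= /ltn_geF ->.
  rewrite -[in RHS](add0n (val i)) big_addn /=; apply: eq_big_nat => j _.
  by rewrite leq_addl addnK addnC mulrA.
rewrite (exchange_big_dep xpredT) //=; apply: eq_bigr => k _.
rewrite mulr_suml (big_ord_widen_cond N xpredT
  (fun i => a i * b (k - i)%N * F k)) //.
Qed.

(* Discrete form of [|e|^2 <= 2 I^g <e, D^g e>]: the inverse weights
   [glw (- g)] are nonpositive except the first one, and their partial sums
   [glw (1 - g)] are positive. *)
Lemma glw_square g (F : nat -> R) N : 0 < g < 1 ->
  (forall k, (N <= k)%N -> F k = 0) ->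
  (\sum_(j < N) glw g j * F j) ^+ 2 <=
  2 * \sum_(i < N) glw g i * ((\sum_(j < N) glw g j * F (i + j)%N) * F i).
Proof.
move=> g01 F0; have /andP[g0 g1] := g01.
pose E i := \sum_(j < N) glw g j * F (i + j)%N.
rewrite -[X in X ^+ 2]/(E 0%N) -/(\sum_(i < N) glw g i * (E i * F i)).
have E0 k : (N <= k)%N -> E k = 0.
  move=> Nk; rewrite /E big1 // => j _.
  by rewrite F0 ?mulr0 // (leq_trans Nk) ?leq_addr.
case: N F0 @E E0 => [|N] F0 E E0.
  by rewrite {1}/E !big_ord0 expr0n mulr0.
have FE i : F i = \sum_(j < N.+1) glw (- g) j * E (i + j)%N.
  transitivity (\sum_(j < N.+1) glw (- g) j *
      (\sum_(l < N.+1) glw g l * F (i + (j + l))%N)); last first.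
    by apply: eq_bigr => j _; congr (_ * _); apply: eq_bigr => l _;
      rewrite addnA.
  rewrite (@toeplitz_comp _ _ (fun k => F (i + k)%N)); last first.
    by move=> k Nk; rewrite F0 // (leq_trans Nk) ?leq_addl.
  have C k := glw_conv0 (- g) k; rewrite opprK in C.
  under eq_bigr => k _ do rewrite C.
  rewrite big_ord_recl big1 => [|k _]; last by rewrite /= mul0r.
  by rewrite /= mul1r addr0 addn0.
(* The same inverse pair of weights, applied to the squares [E k ^+ 2], puts [E 0 ^+ 2] under the
   outer sum of the right-hand side, so that the comparison is term by term. *)
have -> : E 0%N ^+ 2 = \sum_(i < N.+1) glw g i *
    (\sum_(j < N.+1) glw (- g) j * E (i + j)%N ^+ 2).
  rewrite (@toeplitz_comp _ _ (fun k => E k ^+ 2)); last first.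
    by move=> k Nk; rewrite E0 // expr0n.
  under [RHS]eq_bigr => k _ do rewrite glw_conv0.
  rewrite [RHS]big_ord_recl big1 => [|k _]; last by rewrite /= mul0r.
  by rewrite /= mul1r addr0.
rewrite mulr_sumr; apply: ler_sum => i _.
rewrite mulrCA ler_wpM2l ?(ltW (glw_gt0 _ _))//.
rewrite -subr_ge0 {1}FE !mulr_sumr -sumrB.
(* Completing the square, [2 E_i E_k - E_k^2 = E_i^2 - (E_i - E_k)^2], leaves a partial sum of the
   weights and squares among which the one of index 0, with the only positive weight, vanishes. *)
have -> : \sum_(j < N.+1) (2 * (E i * (glw (- g) j * E (i + j)%N)) -
    glw (- g) j * E (i + j)%N ^+ 2) =
    E i ^+ 2 * (\sum_(j < N.+1) glw (- g) j) -
    \sum_(j < N.+1) glw (- g) j * (E i - E (i + j)%N) ^+ 2.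
  by rewrite mulr_sumr -sumrB; apply: eq_bigr => j _; ring.
rewrite glwN_sum big_ord_recl addn0 subrr expr0n mulr0 add0r.
apply: addr_ge0.
  by rewrite mulr_ge0 ?sqr_ge0 ?(ltW (glw_gt0 _ _)) ?subr_gt0.
rewrite oppr_ge0 sumr_le0 // => j _.
by rewrite mulr_le0_ge0 ?sqr_ge0 //= glwN_le0.
Qed.

End Weights.

(** * The Gamma function *)

Section CompletedLebesgue.
Context {R : realType}.
Notation mu := (@lebesgue_measure R).
Notation cmu := (@completed_lebesgue_measure R).
Local Open Scope ereal_scope.

Lemma lebesgue_measurable_set (A : set R) :
  measurable A -> measurable (A : set (lebesgueType R)).
Proof. exact: sub_caratheodory. Qed.

Lemma lebesgue_measurable_id :
  measurable_fun [set: lebesgueType R] (id : lebesgueType R -> measurableTypeR R).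
Proof. by move=> _ Y mY; rewrite setTI; exact: lebesgue_measurable_set. Qed.

Lemma lebesgue_measurable_fun d (S : measurableType d) (D : set R) (f : R -> S) :
  measurable D -> measurable_fun D f ->
  measurable_fun (D : set (lebesgueType R)) (f : lebesgueType R -> S).
Proof.
move=> mD mf.
rewrite -[D in measurable_fun D](preimage_id D) -(setTI (_ @^-1` _)).
by move=> _ Y mY; apply: lebesgue_measurable_set; rewrite setTI; exact: mf.
Qed.

(** The identity from the Lebesgue to the Borel sigma-algebra pushes the completed measure forward
    to the Borel one, so this is a change of variables. It gives access to the fundamental theorem
    of calculus for the integrals of the statement. *)
Lemma ge0_integral_completed (D : set R) (f : R -> \bar R) :
  measurable D -> measurable_fun D f -> (forall x, D x -> 0 <= f x) ->
  \int[cmu]_(x in D) f x = \int[mu]_(x in D) f x.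
Proof.
move=> mD mf f0.
pose idm : {mfun lebesgueType R >-> measurableTypeR R} := HB.pack
  (id : lebesgueType R -> measurableTypeR R)
  (isMeasurableFun.Build _ _ _ _ _ lebesgue_measurable_id).
transitivity (\int[pushforward cmu idm]_(x in D) f x).
  rewrite (@ge0_integral_pushforward _ _ _ _ _ _ lebesgue_measurable_id) //.
  by move=> y; rewrite inE; exact: f0.
exact: eq_measure_integral.
Qed.

Lemma ge0_integral_bigcup_le (F : (set R)^nat) (f : R -> \bar R) (C : \bar R) :
  nondecreasing_seq F -> (forall n, measurable (F n)) ->
  measurable_fun (\bigcup_n F n) f -> (forall x, (\bigcup_n F n) x -> 0 <= f x) ->
  (forall n, \int[mu]_(x in F n) f x <= C) ->
  \int[mu]_(x in \bigcup_n F n) f x <= C.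
Proof.
move=> ndF mF mf f0 FC.
have cvgF : \int[mu]_(x in F n) f x @[n --> \oo] -->
    \int[mu]_(x in \bigcup_n F n) f x.
  apply: ge0_nondecreasing_set_cvg_integral => //.
  - move=> n; apply: measurable_funS mf; last exact: bigcup_sup.
    exact: bigcupT_measurable.
  - by move=> n x Fx; apply: f0; exists n.
rewrite -(cvg_lim _ cvgF)//; apply: lime_le; last exact: nearW.
by apply/cvg_ex; eexists; exact: cvgF.
Qed.

End CompletedLebesgue.

(** * Euler's integral and its functional equation *)

Section GammaFunction.
Context {R : realType}.
Notation mu := (@lebesgue_measure R).
Notation cmu := (@completed_lebesgue_measure R).
Implicit Types (a c s x : R).

Lemma FTC2_segment (f F : R -> R) a b : a < b ->
  (forall x, a <= x <= b -> is_derive x 1 F (f x)) ->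
  (forall x, a <= x <= b -> {for x, continuous f}) ->
  (\int[mu]_(x in `[a, b]) (f x)%:E = (F b - F a)%:E)%E.
Proof.
move=> ab dF cf.
have cF x : a <= x <= b -> F @ x --> F x.
  move=> xab; apply/differentiable_continuous/derivable1_diffP; apply: ex_derive.
  exact: dF.
rewrite EFinB; apply: continuous_FTC2 => //.
- apply: continuous_in_subspaceT => x; rewrite inE /= in_itv /=; exact: cf.
- split.
  + by move=> x; rewrite in_itv /= => /andP[ax xb]; apply: ex_derive;
      apply: dF; rewrite !ltW.
  + by apply: cvg_at_right_filter; apply: cF; rewrite lexx ltW.
  + by apply: cvg_at_left_filter; apply: cF; rewrite lexx ltW.
- move=> x; rewrite in_itv /= => /andP[ax xb].
  by rewrite derive1E; apply: derive_val; apply: dF; rewrite !ltW.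
Qed.

Definition gamma_pdf a x : R := x `^ (a - 1) * expR (- x).

Lemma gamma_pdf_ge0 a x : 0 <= gamma_pdf a x.
Proof. by rewrite mulr_ge0 ?powR_ge0 ?expR_ge0. Qed.

Lemma measurable_gamma_pdf a (D : set R) :
  measurable_fun D (EFin \o gamma_pdf a).
Proof.
apply: measurable_funTS; apply/measurable_EFinP; apply: measurable_funM.
  exact: measurable_powR.
apply: measurableT_comp; first exact: measurable_expR.
by apply: oppr_measurable.
Qed.

Lemma is_derive_powR_expRN a x : 0 < x ->
  is_derive x 1 (fun x => - (x `^ a * expR (- x)))
    (gamma_pdf (a + 1) x - a * gamma_pdf a x).
Proof.
move=> x0; rewrite /gamma_pdf.
have dp := is_derive1_powR a x0.
have de : is_derive x 1 (fun x : R => expR (- x)) (- expR (- x)).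
  by apply: is_derive_eq; rewrite /GRing.scale /=; ring.
have -> : x `^ (a + 1 - 1) * expR (- x) - a * (x `^ (a - 1) * expR (- x)) =
    - (x `^ a *: - expR (- x) + expR (- x) *: (a * x `^ (a - 1))).
  by rewrite /GRing.scale /= addrK; ring.
exact: (is_deriveN (is_deriveM dp de)).
Qed.

Lemma continuous_gamma_pdf a x : 0 < x -> {for x, continuous (gamma_pdf a)}.
Proof.
move=> x0; have dp := is_derive1_powR (a - 1) x0.
have de : is_derive x 1 (fun x : R => expR (- x)) (- expR (- x)).
  by apply: is_derive_eq; rewrite /GRing.scale /=; ring.
apply/differentiable_continuous/derivable1_diffP.
exact: (@ex_derive _ _ _ _ _ _ _ (is_deriveM dp de)).
Qed.

(** A single term, of degree [k.+1], of the exponential series suffices. *)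
Lemma powR_expRN_le (k : nat) a x : 1 <= x -> a <= k%:R ->
  x `^ a * expR (- x) <= k.+1`!%:R / x.
Proof.
move=> x1 ak; have x0 : 0 < x by exact: lt_le_trans x1.
rewrite expRN ler_pdivrMr ?expR_gt0 // mulrAC ler_pdivlMr //.
apply: (@le_trans _ _ (x ^+ k.+1)).
  by rewrite exprSr ler_pM2r // -powR_mulrn ?(ltW x0) // ler_powR.
have k0 : 0 < k.+1`!%:R :> R by rewrite ltr0n fact_gt0.
rewrite mulrC -ler_pdivrMr //.
by apply: le_trans (expR_ge1Dxn k (ltW x0)); rewrite lerDr.
Qed.

(** Concavity of the power, read off from the convexity of [expR] between [ln (x / c)] and 0 with
    weight [s]. *)
Lemma powR_tangent s c x : 0 <= s <= 1 -> 0 < c -> 0 < x ->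
  x `^ s <= c `^ s * (1 - s + s * (x / c)).
Proof.
move=> s01 c0 x0; have xc : 0 < x / c by rewrite divr_gt0.
have -> : x `^ s = c `^ s * (x / c) `^ s.
  by rewrite -powRM ?ltW // mulrC divfK ?gt_eqF.
rewrite ler_pM2l ?powR_gt0 //.
have := @convex_expR R (Itv01 (andP s01).1 (andP s01).2) (ln (x / c)) 0.
rewrite !convRE /= expR0 !mulr0 addr0 mulr1 lnK ?posrE //.
by rewrite /powR gt_eqF // [X in _ -> _ <= X]addrC.
Qed.

(** Compact exhaustion of the open half line, away from the singularity at 0; [k.+2] keeps the two
    endpoints distinct already for [k = 0]. *)
Let J (k : nat) : set R := `[k.+2%:R^-1, k.+2%:R].

Let JE : \bigcup_k J k = `]0, +oo[%classic.
Proof.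
apply/seteqP; split=> [x [k _]|x]; rewrite /J /= !in_itv /= ?andbT.
  by move=> /andP[+ _]; apply: lt_le_trans; rewrite invr_gt0 ltr0n.
move=> x0; have xx : 0 <= x + x^-1 by apply: addr_ge0; rewrite ?invr_ge0 ltW.
exists (Num.truncn (x + x^-1)) => //=; rewrite in_itv /=.
have lt2 : x + x^-1 < (Num.truncn (x + x^-1)).+2%:R.
  by apply: (lt_trans (truncnS_gt _)); rewrite ltr_nat.
apply/andP; split.
  rewrite -[leRHS]invrK lef_pV2 ?posrE ?ltr0n ?invr_gt0 //.
  by rewrite (le_trans _ (ltW lt2)) // lerDr ltW.
by rewrite (le_trans _ (ltW lt2)) // lerDl invr_ge0 ltW.
Qed.

Let ndJ : nondecreasing_seq J.
Proof.
move=> k l kl; apply/subsetPset => x; rewrite /J /= !in_itv /= => /andP[kx xk].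
have kl' : k.+2%:R <= l.+2%:R :> R by rewrite ler_nat !ltnS.
rewrite (le_trans xk kl') andbT (le_trans _ kx) //.
by rewrite lef_pV2 ?posrE ?ltr0n.
Qed.

Let mJ k : measurable (J k : set (measurableTypeR R)). Proof. exact: measurable_itv. Qed.

Let J_gt0 k x : J k x -> 0 < x.
Proof.
rewrite /J /= in_itv /= => /andP[+ _]; apply: lt_le_trans.
by rewrite invr_gt0 ltr0n.
Qed.

Let J_lt k : k.+2%:R^-1 < k.+2%:R :> R.
Proof.
apply: (@lt_trans _ _ 1); last by rewrite ltr1n.
by rewrite invf_lt1 ?ltr0n ?ltr1n.
Qed.

Definition egamma a : \bar R := (\int[mu]_(x in `]0%R, +oo[) (gamma_pdf a x)%:E)%E.

Let egamma_cvg a :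
  (\int[mu]_(x in J k) (gamma_pdf a x)%:E @[k --> \oo] --> egamma a)%E.
Proof.
rewrite /egamma -JE; apply: ge0_nondecreasing_set_cvg_integral => //.
- by move=> k; exact: measurable_gamma_pdf.
- by move=> k x _; rewrite lee_fin gamma_pdf_ge0.
Qed.

Let J_integrable a k : mu.-integrable (J k) (EFin \o gamma_pdf a).
Proof.
apply: continuous_compact_integrable; first exact: segment_compact.
apply: continuous_in_subspaceT => x; rewrite inE => /J_gt0.
exact: continuous_gamma_pdf.
Qed.

Let J_parts a k :
  (\int[mu]_(x in J k) (gamma_pdf (a + 1) x)%:E =
   a%:E * \int[mu]_(x in J k) (gamma_pdf a x)%:E +
   (k.+2%:R^-1 `^ a * expR (- k.+2%:R^-1) - k.+2%:R `^ a * expR (- k.+2%:R))%:E)%E.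
Proof.
have J0 x : k.+2%:R^-1 <= x <= k.+2%:R -> 0 < x.
  by move=> xk; apply: (@J_gt0 k); rewrite /J /= in_itv.
have hd x : k.+2%:R^-1 <= x <= k.+2%:R ->
    is_derive x 1 (fun x => - (x `^ a * expR (- x)))
      (gamma_pdf (a + 1) x - a * gamma_pdf a x).
  by move=> /J0 x0; exact: is_derive_powR_expRN.
have hc x : k.+2%:R^-1 <= x <= k.+2%:R ->
    {for x, continuous (fun x => gamma_pdf (a + 1) x - a * gamma_pdf a x)}.
  move=> /J0 x0; apply: continuousB; first exact: continuous_gamma_pdf.
  by apply: continuousM; [exact: cst_continuous|exact: continuous_gamma_pdf].
have := FTC2_segment (J_lt k) hd hc.
rewrite opprK [X in _ = X%:E -> _]addrC => <-.
have iZ := integrableZl (mJ k) a (J_integrable a k).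
rewrite -integralZl; [|exact: mJ|exact: J_integrable].
rewrite -/(J k) [X in (_ + X)%E](_ : _ = \int[mu]_(x in J k)
  ((gamma_pdf (a + 1) x)%:E - a%:E * (gamma_pdf a x)%:E))%E; last first.
  by apply: eq_integral => x _; rewrite EFinB EFinM.
rewrite integralB; [|exact: mJ|exact: J_integrable|exact: iZ].
have fZ := integrable_fin_num (mJ k) iZ.
by rewrite addeCA subee ?adde0.
Qed.

Let cvg_invS2 : (k.+2%:R^-1 : R) @[k --> \oo] --> (0 : R).
Proof.
apply: (@squeeze_cvgr _ _ _ _ (fun=> 0) (fun k => k.+1%:R^-1)).
- apply: nearW => k; rewrite invr_ge0 ler0n /=.
  by rewrite lef_pV2 ?posrE ?ltr0n // ler_nat.
- exact: cvg_cst.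
- exact: cvg_harmonic.
Qed.

Lemma egammaS a : 0 < a -> egamma (a + 1) = (a%:E * egamma a)%E.
Proof.
move=> a0; rewrite -(cvg_lim _ (@egamma_cvg (a + 1)))//; apply: cvg_lim => //.
rewrite (funext (J_parts a)) -[X in _ --> X]adde0; apply: cvgeD => //.
- by rewrite fin_num_adde_defl.
- by apply: cvgeZl => //; exact: egamma_cvg.
apply: cvg_EFin; first exact: nearW.
rewrite -[X in _ --> X](subr0 0); apply: cvgB.
  rewrite -[X in _ --> X](mul0r 1); apply: cvgM.
    apply: ((cvg_at_rightP _ _ _).1 (powR_cvg0 a0)); split; last exact: cvg_invS2.
    by move=> k; rewrite invr_gt0 ltr0n.
  rewrite -[X in _ --> X]expR0; apply: continuous_cvg.
    exact: continuous_expR.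
  by rewrite -[X in _ --> X]oppr0; apply: cvgN; exact: cvg_invS2.
pose m := (Num.truncn a).+1.
have am : a <= m%:R by rewrite ltW // truncnS_gt.
apply: (@squeeze_cvgr _ _ _ _ (fun=> 0) (fun k => m.+1`!%:R * k.+2%:R^-1)).
- apply: nearW => k; rewrite mulr_ge0 ?powR_ge0 ?expR_ge0 //=.
  by apply: powR_expRN_le => //; rewrite ler1n.
- exact: cvg_cst.
- rewrite -[X in _ --> X](mulr0 (m.+1`!%:R)); apply: cvgM; last exact: cvg_invS2.
  exact: cvg_cst.
Qed.

Lemma egamma_ge0 a : (0 <= egamma a)%E.
Proof. by apply: integral_ge0 => x _; rewrite lee_fin gamma_pdf_ge0. Qed.

Lemma egamma1 : egamma 1 = 1%E.
Proof.
rewrite -(cvg_lim _ (@egamma_cvg 1)) //; apply: cvg_lim => //.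
have -> : (fun k => \int[mu]_(x in J k) (gamma_pdf 1 x)%:E)%E =
    (fun k => (expR (- k.+2%:R^-1) - expR (- k.+2%:R))%:E).
  apply/funext => k.
  have hd x : k.+2%:R^-1 <= x <= k.+2%:R ->
      is_derive x 1 (fun x => - expR (- x)) (gamma_pdf 1 x).
    move=> _; rewrite /gamma_pdf subrr powRr0 mul1r.
    by apply: is_derive_eq; rewrite /GRing.scale /=; ring.
  have hc x : k.+2%:R^-1 <= x <= k.+2%:R -> {for x, continuous (gamma_pdf 1)}.
    move=> /andP[kx _]; apply: continuous_gamma_pdf.
    by apply: lt_le_trans kx; rewrite invr_gt0 ltr0n.
  by rewrite (FTC2_segment (J_lt k) hd hc) opprK addrC.
apply: cvg_EFin; first exact: nearW.
rewrite -[X in _ --> X]subr0; apply: cvgB.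
  rewrite -[X in _ --> X]expR0; apply: continuous_cvg.
    exact: continuous_expR.
  by rewrite -[X in _ --> X]oppr0; apply: cvgN; exact: cvg_invS2.
apply: (@squeeze_cvgr _ _ _ _ (fun=> 0) (fun k => k.+2%:R^-1)).
- apply: nearW => k; rewrite expR_ge0 /= -[leRHS]mul1r.
  have := @powR_expRN_le 0 0 k.+2%:R; rewrite powRr0 mul1r.
  by apply; rewrite ?ler1n.
- exact: cvg_cst.
- exact: cvg_invS2.
Qed.

Lemma le_egammaD a b c p q : 0 <= p -> 0 <= q ->
  (forall x, 0 < x -> gamma_pdf b x <= p * gamma_pdf a x + q * gamma_pdf c x) ->
  (egamma b <= p%:E * egamma a + q%:E * egamma c)%E.
Proof.
move=> p0 q0 bac; rewrite /egamma.
have mg e : measurable_fun (`]0%R, +oo[ : set (measurableTypeR R))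
    (EFin \o gamma_pdf e) by exact: measurable_gamma_pdf.
have mI : measurable (`]0%R, +oo[ : set (measurableTypeR R)).
  exact: measurable_itv.
have mZ r e : measurable_fun (`]0%R, +oo[ : set (measurableTypeR R))
    (fun x => r%:E * (gamma_pdf e x)%:E)%E.
  by apply: emeasurable_funM; [exact: measurable_cst|exact: mg].
have g0 e x : (0 <= (gamma_pdf e x)%:E)%E by rewrite lee_fin gamma_pdf_ge0.
rewrite -!ge0_integralZl //; try exact: mg.
rewrite -ge0_integralD //; try exact: mZ; last 2 first.
- by move=> x _; rewrite mule_ge0.
- by move=> x _; rewrite mule_ge0.
apply: ge0_le_integral => //; try exact: mg.
- by apply: emeasurable_funD; exact: mZ.
- by move=> x; rewrite /= in_itv /= andbT => x0; rewrite lee_fin bac.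
Qed.

Lemma egamma2 : egamma 2 = 1%E.
Proof. by rewrite egammaS // egamma1 mule1. Qed.

(** Integration by parts on [J k] trades the singularity at 0 for the factor [a^-1]: since
    [x ^ a <= 1 + x], the integral for [a + 1] is at most [egamma 1 + egamma 2 = 2], and the
    boundary term at [k.+2] is at most 1. *)
Lemma egamma_fin_lt1 a : 0 < a < 1 -> egamma a \is a fin_num.
Proof.
move=> /andP[a0 a1]; rewrite ge0_fin_numE ?egamma_ge0 //.
apply: (@le_lt_trans _ _ (a^-1 * 3)%:E); last exact: ltry.
rewrite /egamma -JE; apply: ge0_integral_bigcup_le => //.
- by rewrite JE; exact: measurable_gamma_pdf.
- by move=> x _; rewrite lee_fin gamma_pdf_ge0.
move=> k; rewrite -(@lee_pmul2l _ a%:E) // -EFinM mulVKf ?gt_eqF //.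
have ea : (egamma (a + 1) <= 1%:E * egamma 1 + 1%:E * egamma 2)%E.
  apply: le_egammaD => // x x0; rewrite !mul1r -mulrDl ler_wpM2r ?expR_ge0 //.
  rewrite subrr powRr0 addrK (_ : 2 - 1 = 1); last by ring.
  have a01 : 0 <= a <= 1 by rewrite !ltW.
  have := powR_tangent a01 ltr01 x0.
  rewrite powR1 divr1 mul1r (powRr1 (ltW x0)) => /le_trans; apply.
  by rewrite lerD ?ler_piMl ?(ltW a1) ?(ltW x0) // gerBl ltW.
rewrite egamma1 egamma2 !mule1 in ea.
have eJ : (\int[mu]_(x in J k) (gamma_pdf (a + 1) x)%:E <= 2%:E)%E.
  apply: le_trans ea; rewrite /egamma; apply: ge0_subset_integral.
  - exact: mJ.
  - exact: measurable_itv.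
  - exact: measurable_gamma_pdf.
  - by move=> x _; rewrite lee_fin gamma_pdf_ge0.
  - by move=> x /J_gt0; rewrite /= in_itv /= andbT.
have fJ := integrable_fin_num (mJ k) (J_integrable a k).
have := J_parts a k; rewrite -(fineK fJ) -EFinM => JP.
move: eJ; rewrite JP -EFinD !lee_fin.
have r1 : k.+2%:R `^ a * expR (- k.+2%:R) <= 1 :> R.
  apply: (@le_trans _ _ (2`!%:R / k.+2%:R)).
    by apply: powR_expRN_le; rewrite ?ler1n // ltW.
  by rewrite ler_pdivrMr ?ltr0n // mul1r ler_nat.
have s0 : 0 <= k.+2%:R^-1 `^ a * expR (- k.+2%:R^-1) :> R.
  by rewrite mulr_ge0 ?powR_ge0 ?expR_ge0.
move: r1 s0; set u := _ * expR _; set v := _ * expR _; set w := _ * _.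
lra.
Qed.

Lemma egamma_fin a : 0 < a -> egamma a \is a fin_num.
Proof.
have fin m : forall a, 0 < a -> a <= m%:R -> egamma a \is a fin_num.
  elim: m => [|m IHm] {}a a0 am; first by move: am; rewrite leNgt a0.
  have [a1|a1|->] := ltgtP a 1; last by rewrite egamma1.
    by apply: egamma_fin_lt1; rewrite a0.
  rewrite -(subrK 1 a) egammaS ?subr_gt0 // fin_numM //.
  by rewrite IHm ?subr_gt0 // lerBlDr natr1.
by move=> a0; apply: (fin (Num.truncn a).+1) => //; rewrite ltW ?truncnS_gt.
Qed.

Lemma GammaE a : Gamma a = fine (egamma a).
Proof.
rewrite /Gamma /Rintegral ge0_integral_completed //.
- congr fine; rewrite /egamma.
  rewrite -integral_itv_obnd_cbnd //; exact: measurable_gamma_pdf.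
- exact: measurable_gamma_pdf.
- by move=> x _; rewrite lee_fin gamma_pdf_ge0.
Qed.

Lemma GammaS a : 0 < a -> Gamma (a + 1) = a * Gamma a.
Proof. by move=> a0; rewrite !GammaE egammaS // fineM // egamma_fin. Qed.

Lemma Gamma1 : Gamma 1 = 1 :> R.
Proof. by rewrite GammaE egamma1. Qed.

Lemma Gamma_ge0 a : 0 <= Gamma a.
Proof. by rewrite GammaE fine_ge0 // egamma_ge0. Qed.

(* Wendel's inequality, from the tangent line of [x `^ s] at [a]. *)
Lemma Gamma_wendel a s : 0 < a -> 0 <= s <= 1 -> Gamma (a + s) <= a `^ s * Gamma a.
Proof.
move=> a0 s01; rewrite !GammaE.
have fa := egamma_fin a0; have as0 : 0 < a + s by rewrite ltr_wpDr ?(andP s01).1.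
have p0 : 0 <= a `^ s * (1 - s).
  by rewrite mulr_ge0 ?powR_ge0 // subr_ge0 (andP s01).2.
have q0 : 0 <= a `^ s * (s / a).
  by rewrite mulr_ge0 ?powR_ge0 // divr_ge0 ?(andP s01).1 ?ltW.
have : (egamma (a + s) <= (a `^ s * (1 - s))%:E * egamma a +
    (a `^ s * (s / a))%:E * egamma (a + 1))%E.
  apply: le_egammaD => // x x0; rewrite /gamma_pdf.
  have -> : x `^ (a + s - 1) = x `^ s * x `^ (a - 1).
    by rewrite -powRD ?(gt_eqF x0) ?implybT // [in RHS]addrCA addrA.
  rewrite [x `^ (a + 1 - 1)](_ : _ = x `^ (a - 1) * x); last first.
    by rewrite mulrC mulr_powRB1 ?addrK // ltW.
  set y := x `^ (a - 1); set e := expR _.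
  have ye0 : 0 <= y * e by rewrite mulr_ge0 ?powR_ge0 ?expR_ge0.
  rewrite -[leLHS]mulrA; apply: le_trans (ler_wpM2r ye0 (powR_tangent s01 a0 x0)) _.
  by rewrite le_eqVlt; apply/orP; left; apply/eqP; ring.
rewrite egammaS // -(fineK fa) -(fineK (egamma_fin as0)) -!EFinM -EFinD lee_fin.
move=> /le_trans; apply; rewrite le_eqVlt; apply/orP; left; apply/eqP.
by field; rewrite gt_eqF.
Qed.

End GammaFunction.

(** * Power bounds for the weights and their exponential sums *)

Section WeightBounds.
Context {R : realType}.
Implicit Types (g h x : R) (j m N : nat).

Lemma Gamma_glw g m : 0 < g -> Gamma (g + m%:R) = Gamma g * glw g m * m`!%:R.
Proof.
move=> g0; elim: m => [|m IHm]; first by rewrite addr0 glw0 fact0 !mulr1.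
rewrite -natr1 addrA GammaS ?ltr_wpDr // IHm factS natrM.
have -> : Gamma g * glw g m.+1 * (m.+1%:R * m`!%:R) =
  Gamma g * (m.+1%:R * glw g m.+1) * m`!%:R by ring.
by rewrite glwS; ring.
Qed.

Lemma Gamma_nat m : Gamma m.+1%:R = m`!%:R :> R.
Proof.
elim: m => [|m IHm]; first by rewrite Gamma1.
by rewrite -natr1 GammaS ?ltr0n // IHm factS natrM.
Qed.

(** Wendel's inequality from [g + m] with exponent [1 - g] reaches [m.+1], where Gamma is a
    factorial. The upper bound [glw_ub] starts from [m.+1] with exponent [g] instead. *)
Lemma glw_lb g m : 0 < g < 1 -> m.+1%:R `^ (g - 1) <= Gamma g * glw g m.
Proof.
move=> /andP[g0 g1].
have m0 : 0 < m`!%:R :> R by rewrite ltr0n fact_gt0.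
have gm0 : 0 < g + m%:R by rewrite ltr_wpDr.
have s01 : 0 <= 1 - g <= 1 by rewrite subr_ge0 gerBl !ltW.
have := Gamma_wendel gm0 s01.
have -> : g + m%:R + (1 - g) = m.+1%:R by rewrite -natr1; ring.
rewrite Gamma_nat Gamma_glw // => H.
have {}H : 1 <= (g + m%:R) `^ (1 - g) * (Gamma g * glw g m).
  by rewrite -(ler_pM2r m0) mul1r -mulrA.
have GW0 : 0 <= Gamma g * glw g m.
  by rewrite mulr_ge0 ?Gamma_ge0 // ltW // glw_gt0.
have -> : g - 1 = - (1 - g) by rewrite opprB.
rewrite powRN -[leLHS]mulr1 ler_pdivrMl ?powR_gt0 ?ltr0n //.
apply: (le_trans H); rewrite ler_wpM2r //.
rewrite ge0_ler_powR ?nnegrE ?(andP s01).1 ?(ltW gm0) //.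
by rewrite -natr1 addrC lerD2l ltW.
Qed.

Lemma glw_ub g m : 0 < g < 1 -> Gamma g * glw g m.+1 <= m.+1%:R `^ (g - 1).
Proof.
move=> /andP[g0 g1].
have m0 : 0 < m`!%:R :> R by rewrite ltr0n fact_gt0.
have m1 : 0 < m.+1%:R :> R by rewrite ltr0n.
have g01 : 0 <= g <= 1 by rewrite !ltW.
have := Gamma_wendel m1 g01.
rewrite addrC Gamma_glw // Gamma_nat factS natrM mulrA ler_pM2r //.
rewrite -ler_pdivlMr // => /le_trans; apply.
by rewrite powRB ?powRr1 ?(gt_eqF m1) ?implybT // ltW.
Qed.

Lemma Gamma_ge1 g : 0 < g < 1 -> 1 <= Gamma g.
Proof. by move=> /(glw_lb 0); rewrite glw0 mulr1 powR1. Qed.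

Lemma Gamma_gt0 g : 0 < g < 1 -> 0 < Gamma g.
Proof. by move=> /Gamma_ge1; apply: lt_le_trans. Qed.

Lemma glw_powR_le g m : 0 < g < 1 -> glw g m.+1 <= m.+1%:R `^ (g - 1).
Proof.
move=> g01; apply: le_trans (glw_ub m g01).
by rewrite ler_peMl ?Gamma_ge1 // ltW // glw_gt0 ?(andP g01).1.
Qed.

Lemma glw_sum_le g m : 0 < g < 1 -> \sum_(j < m) glw g j <= m%:R `^ g / g.
Proof.
move=> g01; have /andP[g0 g1] := g01.
rewrite glw_sum ?gt_eqF // ler_pM2r ?invr_gt0 //.
case: m => [|m]; first by rewrite mulr0 powR_ge0.
have m1 : 0 < m.+1%:R :> R by rewrite ltr0n.
rewrite -(mulr_powRB1 (ltW m1) g0) mulrC ler_pM2l //.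
exact: glw_powR_le.
Qed.

Lemma glw_sum_scaled g h m : 0 < g < 1 -> 0 <= h ->
  h `^ g * \sum_(j < m) glw g j <= (m%:R * h) `^ g / g.
Proof.
move=> g01 h0; rewrite powRM // mulrAC mulrC ler_wpM2r ?powR_ge0 //.
exact: glw_sum_le.
Qed.

Lemma geometric_expR_le x m : 0 < x ->
  \sum_(j < m) expR (- (x * j%:R)) <= 1 + x^-1.
Proof.
move=> x0; have q1 : expR (- x) < 1 by rewrite expR_lt1 oppr_lt0.
have q10 : 0 < 1 - expR (- x) by rewrite subr_gt0.
have -> : \sum_(j < m) expR (- (x * j%:R)) = \sum_(j < m) expR (- x) ^+ j.
  by apply: eq_bigr => j _; rewrite -expRM_natr mulNr.
rewrite -(ler_pM2l q10) -[X in X * _]opprB mulNr -subrX1 opprB.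
apply: (@le_trans _ _ 1); first by rewrite gerBl exprn_ge0 ?expR_ge0.
have : expR (- x) * (1 + x) <= expR (- x) * expR x.
  by rewrite ler_wpM2l ?expR_ge0 ?expR_ge1Dx.
rewrite -expRD addNr expR0 => qx.
have -> : 1 + x^-1 = (1 + x) / x by field; rewrite gt_eqF.
by rewrite mulrA ler_pdivlMr // mul1r; lra.
Qed.

Lemma glw_anti g j m : 0 < g < 1 -> (j <= m)%N -> glw g m <= glw g j.
Proof.
move=> g01; elim: m => [|m IHm]; first by rewrite leqn0 => /eqP->.
rewrite leq_eqVlt => /predU1P[->//|]; rewrite ltnS => /IHm.
exact: le_trans (glw_le m g01).
Qed.

(* The sum is split at [N ~ 1 / (L h)]: before [N] the weights are summed, and
   after [N] the geometric factor is. *)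
Lemma glw_exp_sum g (L : R) h m : 0 < g < 1 -> 0 < L -> 0 < h ->
  h `^ g * \sum_(j < m) glw g j * expR (- (L * (j%:R * h))) <=
  (g^-1 + 2) * (L^-1 + h) `^ g.
Proof.
move=> g01 L0 h0; have /andP[g0 g1] := g01.
pose x := L * h; have x0 : 0 < x by rewrite mulr_gt0.
pose k := Num.truncn x^-1.
have kx : x^-1 <= k.+1%:R by rewrite ltW // truncnS_gt.
have xk : k.+1%:R <= x^-1 + 1.
  by rewrite -natr1 lerD2r // truncn_le invr_ge0 ltW.
have k0 : 0 < k.+1%:R :> R by rewrite ltr0n.
apply: (@le_trans _ _ (h `^ g * ((g^-1 + 2) * k.+1%:R `^ g))).
  rewrite ler_wpM2l ?powR_ge0 //.
  apply: (@le_trans _ _ (\sum_(j < m) (if (j < k.+1)%N then glw g j else 0) +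
      \sum_(j < m) glw g k.+1 * expR (- (x * j%:R)))).
    rewrite -big_split /=; apply: ler_sum => j _.
    have -> : L * (j%:R * h) = x * j%:R by rewrite /x; ring.
    case: ltnP => jk.
      rewrite -[leLHS]addr0 lerD ?mulr_ge0 ?expR_ge0 ?(ltW (glw_gt0 _ _)) //.
      rewrite ler_piMr ?(ltW (glw_gt0 _ _)) // expR_le1 oppr_le0.
      by rewrite mulr_ge0 ?(ltW x0).
    rewrite add0r ler_wpM2r ?expR_ge0 //.
    exact: glw_anti.
  rewrite mulrDl lerD //.
    rewrite mulrC; apply: le_trans (glw_sum_le k.+1 g01).
    rewrite -big_mkcond /=; apply: (@le_trans _ _ (\sum_(j < maxn m k.+1 | (j < k.+1)%N) glw g j)).
      rewrite (big_ord_widen_cond _ (fun j => (j < k.+1)%N) (fun j => glw g j) (leq_maxl m k.+1)).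
      rewrite [leRHS](bigID (fun j : 'I_(maxn m k.+1) => (j < m)%N)) /= lerDl.
      by rewrite sumr_ge0 // => j _; rewrite (ltW (glw_gt0 _ _)).
    by rewrite (big_ord_widen _ (fun j => glw g j) (leq_maxr m k.+1)).
  rewrite -mulr_sumr; apply: (@le_trans _ _ (k.+1%:R `^ (g - 1) * (2 * k.+1%:R))).
    apply: ler_pM.
    - by rewrite ltW ?glw_gt0.
    - by apply: sumr_ge0 => j _; rewrite expR_ge0.
    - exact: glw_powR_le.
    apply: le_trans (geometric_expR_le m x0) _.
    have : 1 <= k.+1%:R :> R by rewrite ler1n.
    by move: kx; lra.
  by rewrite mulrCA [_ `^ (g - 1) * _]mulrC mulr_powRB1 ?(ltW k0).
rewrite mulrCA ler_wpM2l ?addr_ge0 ?invr_ge0 ?(ltW g0) //.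
rewrite -powRM ?(ltW h0) ?(ltW k0) // ge0_ler_powR ?nnegrE ?(ltW g0) //.
- by rewrite mulr_ge0 ?ltW.
- by rewrite addr_ge0 ?invr_ge0 ?ltW.
have -> : L^-1 + h = h * (x^-1 + 1).
  by rewrite /x; field; rewrite !gt_eqF.
by rewrite ler_pM2l.
Qed.

(** The sum is the norm of the discrete fractional integral in a space weighted by [expR (L * t)];
    making it small is what turns the Gronwall arguments into contractions, uniformly in [h] and
    [m]. *)
Lemma glw_exp_sum_small g (k : R) : 0 < g < 1 -> 0 < k ->
  exists L h0 : R, [/\ 0 < L, 0 < h0 & forall h m, 0 < h <= h0 ->
    h `^ g * \sum_(j < m) glw g j * expR (- (L * (j%:R * h))) <= k].
Proof.
move=> g01 k0; have /andP[g0 g1] := g01.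
have C0 : 0 < g^-1 + 2 by rewrite addr_gt0 ?invr_gt0.
(* [r] solves [(g^-1 + 2) r ^ g = k]; half of it is given to [L^-1] and half to [h]. *)
pose r := (k / (g^-1 + 2)) `^ g^-1.
have r0 : 0 < r by rewrite powR_gt0 // divr_gt0.
exists (2 / r), (r / 2); split; rewrite ?divr_gt0 // => h m /andP[h0 hr].
apply: le_trans (glw_exp_sum m g01 _ h0) _; first by rewrite divr_gt0.
rewrite -ler_pdivlMl // [leRHS]mulrC.
have -> : k / (g^-1 + 2) = r `^ g.
  by rewrite -powRrM mulVf ?gt_eqF // powRr1 // ltW // divr_gt0.
rewrite ge0_ler_powR ?nnegrE ?(ltW g0) ?(ltW r0) //.
  by rewrite addr_ge0 ?invr_ge0 ?divr_ge0 ?(ltW h0) ?(ltW r0).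
by rewrite invf_div; lra.
Qed.

End WeightBounds.

(** * Discrete fractional integrals *)

Section GrunwaldLetnikov.
Context {R : realType}.
Implicit Types (g h M T t s : R) (j k m N : nat) (Y : R -> R).

(* [h ^ (g - 1)] times the fractional difference of order [1 - g] of [Y], after
   summation by parts: a discrete fractional integral of order [g] of [Y']. *)
Definition glA g h N Y t : R := h `^ (g - 1) *
  \sum_(j < N) glw g j * (Y (t - j%:R * h) - Y (t - j.+1%:R * h)).

(** Abel summation: the coefficients of [(1 - z) ^ (1 - g)] are the successive differences of those
    of [(1 - z) ^ (- g)]. The [match] is the last weight, absent for an empty sum. *)
Lemma glw_by_parts g (a : nat -> R) N :
  \sum_(j < N) glw g j * (a j - a j.+1) =
  \sum_(j < N) glw (g - 1) j * a j - (if N is N'.+1 then glw g N' else 0) * a N.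
Proof.
case: N => [|N]; first by rewrite !big_ord0 mul0r subr0.
elim: N => [|N IHN]; first by rewrite !big_ord1 !glw0; ring.
rewrite big_ord_recr /= IHN [in RHS]big_ord_recr /=.
have := glwNSB (1 - g) N; rewrite opprB subrKC.
by move=> ->; ring.
Qed.

(* The first weight is [1], the others are nonpositive with sum [>= - 1]. *)
Lemma glw_norm_sum g N : 0 < g < 1 -> \sum_(j < N) `|glw (g - 1) j| <= 2.
Proof.
move=> /andP[g0 g1]; have g01' : 0 < 1 - g < 1 by rewrite subr_gt0 gtrBl g1.
case: N => [|N]; first by rewrite big_ord0.
have -> : g - 1 = - (1 - g) by rewrite opprB.
have -> : \sum_(j < N.+1) `|glw (- (1 - g)) j| =
    2 - \sum_(j < N.+1) glw (- (1 - g)) j.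
  rewrite !big_ord_recl glw0 normr1.
  have -> : \sum_(j < N) `|glw (- (1 - g)) (lift ord0 j)| =
      - \sum_(j < N) glw (- (1 - g)) (lift ord0 j).
    by rewrite -sumrN; apply: eq_bigr => j _; rewrite ler0_norm // glwN_le0.
  by ring.
by rewrite glwN_sum gerBl ltW // glw_gt0 // subKr.
Qed.

(** Summation by parts moves the difference onto the weights, whose total variation is at most 2;
    the bound therefore does not grow with [N]. *)
Lemma glw_diff_le g (a : nat -> R) N M : 0 < g < 1 -> 0 <= M ->
  (forall j, (j < N)%N -> `|a j| <= M) -> a N = 0 ->
  `|\sum_(j < N) glw g j * (a j - a j.+1)| <= 2 * M.
Proof.
move=> g01 M0 aM aN; rewrite glw_by_parts aN mulr0 subr0.
apply: le_trans (ler_norm_sum _ _ _) _.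
apply: (@le_trans _ _ (\sum_(j < N) `|glw (g - 1) j| * M)).
  by apply: ler_sum => j _; rewrite normrM ler_wpM2l // aM.
by rewrite -mulr_suml ler_wpM2r // glw_norm_sum.
Qed.

(** With zero values to the left of 0, a sum over [t - j h] may have any length [N] with [t <= N h],
    so that one [N] serves all times. *)
Definition causal Y := forall s, s <= 0 -> Y s = 0.

Definition lip_upto T M Y := forall s t, s <= t <= T -> `|Y t - Y s| <= M * (t - s).

Lemma causal_diff h N j Y t : 0 < h -> causal Y -> t <= N%:R * h -> (N <= j)%N ->
  Y (t - j%:R * h) - Y (t - j.+1%:R * h) = 0.
Proof.
move=> h0 cY tN Nj; have tj : t <= j%:R * h.
  by apply: le_trans tN _; rewrite ler_wpM2r ?ler_nat ?ltW.
rewrite !cY ?subrr // subr_le0 //; apply: le_trans tj _.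
by rewrite ler_wpM2r ?ler_nat ?ltW.
Qed.

Lemma glA_indep g h N N' Y t : 0 < h -> causal Y -> t <= N%:R * h -> (N <= N')%N ->
  glA g h N' Y t = glA g h N Y t.
Proof.
move=> h0 cY tN /subnKC <-; rewrite /glA big_split_ord /=.
rewrite [X in _ * (_ + X)]big1 ?addr0 // => j _.
by rewrite (causal_diff h0 cY tN) ?mulr0 // leq_addr.
Qed.

Lemma glA_le0 g h N Y t : 0 < h -> causal Y -> t <= 0 -> glA g h N Y t = 0.
Proof.
move=> h0 cY t0; rewrite (@glA_indep g h 0) // ?mul0r //.
by rewrite /glA big_ord0 mulr0.
Qed.

Lemma glA_shiftE g h N Y t i : glA g h N Y (t - i%:R * h) = h `^ (g - 1) *
  \sum_(j < N) glw g j * (Y (t - (i + j)%:R * h) - Y (t - (i + j).+1%:R * h)).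
Proof.
rewrite /glA; congr (_ * _); apply: eq_bigr => j _; congr (_ * (Y _ - Y _)).
  by rewrite natrD; ring.
by rewrite -addnS natrD; ring.
Qed.

Lemma powRB1M g h : 0 < h -> h `^ (g - 1) * h = h `^ g.
Proof.
move=> h0; rewrite -[X in _ * X](@powRr1 _ h) ?(ltW h0) // -powRD ?subrK //.
by rewrite (gt_eqF h0) implybT.
Qed.

(* Discrete [I ^ (1 - g) I ^ g = I], from [(1 - z) ^ (g - 1) (1 - z) ^ (- g) = (1 - z) ^ (-1)]. *)
Lemma glA_comp g h N Y t : 0 < h -> causal Y -> t <= N%:R * h ->
  h `^ (1 - g) * \sum_(j < N) glw (1 - g) j * glA g h N Y (t - j%:R * h) = Y t.
Proof.
move=> h0 cY tN.
under eq_bigr => j _ do rewrite glA_shiftE mulrCA.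
rewrite -mulr_sumr mulrA -powRD ?(gt_eqF h0) ?implybT //.
rewrite (_ : 1 - g + (g - 1) = 0) ?powRr0 ?mul1r; last by ring.
pose F k := Y (t - k%:R * h) - Y (t - k.+1%:R * h).
rewrite (@toeplitz_comp _ (glw (1 - g)) (glw g) F); last first.
  by move=> k Nk; rewrite /F (causal_diff h0 cY tN).
have C k := glw_conv1 (1 - g) k; rewrite subKr in C.
under eq_bigr => k _ do rewrite C mul1r.
rewrite /F -(big_mkord xpredT (fun k => Y (t - k%:R * h) - Y (t - k.+1%:R * h))).
have -> : \sum_(0 <= k < N) (Y (t - k%:R * h) - Y (t - k.+1%:R * h)) =
    - \sum_(0 <= k < N) (Y (t - k.+1%:R * h) - Y (t - k%:R * h)).
  by rewrite -sumrN; apply: eq_bigr => k _; rewrite opprB.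
rewrite (telescope_sumr (fun k => Y (t - k%:R * h))) // mul0r subr0 opprB.
by rewrite [Y (t - N%:R * h)]cY ?subr0 // subr_le0.
Qed.

(** This is [glw_square] for the increments of [Y] on the backward lattice of [t], which vanish from
    index [N] on by causality. *)
Lemma glA_square g h N Y t : 0 < g < 1 -> 0 < h -> causal Y -> t <= N%:R * h ->
  glA g h N Y t ^+ 2 <= 2 * (h `^ (g - 1) * \sum_(j < N) glw g j *
    (glA g h N Y (t - j%:R * h) * (Y (t - j%:R * h) - Y (t - j.+1%:R * h)))).
Proof.
move=> g01 h0 cY tN.
pose F k := Y (t - k%:R * h) - Y (t - k.+1%:R * h).
have F0 k : (N <= k)%N -> F k = 0.
  by move=> Nk; rewrite /F (causal_diff h0 cY tN).
have H := glw_square g01 F0.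
rewrite [leRHS](_ : _ = (h `^ (g - 1)) ^+ 2 * (2 * \sum_(i < N) glw g i *
    ((\sum_(j < N) glw g j * F (i + j)%N) * F i))).
  by rewrite /glA exprMn ler_wpM2l ?sqr_ge0.
rewrite mulrCA expr2 -!mulrA; congr (_ * _); rewrite mulrCA; congr (_ * _).
rewrite mulr_sumr; apply: eq_bigr => j _; rewrite glA_shiftE /F; ring.
Qed.

Definition glk g h j : R := (j%:R * h) `^ (g - 1) / Gamma g.

(** This is the form of the weight asymptotics that telescopes: each weight lies between the kernel
    values at the ends of its cell. Cell 0 is left out because the kernel is singular there. *)
Lemma glk_bounds g h j : 0 < g < 1 -> 0 < h ->
  glk g h j.+2 <= h `^ (g - 1) * glw g j.+1 <= glk g h j.+1.
Proof.
move=> g01 h0; have G0 := Gamma_gt0 g01.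
rewrite /glk ler_pdivrMr // ler_pdivlMr // !powRM ?(ltW h0) //.
have -> : h `^ (g - 1) * glw g j.+1 * Gamma g =
  Gamma g * glw g j.+1 * h `^ (g - 1) by ring.
by rewrite !ler_pM2r ?powR_gt0 // glw_lb // glw_ub.
Qed.

Lemma glk1_le g h : 0 < g < 1 -> 0 < h -> h * glk g h 1 <= h `^ g.
Proof.
move=> g01 h0; rewrite /glk mul1r mulrA mulr_powRB1 ?(ltW h0) ?(andP g01).1 //.
by rewrite ler_pdivrMr ?Gamma_gt0 // ler_peMr ?powR_ge0 // Gamma_ge1.
Qed.

(* [J j] is the contribution of the [j]-th cell to an integral against any
   kernel lying between the values of the fractional kernel at the two ends of
   the cell; the errors telescope. *)
Lemma glA_compare g h M (C : R) N Y t (J : nat -> R) : 0 < g < 1 -> 0 < h -> 0 <= M ->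
  lip_upto t M Y ->
  (forall j (e : R), glk g h j.+2 <= e <= glk g h j.+1 -> (j.+1 < N)%N ->
     `|J j.+1 - e * (Y (t - j.+1%:R * h) - Y (t - j.+2%:R * h))| <=
     M * h * (glk g h j.+1 - glk g h j.+2)) ->
  `|J 0%N| <= C * M * h `^ g ->
  `|\sum_(j < N) J j - glA g h N Y t| <= (C + 2) * M * h `^ g.
Proof.
move=> g01 h0 M0 lY HJ HJ0.
have hg0 := powR_ge0 h g.
case: N HJ => [|N] HJ.
  rewrite /glA !big_ord0 mulr0 subr0 normr0.
  have : 0 <= C * M * h `^ g by apply: le_trans HJ0.
  have : 0 <= M * h `^ g by rewrite mulr_ge0.
  by lra.
rewrite /glA mulr_sumr -sumrB big_ord_recl /=.
apply: le_trans (ler_normD _ _) _.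
(* Cell 0 costs [C] for [J 0] and 1 for the first term of [glA]; the remaining cells telescope to at
   most [M * h * glk g h 1], which costs 1 more. *)
have -> : (C + 2) * M * h `^ g = (C + 1) * M * h `^ g + M * h `^ g by ring.
apply: lerD.
  apply: le_trans (ler_normB _ _) _.
  have -> : (C + 1) * M * h `^ g = C * M * h `^ g + M * h `^ g by ring.
  apply: lerD => //; rewrite glw0 !mul1r mul0r subr0 normrM ger0_norm ?powR_ge0 //.
  rewrite -(powRB1M g h0) mulrCA ler_wpM2l ?powR_ge0 //.
  apply: le_trans (lY _ _ _) _; last by rewrite opprB addrC subrK.
  by rewrite lerBlDl lerDr (ltW h0) lexx.
apply: le_trans (ler_norm_sum _ _ _) _.
apply: (@le_trans _ _ (\sum_(0 <= j < N) M * h * (glk g h j.+1 - glk g h j.+2))).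
  rewrite big_mkord; apply: ler_sum => j _; rewrite /bump /= add1n mulrA.
  by apply: HJ; [exact: glk_bounds|rewrite ltnS].
rewrite -mulr_sumr.
have -> : \sum_(0 <= j < N) (glk g h j.+1 - glk g h j.+2) =
    - \sum_(0 <= j < N) (glk g h j.+2 - glk g h j.+1).
  by rewrite -sumrN; apply: eq_bigr => k _; rewrite opprB.
rewrite (telescope_sumr (fun k => glk g h k.+1)) // opprB -mulrA ler_wpM2l //.
apply: le_trans (glk1_le g01 h0); rewrite ler_wpM2l ?(ltW h0) // gerBl.
by rewrite divr_ge0 ?powR_ge0 ?Gamma_ge0.
Qed.

End GrunwaldLetnikov.

(** * Refinement and translation of the discrete fractional integral *)

Section GrunwaldLetnikovEstimates.
Context {R : realType}.
Implicit Types (g h M T t s : R) (j k m N K : nat) (Y : R -> R).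

Lemma lip_upto_le T T' M Y : T' <= T -> lip_upto T M Y -> lip_upto T' M Y.
Proof.
by move=> TT lY s t /andP[st tT]; apply: lY; rewrite st (le_trans tT).
Qed.

Lemma powR_anti g (x y : R) : g < 1 -> 0 < x -> x <= y ->
  y `^ (g - 1) <= x `^ (g - 1).
Proof.
move=> g1 x0 xy; have y0 := lt_le_trans x0 xy.
have -> : g - 1 = - (1 - g) by rewrite opprB.
rewrite !powRN lef_pV2 ?posrE ?powR_gt0 //.
by apply: ge0_ler_powR; rewrite ?nnegrE ?(ltW x0) ?(ltW y0) // subr_ge0 ltW.
Qed.

Lemma lip_step h M j Y t : 0 < h -> lip_upto t M Y ->
  `|Y (t - j%:R * h) - Y (t - j.+1%:R * h)| <= M * h.
Proof.
move=> h0 lY; apply: le_trans (lY _ _ _) _.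
  by rewrite lerD2l lerN2 ler_pM2r // ler_nat leqnSn gerBl mulr_ge0 ?(ltW h0).
by rewrite -natr1 (_ : _ - _ = h) //; ring.
Qed.

Lemma sum_ord_mul N K (F : nat -> R) :
  \sum_(i < N * K) F i = \sum_(j < N) \sum_(r < K) F (j * K + r)%N.
Proof.
elim: N => [|N IHN]; first by rewrite !big_ord0.
by rewrite mulSn addnC big_split_ord /= IHN big_ord_recr.
Qed.

(** [J j] collects the [K] fine cells inside the coarse cell [j]; fine and coarse weights lie
    between the same two kernel values, so [glA_compare] applies. The [g^-1] is the total fine
    weight of cell 0. *)
Lemma glA_refine g h K N M Y t : 0 < g < 1 -> 0 < h -> 0 <= M -> (0 < K)%N ->
  lip_upto t M Y ->
  `|glA g (h / K%:R) (N * K) Y t - glA g h N Y t| <= (g^-1 + 2) * M * h `^ g.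
Proof.
move=> g01 h0 M0 K0 lY; have /andP[g0 g1] := g01.
have K0' : 0 < K%:R :> R by rewrite ltr0n.
set h' := h / K%:R; have h'0 : 0 < h' by rewrite divr_gt0.
have Kh : K%:R * h' = h by rewrite mulrC divfK ?gt_eqF.
pose D i := Y (t - i%:R * h') - Y (t - i.+1%:R * h').
have DM i : `|D i| <= M * h' by exact: lip_step.
pose J j := \sum_(r < K) h' `^ (g - 1) * glw g (j * K + r)%N * D (j * K + r)%N.
have -> : glA g h' (N * K) Y t = \sum_(j < N) J j.
  rewrite /glA mulr_sumr (sum_ord_mul _ _ (fun i => h' `^ (g - 1) *
    (glw g i * (Y (t - i%:R * h') - Y (t - i.+1%:R * h'))))).
  by apply: eq_bigr => j _; apply: eq_bigr => r _; rewrite mulrA.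
apply: glA_compare => //.
- move=> j e /andP[e1 e2] jN.
  have -> : Y (t - j.+1%:R * h) - Y (t - j.+2%:R * h) =
      \sum_(r < K) D (j.+1 * K + r)%N.
    pose y r := - Y (t - (j.+1 * K + r)%:R * h').
    rewrite -(big_mkord xpredT (fun r => D (j.+1 * K + r)%N)).
    rewrite (telescope_sumr_eq y) //; last first.
      by move=> r _; rewrite /D /y addnS opprK addrC.
    rewrite /y opprK addrC addn0 -mulSnr !natrM -![_ * _ * h']mulrA Kh.
    by [].
  rewrite /J mulr_sumr -sumrB; apply: le_trans (ler_norm_sum _ _ _) _.
  have -> : M * h * (glk g h j.+1 - glk g h j.+2) =
      \sum_(r < K) (glk g h j.+1 - glk g h j.+2) * (M * h').
    by rewrite sumr_const card_ord -mulr_natl -Kh; ring.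
  apply: ler_sum => r _; rewrite -mulrBl normrM ler_pM //.
  have rK := ltn_ord r; set i := (j.+1 * K + r)%N.
  have i0 : (0 < i)%N by rewrite addn_gt0 muln_gt0 K0.
  have := glk_bounds i.-1 g01 h'0; rewrite prednK // => /andP[b1 b2].
  have ub : glk g h' i <= glk g h j.+1.
    rewrite /glk ler_pM2r ?invr_gt0 ?Gamma_gt0 //; apply: powR_anti => //.
      by rewrite mulr_gt0 // ltr0n.
    by rewrite -Kh mulrA ler_pM2r // -natrM ler_nat leq_addr.
  have lb : glk g h j.+2 <= glk g h' i.+1.
    rewrite /glk ler_pM2r ?invr_gt0 ?Gamma_gt0 //; apply: powR_anti => //.
      by rewrite mulr_gt0 // ltr0n.
    by rewrite -Kh mulrA ler_pM2r // -natrM ler_nat mulSnr -addnS leq_add2l.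
  by rewrite ler_norml; apply/andP; split; lra.
- rewrite /J; apply: le_trans (ler_norm_sum _ _ _) _.
  apply: (@le_trans _ _ (\sum_(r < K) h' `^ g * (glw g r * M))).
    apply: ler_sum => r _; rewrite mul0n add0n !normrM.
    rewrite (ger0_norm (powR_ge0 _ _)) (ger0_norm (ltW (glw_gt0 _ g0))).
    rewrite [leRHS](_ : _ = h' `^ (g - 1) * glw g r * (M * h')); last first.
      by rewrite -(powRB1M g h'0); ring.
    by rewrite ler_wpM2l ?mulr_ge0 ?powR_ge0 ?(ltW (glw_gt0 _ _)).
  rewrite -mulr_sumr -mulr_suml.
  rewrite [leLHS](_ : _ = M * (h' `^ g * \sum_(r < K) glw g r)); last by ring.
  rewrite [leRHS](_ : _ = M * ((K%:R * h') `^ g / g)); last by rewrite Kh; ring.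
  by rewrite ler_wpM2l //; exact: glw_sum_scaled (ltW h'0).
Qed.

(** A shift by at most one step changes every sample of [Y] by at most [M * h], and [glw_diff_le]
    sums these changes without a factor [N]. *)
Lemma glA_near g h M N Y t' t : 0 < g < 1 -> 0 < h -> 0 <= M -> causal Y ->
  lip_upto t M Y -> t' <= t <= t' + h -> t <= N%:R * h ->
  `|glA g h N Y t - glA g h N Y t'| <= 2 * M * h `^ g.
Proof.
move=> g01 h0 M0 cY lY /andP[t't tt'] tN.
rewrite /glA -mulrBr -sumrB.
pose a j := Y (t - j%:R * h) - Y (t' - j%:R * h).
have -> : \sum_(j < N) (glw g j * (Y (t - j%:R * h) - Y (t - j.+1%:R * h)) -
    glw g j * (Y (t' - j%:R * h) - Y (t' - j.+1%:R * h))) =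
    \sum_(j < N) glw g j * (a j - a j.+1).
  by apply: eq_bigr => j _; rewrite /a; ring.
rewrite normrM ger0_norm ?powR_ge0 // -(powRB1M g h0) [leRHS]mulrCA ler_wpM2l ?powR_ge0 //.
rewrite -mulrA; apply: glw_diff_le => //; first by rewrite mulr_ge0 ?(ltW h0).
- move=> j _; rewrite /a; apply: le_trans (lY _ _ _) _.
    by rewrite lerD2r t't gerBl mulr_ge0 ?(ltW h0).
  by rewrite ler_wpM2l //; lra.
- by rewrite /a !cY ?subrr // subr_le0 // (le_trans t't).
Qed.

(** After a shift by whole steps the same increments reappear with later weights. The first [m]
    terms are new; for the others the weights have decreased, and the total decrease telescopes to
    at most the sum of the first [m] weights. *)
Lemma glA_translate g h M N m Y t : 0 < g < 1 -> 0 < h -> 0 <= M -> causal Y ->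
  lip_upto (t + m%:R * h) M Y -> t + m%:R * h <= N%:R * h ->
  `|glA g h N Y (t + m%:R * h) - glA g h N Y t| <=
  2 / g * M * (m%:R * h) `^ g.
Proof.
move=> g01 h0 M0 cY lY tN.
rewrite -(@glA_indep _ g h N (m + N) _ (t + m%:R * h)) ?leq_addl //.
rewrite /glA -mulrBr big_split_ord /=.
pose D j := Y (t - j%:R * h) - Y (t - j.+1%:R * h).
set S1 := \sum_(j < m) _.
have -> : \sum_(j < N) glw g (m + j) * (Y (t + m%:R * h - (m + j)%:R * h) -
    Y (t + m%:R * h - (m + j).+1%:R * h)) = \sum_(j < N) glw g (m + j) * D j.
  apply: eq_bigr => j _; rewrite /D; congr (_ * (Y _ - Y _)).
    by rewrite natrD; ring.
  by rewrite -addnS natrD; ring.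
rewrite -addrA -sumrB normrM ger0_norm ?powR_ge0 //.
have S1M : `|S1| <= M * h * \sum_(j < m) glw g j.
  apply: le_trans (ler_norm_sum _ _ _) _; rewrite mulr_sumr.
  apply: ler_sum => j _.
  rewrite normrM (ger0_norm (ltW (glw_gt0 _ _))) ?(andP g01).1 // mulrC.
  by rewrite ler_wpM2r ?(ltW (glw_gt0 _ _)) ?(andP g01).1 //; exact: lip_step.
have S2M : `|\sum_(j < N) (glw g (m + j) * D j - glw g j * D j)| <=
    M * h * \sum_(j < m) glw g j.
  apply: (@le_trans _ _ (\sum_(j < N) (glw g j - glw g (m + j)) * (M * h))).
    apply: le_trans (ler_norm_sum _ _ _) _.
    apply: ler_sum => j _; rewrite -mulrBl normrM distrC.
    have W0 : 0 <= glw g j - glw g (m + j).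
      by rewrite subr_ge0; apply: glw_anti; rewrite ?leq_addl.
    rewrite (ger0_norm W0); apply: ler_wpM2l => //.
    apply: lip_step => //; apply: lip_upto_le lY.
    by rewrite lerDl mulr_ge0 ?(ltW h0).
  rewrite -mulr_suml mulrC ler_wpM2l ?mulr_ge0 ?(ltW h0) // sumrB.
  rewrite lerBlDr; have -> : \sum_(j < m) glw g j + \sum_(j < N) glw g (m + j) =
      \sum_(j < N + m) glw g j by rewrite addnC big_split_ord.
  rewrite big_split_ord lerDl; apply: sumr_ge0 => j _.
  by rewrite ltW // glw_gt0 ?(andP g01).1.
apply: (@le_trans _ _ (2 * M * (h `^ g * \sum_(j < m) glw g j))).
  rewrite -(powRB1M g h0); set S := \sum_(j < m) _ in S1M S2M *.
  rewrite [leRHS](_ : _ = h `^ (g - 1) * (M * h * S + M * h * S)); last by ring.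
  rewrite ler_wpM2l ?powR_ge0 //; apply: le_trans (ler_normD _ _) _.
  exact: lerD.
rewrite [leRHS](_ : _ = 2 * M * ((m%:R * h) `^ g / g)); last by ring.
by apply: ler_wpM2l; [rewrite mulr_ge0|exact: glw_sum_scaled (ltW h0)].
Qed.

Lemma glA_shift g h M N Y t' t : 0 < g < 1 -> 0 < h -> 0 <= M -> causal Y ->
  lip_upto t M Y -> t' <= t -> t <= N%:R * h ->
  `|glA g h N Y t - glA g h N Y t'| <=
  2 / g * M * (t - t') `^ g + 2 * M * h `^ g.
Proof.
move=> g01 h0 M0 cY lY t't tN; have /andP[g0 g1] := g01.
pose m := Num.truncn ((t - t') / h).
have th0 : 0 <= (t - t') / h by rewrite divr_ge0 ?subr_ge0 ?(ltW h0).
have mt : m%:R * h <= t - t' by rewrite -ler_pdivlMr // truncn_le.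
have tm : t - t' <= m%:R * h + h.
  have := ltW (truncnS_gt ((t - t') / h)).
  by rewrite -/m ler_pdivrMr // -natr1 mulrDl mul1r.
rewrite -(subrKA (glA g h N Y (t' + m%:R * h))) addrC.
apply: le_trans (ler_normD _ _) _; apply: lerD.
  apply: le_trans (glA_translate g01 h0 M0 cY _ _) _.
  - by apply: lip_upto_le lY; lra.
  - by lra.
  rewrite ler_wpM2l ?mulr_ge0 ?invr_ge0 ?(ltW g0) //.
  by apply: ge0_ler_powR; rewrite ?nnegrE ?mulr_ge0 ?subr_ge0 ?(ltW h0) ?(ltW g0).
apply: glA_near => //; lra.
Qed.

End GrunwaldLetnikovEstimates.

(** * Riemann-Liouville integrals *)

Section Primitives.
Context {R : realType}.
Notation mu := (@lebesgue_measure R).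
Notation cmu := (@completed_lebesgue_measure R).
Implicit Types (a b c s t M g h : R) (f phi : R -> R).

Lemma lebesgue_measurable_itv (i : interval R) :
  measurable ([set` i] : set (lebesgueType R)).
Proof. by apply: lebesgue_measurable_set; exact: measurable_itv. Qed.

(** The integrand [phi] is only Lebesgue measurable, the majorant [psi] is Borel: integrability and
    the bound are both computed on the Borel side. *)
Lemma norm_Rintegral_le (D : set R) phi psi (C : R) :
  measurable D -> measurable_fun D psi ->
  measurable_fun (D : set (lebesgueType R)) (phi : lebesgueType R -> R) ->
  (forall s, D s -> `|phi s| <= psi s) ->
  (\int[mu]_(s in D) (psi s)%:E <= C%:E)%E ->
  cmu.-integrable (D : set (lebesgueType R)) (EFin \o phi) /\
  `|\int[cmu]_(s in D) phi s| <= C.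
Proof.
move=> mD mpsi mphi phipsi psiC.
have mD' := lebesgue_measurable_set mD.
have psi0 s : D s -> (0 <= (psi s)%:E)%E.
  by move=> /phipsi; rewrite lee_fin; apply: le_trans.
have mpsi' : measurable_fun D (EFin \o psi) by exact/measurable_EFinP.
have mphi' : measurable_fun (D : set (lebesgueType R))
    (EFin \o phi : lebesgueType R -> \bar R) by exact/measurable_EFinP.
have le1 : (\int[cmu]_(s in D) `|(phi s)%:E| <= C%:E)%E.
  apply: le_trans psiC; rewrite -(ge0_integral_completed mD mpsi' psi0).
  apply: (ge0_le_integral cmu mD').
  - by move=> s _; exact: abse_ge0.
  - exact: (measurableT_comp (@abse_measurable R _) mphi').
  - exact: lebesgue_measurable_fun mD mpsi'.
  - by move=> s Ds; rewrite /= lee_fin phipsi.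
have iphi : cmu.-integrable (D : set (lebesgueType R)) (EFin \o phi).
  by apply/integrableP; split; [exact: mphi'|exact: le_lt_trans le1 (ltry _)].
split; first exact: iphi.
rewrite -lee_fin (EFin_normr_Rintegral mD' iphi).
exact: le_trans (le_abse_integral cmu mD' mphi') le1.
Qed.

Definition prim phi s : R := \int[cmu]_(r in `[0, s]) phi r.

Lemma prim_causal phi : causal (prim phi).
Proof.
move=> s; rewrite le_eqVlt => /predU1P[->|s0]; rewrite /prim.
  have m0 : measurable (`[0, 0]%classic : set R) by exact: measurable_itv.
  have [||//|//||_ n0] := @norm_Rintegral_le `[0, 0]%classic phi (cst `|phi 0|) 0.
  - exact: measurable_itv.
  - exact: measurable_cst.
  - by rewrite set_itv1; exact: measurable_fun_set1.
  - by move=> r; rewrite set_itv1 /= => ->.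
  - by rewrite set_itv1 integral_set1.
  by apply/eqP; rewrite -normr_le0.
by rewrite set_itv_ge ?Rintegral_set0 // bnd_simp -ltNge.
Qed.

(** The intersection with [[0, t]] takes care of negative [s], where the primitive is 0. *)
Lemma primB phi s t : s <= t ->
  cmu.-integrable (`[0%R, t]%classic : set (lebesgueType R)) (EFin \o phi) ->
  prim phi t - prim phi s = \int[cmu]_(r in `]s, t] `&` `[0, t]) phi r.
Proof.
move=> st iphi; apply/eqP; rewrite subr_eq addrC; apply/eqP.
have E : `[0, t]%classic = `[0, s]%classic `|` (`]s, t] `&` `[0, t]) :> set R.
  apply/seteqP; split=> r /=; rewrite !in_itv /=.
    by move=> /andP[r0 rt]; case: (leP r s) => rs; [left|right]; rewrite ?r0 ?rt.
  by move=> [/andP[-> /le_trans ->]|[_ //]].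
rewrite /prim [in LHS]E; apply: Rintegral_setU.
- exact: lebesgue_measurable_itv.
- by apply: measurableI; exact: lebesgue_measurable_itv.
- by rewrite -E.
- apply/disj_setPS => r [] /=; rewrite !in_itv /= => /andP[_ rs] [/andP[sr _] _].
  by move: sr; rewrite ltNge rs.
Qed.

Lemma measurable_RLkernel g t (D : set R) :
  measurable_fun D (fun s => (t - s) `^ (g - 1)).
Proof.
apply: measurable_funTS.
apply: (@measurableT_comp _ _ _ _ _ _ (fun x : R => x `^ (g - 1)) _ (fun s : R => t - s)).
  exact: measurable_powR.
by apply: measurable_funB; [exact: measurable_cst|exact: measurable_id].
Qed.

Lemma RLkernel_integral g c t : 0 < g < 1 -> c < t ->
  (\int[mu]_(s in `[c, t]) ((t - s) `^ (g - 1))%:E <= ((t - c) `^ g / g)%:E)%E.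
Proof.
move=> /andP[g0 g1] ct; have tc0 : 0 < t - c by rewrite subr_gt0.
have mk D : measurable_fun D (EFin \o (fun s => (t - s) `^ (g - 1))).
  by apply/measurable_EFinP; exact: measurable_RLkernel.
rewrite -integral_itv_bndo_bndc; last exact: mk.
(* The kernel is singular at [t], so [[c, t[] is exhausted by segments ending at [b k]; [k.+2] makes
   the first of them nondegenerate. *)
pose b (k : nat) : R := t - (t - c) / k.+2%:R.
have bt k : b k < t by rewrite gtrBl divr_gt0 // ltr0n.
have cb k : c < b k.
  by rewrite /b ltrBrDl -ltrBrDr ltr_pdivrMr ?ltr0n // ltr_pMr // ltr1n.
have bE : \bigcup_k `[c, b k]%classic = `[c, t[%classic :> set R.
  apply/seteqP; split=> [s [k _]|s] /=; rewrite !in_itv /=.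
    by move=> /andP[-> /le_lt_trans ->].
  move=> /andP[cs st]; pose k := Num.truncn ((t - c) / (t - s)).
  exists k => //=; rewrite in_itv /= cs /=.
  have k2 : (t - c) / (t - s) < k.+2%:R.
    by apply: lt_trans (truncnS_gt _) _; rewrite ltr_nat.
  have ts0 : 0 < t - s by rewrite subr_gt0.
  move: k2; rewrite ltr_pdivrMr // mulrC -ltr_pdivrMr ?ltr0n // /b.
  by rewrite ltrBrDr addrC -ltrBrDr => /ltW.
rewrite -bE; apply: ge0_integral_bigcup_le.
- move=> k l kl; apply/subsetPset => s /=; rewrite !in_itv /= => /andP[-> sk].
  rewrite (le_trans sk) // lerD2l lerN2 ler_pM2l //.
  by rewrite lef_pV2 ?posrE ?ltr0n // ler_nat !ltnS.
- by move=> k; exact: measurable_itv.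
- exact: mk.
- by move=> s _; rewrite lee_fin powR_ge0.
move=> k.
have ts0 s : c <= s <= b k -> 0 < t - s.
  by move=> /andP[_ sb]; rewrite subr_gt0 (le_lt_trans sb).
have hts s : is_derive s 1 (fun s : R => t - s) (- 1).
  by apply: is_derive_eq; ring.
have hd s : c <= s <= b k ->
    is_derive s 1 (fun s => - g^-1 * (t - s) `^ g) ((t - s) `^ (g - 1)).
  move=> /ts0 ts; have hp := is_derive1_powR g ts.
  have := is_deriveZ (- g^-1) (@is_derive1_comp _ _ (fun s => t - s) _ _ _ hp (hts s)).
  rewrite (_ : - g^-1 *: _ = (t - s) `^ (g - 1)) //.
  by rewrite /GRing.scale /=; field; rewrite gt_eqF.
have hc s : c <= s <= b k -> {for s, continuous (fun s => (t - s) `^ (g - 1))}.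
  move=> /ts0 ts; have hp := is_derive1_powR (g - 1) ts.
  apply/differentiable_continuous/derivable1_diffP.
  exact: (@ex_derive _ _ _ _ _ _ _ (@is_derive1_comp _ _ (fun s => t - s) _ _ _ hp (hts s))).
rewrite (FTC2_segment (cb k) hd hc) lee_fin -subr_ge0.
rewrite [leRHS](_ : _ = (t - b k) `^ g / g); last by ring.
by rewrite divr_ge0 ?powR_ge0 ?(ltW g0).
Qed.

Definition RLs g phi t : R := (Gamma g)^-1 *
  \int[cmu]_(s in `[0, t]) ((t - s) `^ (g - 1) * phi s).

Section RLestimate.
Context (g T M : R) (phi : R -> R).
Hypotheses (g01 : 0 < g < 1) (M0 : 0 <= M).
Hypothesis mphi : measurable_fun (`[0, T]%classic : set (lebesgueType R))
  (phi : lebesgueType R -> R).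
Hypothesis phiM : forall s, 0 <= s <= T -> `|phi s| <= M.

Let cell s t : set R := `]s, t] `&` `[0, t].

Let mcell s t : measurable (cell s t).
Proof. by apply: measurableI; exact: measurable_itv. Qed.

Let mphicell s t : t <= T -> measurable_fun
  (cell s t : set (lebesgueType R)) (phi : lebesgueType R -> R).
Proof.
move=> tT; apply: measurable_funS mphi; first exact: lebesgue_measurable_itv.
by move=> r [_] /=; rewrite !in_itv /= => /andP[-> /le_trans ->].
Qed.

Let cellT s t r : t <= T -> cell s t r -> 0 <= r <= T.
Proof. by move=> tT [_] /=; rewrite in_itv /= => /andP[-> /le_trans ->]. Qed.

Let integral_cell_cst s t c : s <= t -> 0 <= c ->
  (\int[mu]_(r in cell s t) c%:E <= (c * (t - s))%:E)%E.
Proof.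
move=> st c0.
apply: (@le_trans _ _ (\int[mu]_(r in `]s, t]) c%:E)%E).
  apply: ge0_subset_integral.
  - exact: mcell.
  - exact: measurable_itv.
  - exact: measurable_cst.
  - by move=> r _; rewrite lee_fin.
  - by move=> r [].
rewrite integral_cst // /= lebesgue_measure_itv /= lte_fin.
case: ifP => _; first by rewrite -EFinB -EFinM.
by rewrite mule0 lee_fin mulr_ge0 // subr_ge0.
Qed.

Let integral_kernel c t (D : set R) : measurable D -> D `<=` `[c, t]%classic -> c < t ->
  (\int[mu]_(r in D) (M * (t - r) `^ (g - 1))%:E <= (M * ((t - c) `^ g / g))%:E)%E.
Proof.
move=> mD Dct ct.
have mk (E : set (measurableTypeR R)) :
    measurable_fun E (EFin \o (fun s => (t - s) `^ (g - 1))).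
  by apply/measurable_EFinP; exact: measurable_RLkernel.
under eq_integral do rewrite EFinM.
rewrite ge0_integralZl; [|exact: mD|exact: mk| |by rewrite lee_fin]; last first.
  by move=> s _; rewrite lee_fin powR_ge0.
rewrite EFinM lee_wpmul2l ?lee_fin //.
apply: le_trans (RLkernel_integral g01 ct); apply: ge0_subset_integral.
- exact: mD.
- exact: measurable_itv.
- exact: mk.
- by move=> s _; rewrite lee_fin powR_ge0.
- exact: Dct.
Qed.

Lemma prim_integrable t : t <= T ->
  cmu.-integrable (`[0%R, t]%classic : set (lebesgueType R)) (EFin \o phi).
Proof.
move=> tT; apply: (proj1 (@norm_Rintegral_le _ phi (cst M) (M * `|t|) _ _ _ _ _)).
- exact: measurable_itv.
- exact: measurable_cst.
- apply: measurable_funS mphi; first exact: lebesgue_measurable_itv.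
  by move=> r /=; rewrite !in_itv /= => /andP[-> /le_trans ->].
- move=> r /=; rewrite in_itv /= => /andP[r0 rt]; apply: phiM.
  by rewrite r0 (le_trans rt).
- rewrite -[leLHS]/(\int[mu]_(r in `[0%R, t]) M%:E)%E.
  rewrite integral_cst /=; last exact: measurable_itv.
  rewrite lebesgue_measure_itv /= lte_fin.
  case: ifP => [t0|_]; last by rewrite mule0 lee_fin mulr_ge0.
  by rewrite sube0 -EFinM lee_fin ler_wpM2l // ler_norm.
Qed.

Lemma prim_lip : lip_upto T M (prim phi).
Proof.
move=> s t /andP[st tT]; rewrite primB //; last exact: prim_integrable.
apply: (proj2 (@norm_Rintegral_le (cell s t) phi (cst M) (M * (t - s)) _ _ _ _ _)).
- exact: mcell.
- exact: measurable_cst.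
- exact: mphicell.
- by move=> r /(cellT tT); exact: phiM.
- exact: integral_cell_cst.
Qed.

Let kphi t r := (t - r) `^ (g - 1) * phi r.

Let mkphi t (D : set R) : measurable D -> D `<=` `[0, t]%classic -> t <= T ->
  measurable_fun (D : set (lebesgueType R)) (kphi t : lebesgueType R -> R).
Proof.
move=> mD Dt tT; apply: measurable_funM.
  by apply: lebesgue_measurable_fun => //; exact: measurable_RLkernel.
apply: measurable_funS mphi; first exact: lebesgue_measurable_itv.
by move=> r /Dt /=; rewrite !in_itv /= => /andP[-> /le_trans ->].
Qed.

Let kphi_le t r : t <= T -> `[0, t]%classic r -> `|kphi t r| <= M * (t - r) `^ (g - 1).
Proof.
move=> tT /=; rewrite in_itv /= => /andP[r0 rt].
rewrite normrM ger0_norm ?powR_ge0 // mulrC ler_wpM2r ?powR_ge0 //.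
by rewrite phiM // r0 (le_trans rt).
Qed.

Let measurable_Mkernel t (D : set R) :
  measurable_fun D (fun r => M * (t - r) `^ (g - 1)).
Proof.
by apply: measurable_funM; [exact: measurable_cst|exact: measurable_RLkernel].
Qed.

Lemma RL_integrable t : 0 < t -> t <= T ->
  cmu.-integrable (`[0%R, t]%classic : set (lebesgueType R))
    (EFin \o (fun r => (t - r) `^ (g - 1) * phi r)).
Proof.
move=> t0 tT; apply: (proj1 (@norm_Rintegral_le _ (kphi t)
  (fun r => M * (t - r) `^ (g - 1)) (M * ((t - 0) `^ g / g)) _ _ _ _ _)).
- exact: measurable_itv.
- exact: measurable_Mkernel.
- by apply: mkphi => //; exact: measurable_itv.
- by move=> r; exact: kphi_le.
- by apply: integral_kernel => //; exact: measurable_itv.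
Qed.

(** [glA_compare] again, with [J j] the exact integral over cell [j]. On cell 0 the singular kernel
    is integrated explicitly, which yields the constant [g^-1], while [Gamma g >= 1] absorbs the
    normalization. *)
Lemma RLs_glA h N t : 0 < h -> t <= T -> t <= N%:R * h ->
  `|RLs g phi t - glA g h N (prim phi) t| <= (g^-1 + 2) * M * h `^ g.
Proof.
move=> h0 tT tN; have /andP[g0 g1] := g01; have G0 := Gamma_gt0 g01.
have [t0|t0] := leP t 0.
  rewrite glA_le0 //; last exact: prim_causal.
  rewrite /RLs -[\int[_]_(_ in _) _]/(prim (kphi t) t) prim_causal //.
  rewrite mulr0 subr0 normr0 !mulr_ge0 ?powR_ge0 ?addr_ge0 ?invr_ge0 ?(ltW g0) //.
(* The [t] inside the kernel is frozen, so that the contributions of the cells are increments of a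
   single primitive and telescope to the whole integral. *)
pose G := prim (kphi t).
have iG s : s <= t -> cmu.-integrable (`[0%R, s]%classic : set (lebesgueType R))
    (EFin \o kphi t).
  move=> st; apply: integrableS (RL_integrable t0 tT).
  - exact: lebesgue_measurable_itv.
  - exact: lebesgue_measurable_itv.
  - by move=> r /=; rewrite !in_itv /= => /andP[-> /le_trans ->].
pose J j := (Gamma g)^-1 * (G (t - j%:R * h) - G (t - j.+1%:R * h)).
have -> : RLs g phi t = \sum_(j < N) J j.
  rewrite -mulr_sumr -(big_mkord xpredT (fun j => G (t - j%:R * h) - G (t - j.+1%:R * h))).
  rewrite (telescope_sumr_eq (fun j => - G (t - j%:R * h))) //; last first.
    by move=> j _; rewrite opprK addrC.
  rewrite opprK mul0r subr0 addrC [G (t - N%:R * h)]prim_causal ?subr0 //.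
  by rewrite subr_le0.
have th j : t - j%:R * h <= t by rewrite gerBl mulr_ge0 ?(ltW h0).
have step j : t - j.+1%:R * h <= t - j%:R * h.
  by rewrite lerD2l lerN2 ler_pM2r // ler_nat.
have GE j : G (t - j%:R * h) - G (t - j.+1%:R * h) =
    \int[cmu]_(r in cell (t - j.+1%:R * h) (t - j%:R * h)) kphi t r.
  by rewrite /G primB //; exact: iG.
have iGc s s' : s' <= t -> cmu.-integrable (cell s s' : set (lebesgueType R))
    (EFin \o kphi t).
  move=> st; apply: integrableS (iG _ st).
  - exact: lebesgue_measurable_itv.
  - exact: lebesgue_measurable_set.
  - by move=> r [].
have iphi s s' : s' <= t -> cmu.-integrable (cell s s' : set (lebesgueType R))
    (EFin \o phi).
  move=> st; apply: integrableS (prim_integrable (le_trans st tT)).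
  - exact: lebesgue_measurable_itv.
  - exact: lebesgue_measurable_set.
  - by move=> r [].
apply: glA_compare => //.
- by apply: lip_upto_le prim_lip.
- move=> j e /andP[e1 e2] jN; rewrite /J GE.
  rewrite primB ?(prim_integrable (le_trans (th _) tT)) //.
  set s := t - j.+2%:R * h; set s' := t - j.+1%:R * h.
  have s't : s' <= t by exact: th.
  have -> : (Gamma g)^-1 * \int[cmu]_(r in cell s s') kphi t r -
      e * \int[cmu]_(r in cell s s') phi r =
      (Gamma g)^-1 * \int[cmu]_(r in cell s s') (kphi t r - e * Gamma g * phi r).
    rewrite RintegralB; [|exact: lebesgue_measurable_set|exact: iGc|]; last first.
      have iZ := integrableZl (lebesgue_measurable_set (mcell s s'))
        (e * Gamma g) (iphi s s' s't).
      exact: iZ.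
    rewrite RintegralZl; [|exact: lebesgue_measurable_set|exact: iphi].
    by field; rewrite gt_eqF.
  rewrite normrM ger0_norm ?invr_ge0 ?(ltW G0) // ler_pdivrMl //.
  set d := glk g h j.+1 - glk g h j.+2.
  have d0 : 0 <= d by rewrite subr_ge0 (le_trans e1).
  have GMd0 : 0 <= Gamma g * (M * d) by rewrite !mulr_ge0 ?(ltW G0).
  have ss : s' - s = h by rewrite /s /s' -[j.+2%:R]natr1; ring.
  rewrite [leRHS](_ : _ = Gamma g * (M * d) * (s' - s)); last by rewrite ss; ring.
  apply: (proj2 (@norm_Rintegral_le (cell s s') _ (cst (Gamma g * (M * d))) _ _ _ _ _ _)).
  + exact: mcell.
  + exact: measurable_cst.
  + apply: measurable_funB; first by apply: mkphi => // r [] _ /=;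
      rewrite !in_itv /= => /andP[-> /le_trans ->].
    by apply: measurable_funM; [exact: measurable_cst|apply: mphicell; apply: le_trans tT].
  + move=> r rc; rewrite /kphi -mulrBl normrM.
    have [/= + _] := rc; rewrite in_itv /= => /andP[sr rs'].
    rewrite (_ : Gamma g * (M * d) = Gamma g * d * M); last by ring.
    apply: ler_pM => //; last by apply: phiM; apply: cellT rc; apply: le_trans tT.
    have j1 : 0 < j.+1%:R * h by rewrite mulr_gt0 // ltr0n.
    have tr1 : j.+1%:R * h <= t - r by move: rs'; rewrite /s'; lra.
    have tr2 : t - r <= j.+2%:R * h by move: sr; rewrite /s; lra.
    have k1 := powR_anti g1 j1 tr1.
    have k2 := powR_anti g1 (lt_le_trans j1 tr1) tr2.
    have E i : (i%:R * h) `^ (g - 1) = Gamma g * glk g h i.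
      by rewrite /glk [RHS]mulrC divfK ?gt_eqF.
    rewrite E in k1; rewrite E in k2.
    have e1' : Gamma g * glk g h j.+2 <= Gamma g * e by rewrite ler_pM2l.
    have e2' : Gamma g * e <= Gamma g * glk g h j.+1 by rewrite ler_pM2l.
    rewrite (mulrC e) /d mulrBr ler_norml.
    by apply/andP; split; lra.
  + by apply: integral_cell_cst; rewrite // -subr_ge0 ss ltW.
- rewrite /J GE mul0r subr0 mul1r normrM ger0_norm ?invr_ge0 ?(ltW G0) //.
  rewrite ler_pdivrMl //.
  have tht : t - h < t by rewrite gtrBl.
  apply: (@le_trans _ _ (M * ((t - (t - h)) `^ g / g))); last first.
    rewrite subKr (_ : M * _ = 1 * (g^-1 * M * h `^ g)); last by ring.
    by rewrite ler_wpM2r ?Gamma_ge1 // !mulr_ge0 ?powR_ge0 ?invr_ge0 ?(ltW g0).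
  apply: (proj2 (@norm_Rintegral_le (cell (t - h) t) _
    (fun r => M * (t - r) `^ (g - 1)) _ _ _ _ _ _)).
  + exact: mcell.
  + exact: measurable_Mkernel.
  + by apply: mkphi => // r [].
  + by move=> r [_]; exact: kphi_le.
  + apply: integral_kernel => // r [+ _] /=; rewrite !in_itv /= => /andP[/ltW -> //].
Qed.

End RLestimate.

End Primitives.

(** * Hoelder continuity and the semigroup property of fractional integrals *)

Section FractionalSemigroup.
Context {R : realType}.
Notation cmu := (@completed_lebesgue_measure R).

Lemma powR_small (g c e : R) : 0 < g -> 0 <= c -> 0 < e ->
  exists2 h : R, 0 < h <= 1 & c * h `^ g <= e.
Proof.
move=> g0 c0 e0; have c1 : 0 < c + 1 by rewrite ltr_wpDl.
pose r := (e / (c + 1)) `^ g^-1; have r0 : 0 < r by rewrite powR_gt0 ?divr_gt0.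
have m0 : 0 < Num.min r 1 by rewrite lt_min r0 /=.
exists (Num.min r 1); first by rewrite m0 ge_min lexx orbT.
apply: (@le_trans _ _ (c * r `^ g)).
  rewrite ler_wpM2l // ge0_ler_powR ?nnegrE ?(ltW g0) ?(ltW m0) ?(ltW r0) //.
  by rewrite ge_min lexx.
rewrite -powRrM mulVf ?gt_eqF // powRr1 ?divr_ge0 ?(ltW e0) ?(ltW c1) //.
rewrite mulrCA ler_piMr ?(ltW e0) // ler_pdivrMr // mul1r.
by rewrite lerDl.
Qed.

Lemma le_powR_lim (g a b c : R) : 0 < g -> 0 <= c ->
  (forall h : R, 0 < h <= 1 -> a <= b + c * h `^ g) -> a <= b.
Proof.
move=> g0 c0 H; apply/ler_addgt0Pr => e e0.
have [h h01 he] := powR_small g0 c0 e0.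
by apply: le_trans (H h h01) _; rewrite lerD2l.
Qed.

Lemma nat_cover (t h : R) : 0 < h -> 0 <= t ->
  exists2 N : nat, t <= N%:R * h & N%:R * h <= t + h.
Proof.
move=> h0 t0; exists (Num.truncn (t / h)).+1.
  by rewrite -ler_pdivrMr // ltW // truncnS_gt.
rewrite -natr1 mulrDl mul1r lerD2r -ler_pdivlMr // truncn_le.
by rewrite divr_ge0 ?(ltW h0).
Qed.

Context (a T M : R) (phi : R -> R).
Hypotheses (a01 : 0 < a < 1) (T0 : 0 < T) (M0 : 0 <= M).
Hypothesis mphi : measurable_fun (`[0, T]%classic : set (lebesgueType R))
  (phi : lebesgueType R -> R).
Hypothesis phiM : forall s, 0 <= s <= T -> `|phi s| <= M.

Let w := RLs a phi.

Lemma RLs_causal g (f : R -> R) : causal (RLs g f).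
Proof.
by move=> s s0; rewrite /RLs -[\int[_]_(_ in _) _]/(prim _ s) prim_causal // mulr0.
Qed.

Lemma RLs_hoelder s t : s <= t -> t <= T ->
  `|w t - w s| <= 2 / a * M * (t - s) `^ a.
Proof.
move=> st tT; have /andP[a0 a1] := a01.
(* Two uses of [RLs_glA] and the [h ^ a] term of [glA_shift]; all of these errors disappear as [h]
   tends to 0. *)
pose C := (2 * (a^-1 + 2) + 2) * M.
have C0 : 0 <= C by rewrite mulr_ge0 // addr_ge0 // mulr_ge0 // addr_ge0 // invr_ge0 ltW.
apply: (@le_powR_lim a _ _ C) => // h /andP[h0 _].
have [N tN _] := nat_cover h0 (normr_ge0 t).
have {}tN := le_trans (ler_norm t) tN.
have e1 := RLs_glA a01 M0 mphi phiM h0 tT tN.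
have e2 := RLs_glA a01 M0 mphi phiM h0 (le_trans st tT) (le_trans st tN).
have lP := lip_upto_le tT (prim_lip M0 mphi phiM).
have e3 := glA_shift a01 h0 M0 (prim_causal phi) lP st tN.
rewrite -/w in e1 e2.
rewrite (_ : w t - w s = (w t - glA a h N (prim phi) t) -
  (w s - glA a h N (prim phi) s) +
  (glA a h N (prim phi) t - glA a h N (prim phi) s)); last by ring.
apply: le_trans (ler_normD _ _) _.
have := le_trans (ler_normB _ _) (lerD e1 e2) => /lerD /(_ e3) /le_trans; apply.
by rewrite le_eqVlt; apply/orP; left; apply/eqP; rewrite /C; ring.
Qed.

Lemma RLs_bounded s : 0 <= s <= T -> `|w s| <= 2 / a * M * T `^ a.
Proof.
move=> /andP[s0 sT]; have /andP[a0 a1] := a01.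
have := RLs_hoelder s0 sT; rewrite [w 0]RLs_causal // !subr0 => /le_trans; apply.
rewrite ler_wpM2l ?mulr_ge0 ?invr_ge0 ?(ltW a0) //.
by apply: ge0_ler_powR; rewrite ?nnegrE ?(ltW a0) ?(ltW T0).
Qed.

(** Stopped at [T], the fractional integral is continuous on the whole line by the Hoelder estimate
    and zero on the left, hence Borel. *)
Lemma measurable_RLs : measurable_fun (`[0, T]%classic : set (lebesgueType R))
  (w : lebesgueType R -> R).
Proof.
have /andP[a0 a1] := a01.
apply: (eq_measurable_fun ((fun s => w (Num.min s T)) : lebesgueType R -> R)).
  by move=> s; rewrite inE /= in_itv /= => /andP[_ /min_idPl ->].
apply: lebesgue_measurable_fun; first exact: measurable_itv.
apply: measurable_funTS; apply: continuous_measurable_fun => x.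
apply/(@cvgrPdist_le _ R^o) => e e0.
have C0 : 0 <= 2 / a * M by rewrite mulr_ge0 // divr_ge0 // ltW.
have [d /andP[d0 _] de] := powR_small a0 C0 e0.
have key y z : y <= z -> z - y <= d -> `|w (Num.min z T) - w (Num.min y T)| <= e.
  move=> yz zyd; apply: le_trans (RLs_hoelder _ _) _.
  - by rewrite le_min !ge_min yz lexx orbT.
  - by rewrite ge_min lexx orbT.
  apply: le_trans de; rewrite ler_wpM2l //.
  have zy0 : 0 <= Num.min z T - Num.min y T by rewrite subr_ge0 le_min !ge_min yz lexx orbT.
  apply: ge0_ler_powR; rewrite ?nnegrE ?(ltW a0) ?(ltW d0) //.
  apply: le_trans zyd.
  by rewrite !minEle; case: (leP z T); case: (leP y T); lra.
near=> y.
have : `|x - y| <= d by near: y; apply: cvgr_dist_le.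
rewrite ler_norml => /andP[xy yx].
have [le_xy|/ltW le_yx] := leP x y; last exact: key.
by rewrite distrC; apply: key => //; lra.
Unshelve. all: by end_near. Qed.

Let H := 2 / a * M.

Let H0 : 0 <= H.
Proof. by have /andP[a0 _] := a01; rewrite mulr_ge0 // divr_ge0 // ltW. Qed.

Let Mw0 : 0 <= H * T `^ a. Proof. by rewrite mulr_ge0 ?powR_ge0. Qed.

Let Rintegral_cst_itv c s (k : R) : c <= s ->
  \int[cmu]_(r in `]c, s]) k = k * (s - c).
Proof.
move=> cs; rewrite Rintegral_cst; last exact: lebesgue_measurable_itv.
congr (_ * _); transitivity (fine (@lebesgue_measure R `]c, s]%classic)) => //.
rewrite lebesgue_measure_itv /= lte_fin; case: ifP => //= /negbT.
by rewrite -leNgt => sc; rewrite (@le_anti _ _ c s) ?cs ?sc // subrr.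
Qed.

(** By the Hoelder estimate [w] varies by [O(h ^ a)] over one step. When the step crosses 0 the
    missing length is multiplied by [w s], which is itself [O(h ^ a)] because [s < h]. *)
Lemma prim_RLs_step s h : 0 < h -> s <= T ->
  `|prim w s - prim w (s - h) - h * w s| <= 2 * H * h `^ a * h.
Proof.
move=> h0 sT; have /andP[a0 a1] := a01.
have [s0|s0] := leP s 0.
  rewrite !prim_causal //; last by lra.
  by rewrite [w s]RLs_causal // mulr0 !subr0 normr0 !(H0, mulr_ge0, powR_ge0, ltW h0).
pose c := Num.max 0 (s - h).
have cs : c <= s by rewrite ge_max (ltW s0) gerBl ltW.
have c0 : 0 <= c by rewrite le_max lexx.
have sc : s - c <= h by rewrite lerBlDl -lerBlDr le_max lexx orbT.
have -> : prim w (s - h) = prim w c.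
  rewrite /c; case: (leP 0 (s - h)) => // sh.
  by rewrite !prim_causal // ltW.
have iw := prim_integrable Mw0 measurable_RLs RLs_bounded sT.
have cell_itv : `]c, s] `&` `[0, s] = `]c, s]%classic :> set R.
  apply/seteqP; split=> [r []//|r] /=; rewrite !in_itv /= => /andP[cr rs].
  by rewrite cr rs (le_trans c0) // ltW.
have iwc : cmu.-integrable (`]c, s]%classic : set (lebesgueType R)) (EFin \o w).
  apply: integrableS iw; [exact: lebesgue_measurable_itv..|].
  by rewrite -cell_itv => r [].
rewrite primB // cell_itv.
have ick (k : R) : cmu.-integrable (`]c, s]%classic : set (lebesgueType R))
    (EFin \o cst k).
  apply: (proj1 (@norm_Rintegral_le _ _ _ (cst `|k|) (`|k| * (s - c)) _ _ _ _ _)).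
  - exact: measurable_itv.
  - exact: measurable_cst.
  - exact: measurable_cst.
  - by [].
  rewrite -[leLHS]/(\int[@lebesgue_measure R]_(r in `]c, s]) `|k|%:E)%E.
  rewrite integral_cst /=; last exact: measurable_itv.
  rewrite lebesgue_measure_itv /= lte_fin; case: ifP => [_|_].
    by rewrite -EFinD -EFinM.
  by rewrite mule0 lee_fin mulr_ge0 // subr_ge0.
have -> : \int[cmu]_(r in `]c, s]) w r - h * w s =
    \int[cmu]_(r in `]c, s]) (w r - w s) - (h - (s - c)) * w s.
  rewrite RintegralB; [|exact: lebesgue_measurable_itv|exact: iwc|exact: ick].
  by rewrite Rintegral_cst_itv //; ring.
apply: le_trans (ler_normB _ _) _.
rewrite (_ : 2 * H * h `^ a * h = H * h `^ a * h + h * (H * h `^ a)); last by ring.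
apply: lerD.
  apply: (@le_trans _ _ (H * h `^ a * (s - c))); last first.
    by rewrite ler_wpM2l ?(H0, mulr_ge0, powR_ge0).
  apply: (proj2 (@norm_Rintegral_le _ _ _ (cst (H * h `^ a)) _ _ _ _ _ _)).
  - exact: measurable_itv.
  - exact: measurable_cst.
  - apply: measurable_funB; last exact: measurable_cst.
    apply: measurable_funS measurable_RLs; first exact: lebesgue_measurable_itv.
    move=> r /=; rewrite !in_itv /= => /andP[cr rs].
    by rewrite (le_trans c0 (ltW cr)) (le_trans rs).
  - move=> r /=; rewrite in_itv /= => /andP[cr rs]; rewrite distrC.
    apply: le_trans (RLs_hoelder rs sT) _; rewrite ler_wpM2l //.
    apply: ge0_ler_powR; rewrite ?nnegrE ?subr_ge0 ?(ltW a0) ?(ltW h0) //.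
    by apply: le_trans sc; rewrite lerD2l lerN2 ltW.
  - rewrite -[leLHS]/(\int[@lebesgue_measure R]_(r in `]c, s]) (H * h `^ a)%:E)%E.
    rewrite integral_cst /=; last exact: measurable_itv.
    rewrite lebesgue_measure_itv /= lte_fin; case: ifP => [_|_].
      by rewrite -EFinD -EFinM.
    by rewrite mule0 lee_fin !(H0, mulr_ge0, powR_ge0, subr_ge0).
have hsc : 0 <= h - (s - c) by rewrite subr_ge0.
rewrite normrM (ger0_norm hsc).
have [sh|sh] := leP h s.
  rewrite (_ : h - (s - c) = 0) ?mul0r ?(H0, mulr_ge0, powR_ge0, ltW h0) //.
  by rewrite /c max_r ?subr_ge0 //; ring.
apply: ler_pM => //; first by rewrite gerBl subr_ge0.
have := RLs_hoelder (ltW s0) sT; rewrite [w 0]RLs_causal // !subr0 => /le_trans.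
apply; rewrite ler_wpM2l //.
by apply: ge0_ler_powR; rewrite ?nnegrE ?(ltW a0) ?(ltW h0) ?(ltW s0) ?(ltW sh).
Qed.

(* Limit [h -> 0] of [glA_comp], which replaces Fubini's theorem and the Beta
   function. *)
Lemma RLs_semigroup t : 0 <= t <= T -> RLs (1 - a) w t = prim phi t.
Proof.
move=> /andP[t0 tT]; have /andP[a0 a1] := a01.
have b0 : 0 < 1 - a by rewrite subr_gt0.
have b01 : 0 < 1 - a < 1 by rewrite b0 gtrBl.
(* Discretizing the outer integral costs [h ^ (1 - a)], the inner one [h ^ a]; as [h <= 1], both are
   at most [h ^ d]. *)
pose d := Num.min a (1 - a).
have d0 : 0 < d by rewrite lt_min a0.
pose C1 := ((1 - a)^-1 + 2) * (H * T `^ a).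
pose C2 := (2 * H + (a^-1 + 2) * M) * ((T + 1) `^ (1 - a) / (1 - a)).
have S0 : 0 <= 2 * H + (a^-1 + 2) * M.
  apply: addr_ge0; first exact: mulr_ge0.
  by apply: mulr_ge0 => //; rewrite addr_ge0 // invr_ge0 ltW.
have C10 : 0 <= C1.
  by apply: mulr_ge0 => //; rewrite addr_ge0 // invr_ge0 ltW.
have C20 : 0 <= C2.
  by apply: mulr_ge0 => //; rewrite divr_ge0 ?powR_ge0 ?(ltW b0).
apply/eqP; rewrite -subr_eq0 -normr_le0.
apply: (@le_powR_lim d _ _ (C1 + C2) d0).
  by rewrite addr_ge0.
move=> h /andP[h0 h1]; rewrite add0r mulrDl.
have [N tN Nt] := nat_cover h0 t0.
have hd e : d <= e -> h `^ e <= h `^ d by apply: ger_powR; rewrite h0.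
have e1 := RLs_glA b01 Mw0 measurable_RLs RLs_bounded h0 tT tN.
pose A j := glA a h N (prim phi) (t - j%:R * h).
have th j : t - j%:R * h <= t by rewrite gerBl mulr_ge0 ?(ltW h0).
have step j : `|prim w (t - j%:R * h) - prim w (t - j.+1%:R * h) - h * A j| <=
    (2 * H + (a^-1 + 2) * M) * h `^ a * h.
  have -> : t - j.+1%:R * h = t - j%:R * h - h by rewrite -natr1; ring.
  have p1 := prim_RLs_step h0 (le_trans (th j) tT).
  have p2 := RLs_glA a01 M0 mphi phiM h0 (le_trans (th j) tT) (le_trans (th j) tN).
  rewrite -/w -/(A j) in p2.
  set s := t - j%:R * h in p1 p2 *.
  rewrite (_ : prim w s - prim w (s - h) - h * A j =
    prim w s - prim w (s - h) - h * w s + h * (w s - A j)); last by ring.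
  rewrite [leRHS](_ : _ = 2 * H * h `^ a * h + (a^-1 + 2) * M * h `^ a * h); last by ring.
  apply: le_trans (ler_normD _ _) _; apply: lerD => //.
  by rewrite normrM (gtr0_norm h0) mulrC ler_wpM2r ?(ltW h0).
(* The discrete composition is exact, so only the errors [step] remain, weighted by [glw (1 - a)];
   the total weight is bounded through [N h <= T + 1]. *)
have e2 : `|glA (1 - a) h N (prim w) t - prim phi t| <= C2 * h `^ a.
  rewrite -[X in _ - X](glA_comp a h0 (prim_causal phi) tN).
  have -> : glA (1 - a) h N (prim w) t - h `^ (1 - a) *
      (\sum_(j < N) glw (1 - a) j * glA a h N (prim phi) (t - j%:R * h)) =
      h `^ (1 - a - 1) * \sum_(j < N) glw (1 - a) j *
      (prim w (t - j%:R * h) - prim w (t - j.+1%:R * h) - h * A j).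
    rewrite -(powRB1M (1 - a) h0) [X in X - _]/glA -[X in _ - X]mulrA -mulrBr.
    rewrite [h * _]mulr_sumr -sumrB.
    by congr (_ * _); apply: eq_bigr => j _; rewrite /A; ring.
  rewrite normrM (ger0_norm (powR_ge0 _ _)).
  apply: (@le_trans _ _ (h `^ (1 - a - 1) * \sum_(j < N) glw (1 - a) j *
      ((2 * H + (a^-1 + 2) * M) * h `^ a * h))).
    rewrite ler_wpM2l ?powR_ge0 //; apply: le_trans (ler_norm_sum _ _ _) _.
    apply: ler_sum => j _; rewrite normrM (ger0_norm (ltW (glw_gt0 _ b0))).
    by rewrite ler_wpM2l ?(ltW (glw_gt0 _ b0)) // step.
  rewrite -mulr_suml [leLHS](_ : _ = (2 * H + (a^-1 + 2) * M) * h `^ a *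
    (h `^ (1 - a) * \sum_(j < N) glw (1 - a) j)); last first.
    by rewrite -(powRB1M (1 - a) h0); ring.
  rewrite [leRHS](_ : _ = (2 * H + (a^-1 + 2) * M) * h `^ a *
    ((T + 1) `^ (1 - a) / (1 - a))); last by rewrite /C2; ring.
  apply: ler_wpM2l; first by apply: mulr_ge0; rewrite ?powR_ge0.
  apply: le_trans (glw_sum_scaled N b01 (ltW h0)) _.
  rewrite ler_wpM2r ?invr_ge0 ?(ltW b0) //.
  apply: ge0_ler_powR; rewrite ?nnegrE ?mulr_ge0 ?(ltW b0) ?(ltW h0) //.
    by rewrite addr_ge0 // ltW.
  by apply: (le_trans Nt); rewrite lerD.
rewrite -(subrKA (glA (1 - a) h N (prim w) t)).
apply: le_trans (ler_normD _ _) _; apply: lerD.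
  apply: le_trans e1 _; rewrite ler_wpM2l // hd // ge_min lexx orbT //.
by apply: le_trans e2 _; rewrite ler_wpM2l // hd // ge_min lexx.
Qed.

End FractionalSemigroup.

(** * Functions differentiable almost everywhere *)

Section AlmostEverywhereDerivative.
Context {R : realType}.
Notation mu := (@lebesgue_measure R).
Notation cmu := (@completed_lebesgue_measure R).

Lemma ae_on_open_cover (D : set R) (P : R -> Prop) (e : R) : ae_on D P -> 0 < e ->
  exists U : set R, [/\ open U, (mu U <= e%:E)%E & forall t, D t -> P t \/ U t].
Proof.
move=> [A [mA A0 NA]] e0.
have [U [oU AU Ue]] := outer_measure_open_le A e0.
exists U; split => //.
  apply: (le_trans Ue); rewrite [X in (X + _)%E](_ : _ = 0%E) ?add0e //.
move=> t Dt; case: (pselect (P t)) => Pt; [by left|right; apply: AU].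
by apply: NA => /(_ Dt).
Qed.

(** The supremum of the times up to which [Q] holds throughout inherits [Q] from the left, and if it
    were below [b] the third hypothesis would carry [Q] past it. *)
Lemma real_induction (a b : R) (Q : R -> Prop) : a <= b -> Q a ->
  (forall t, a < t <= b -> (forall s, a <= s < t -> Q s) -> Q t) ->
  (forall t, a <= t < b -> Q t -> exists2 d, 0 < d &
     forall s, t < s < t + d -> s <= b -> Q s) ->
  Q b.
Proof.
move=> ab Qa Qlim Qright.
pose S := [set t | a <= t <= b /\ forall s, a <= s <= t -> Q s].
have Sa : S a.
  by split=> [|s /andP[? ?]]; rewrite ?lexx // (@le_anti _ _ s a) //; apply/andP.
have hS : has_sup S by split; [exists a|exists b => t [/andP[]]].
have supa : a <= sup S by apply: ub_le_sup => //; exact: hS.2.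
have supb : sup S <= b by apply: ge_sup; [exists a|move=> t [/andP[]]].
have Qlt s : a <= s < sup S -> Q s.
  move=> /andP[as_ ss]; have [t [_ St] st] := sup_gt (ex_intro _ a Sa) ss.
  by apply: St; rewrite as_ ltW.
have Qsup : Q (sup S).
  have [asup|] := ltP a (sup S); first by apply: Qlim Qlt; rewrite asup.
  by move=> supa'; rewrite (@le_anti _ _ (sup S) a) // supa' supa.
have [supltb|] := ltP (sup S) b; last first.
  by move=> bsup; rewrite (@le_anti _ _ b (sup S)) // bsup supb.
have [d d0 Hd] : exists2 d, 0 < d & forall s, sup S < s < sup S + d -> s <= b -> Q s.
  by apply: Qright => //; rewrite supa.
pose t := Num.min b (sup S + d / 2).
have supt : sup S < t by rewrite lt_min supltb ltrDl divr_gt0.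
have : S t.
  split; first by rewrite (le_trans supa (ltW supt)) ge_min lexx.
  move=> s /andP[as_ st]; have [ss|] := ltP s (sup S); first by apply: Qlt; rewrite as_.
  rewrite le_eqVlt => /predU1P[<-//|sups].
  have [sb sd] : s <= b /\ s <= sup S + d / 2.
    by move: st; rewrite le_min => /andP[].
  by apply: Hd => //; rewrite sups (le_lt_trans sd) // ltrD2l; lra.
by move=> /(ub_le_sup hS.2); rewrite leNgt supt.
Qed.

(* Real induction on [F t - (c + e) t - K mu (U `&` [a, t])], where [U] is a small
   open set covering the exceptional points. *)
Lemma ae_derive_le (F : R -> R) (L c a b : R) (P : R -> Prop) : a <= b ->
  (forall s t, a <= s -> s <= t -> t <= b -> `|F t - F s| <= L * (t - s)) ->
  ae_on `[a, b] P ->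
  (forall t, a <= t < b -> P t -> forall e, 0 < e -> exists2 d, 0 < d &
    forall k, 0 < k < d -> F (t + k) - F t <= (c + e) * k) ->
  F b - F a <= c * (b - a).
Proof.
rewrite le_eqVlt => /predU1P[->|ab] lF aeP PF; first by rewrite !subrr mulr0.
have L0 : 0 <= L.
  have := le_trans (normr_ge0 _) (lF a b (lexx _) (ltW ab) (lexx _)).
  by rewrite pmulr_lge0 // subr_gt0.
(* Inside [U] nothing is known but the Lipschitz bound: [F] rises at rate at most [L] and [- c t] at
   rate at most [|c|]; [K e] outweighs both. *)
pose K e := L + `|c| + e.
suff H e : 0 < e -> F b - F a <= (c + e) * (b - a) + K e * e.
  pose C := b - a + L + `|c| + 1.
  have C0 : 0 <= C.
    by have := normr_ge0 c; rewrite /C; lra.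
  apply: (@le_powR_lim _ 1 _ _ C) => // e /andP[e0 e1].
  rewrite powRr1 ?(ltW e0) //; apply: (le_trans (H e e0)).
  have : e * e <= 1 * e by rewrite ler_wpM2r // ltW.
  by rewrite /K /C; nra.
move=> e0; have K0 : 0 <= K e by rewrite !addr_ge0 // ltW.
have [U [oU Ue UP]] := ae_on_open_cover aeP e0.
have mU : measurable U by exact: open_measurable.
pose V t : set R := U `&` `[a, t].
have mV t : measurable (V t) by apply: measurableI => //; exact: measurable_itv.
have Vle t : (mu (V t) <= e%:E)%E.
  by apply: le_trans Ue; apply: le_measure; rewrite ?inE;
    [exact: mV|exact: mU|exact: subIsetl].
have fV t : mu (V t) \is a fin_num.
  by rewrite ge0_fin_numE //; apply: le_lt_trans (Vle t) _; exact: ltry.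
pose m t := fine (mu (V t)).
have m_mono s t : s <= t -> m s <= m t.
  move=> st; rewrite fine_le //; apply: le_measure; rewrite ?inE;
    [exact: mV|exact: mV|move=> r [Ur] /=].
  by rewrite in_itv /= => /andP[ar rs]; split => //=; rewrite in_itv /= ar (le_trans rs).
have m_open s t : a <= s -> s <= t -> `[s, t]%classic `<=` U -> t - s <= m t - m s.
  move=> as_ st stU; rewrite lerBrDr -lee_fin EFinD /m !fineK //.
  have sub : V s `|` `]s, t]%classic `<=` V t.
    move=> r [[Ur]|] /=; rewrite !in_itv /= => /andP[ar rs].
      by split => //=; rewrite in_itv /= ar (le_trans rs).
    split; first by apply: stU; rewrite /= in_itv /= rs ltW.
    by rewrite /= in_itv /= rs (le_trans as_) // ltW.
  have m1 : measurable (`]s, t]%classic : set (measurableTypeR R)).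
    exact: measurable_itv.
  have : (mu (V s `|` `]s, t]%classic) <= mu (V t))%E.
    apply: le_measure; rewrite ?inE; [|exact: mV|exact: sub].
    by apply: measurableU => //; exact: mV.
  rewrite measureU; [|exact: mV|exact: m1|]; last first.
    apply/seteqP; split=> // r [[Ur]] /=; rewrite !in_itv /= => /andP[_ rs] /andP[].
    by rewrite ltNge rs.
  rewrite /= lebesgue_measure_itv /= lte_fin; case: ifP => [_|/negbT].
    by rewrite addeC -EFinB.
  rewrite -leNgt => ts _; rewrite (@le_anti _ _ s t) ?st ?ts //.
  by rewrite subrr add0e.
pose G t := F t - (c + e) * t - K e * m t.
suff : G b <= G a.
  rewrite /G => GG; have m0 : 0 <= m a by rewrite fine_ge0.
  have mb : m b <= e by rewrite -lee_fin fineK.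
  have : K e * m b <= K e * e by rewrite ler_wpM2l.
  have : 0 <= K e * m a by rewrite mulr_ge0.
  by move: GG; lra.
apply: (@real_induction a b (fun t => G t <= G a)) => //; first exact: ltW.
- move=> t /andP[at_ tb] Gs.
  (* Passage to the limit from the left, along [max a (t - d)]; the measure term is monotone and
     helps. *)
  apply: (@le_powR_lim _ 1 _ _ (L + `|c + e|)); rewrite ?addr_ge0 //.
  move=> d /andP[d0 _]; rewrite powRr1 ?(ltW d0) //.
  pose s := Num.max a (t - d).
  have st : s < t by rewrite gt_max at_ gtrBl.
  have as_ : a <= s by rewrite le_max lexx.
  have td : t - s <= d by rewrite lerBlDl -lerBlDr le_max lexx orbT.
  have Gsa : G s <= G a by apply: Gs; rewrite as_.
  have Fts := lF s t as_ (ltW st) tb.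
  have Km : K e * m s <= K e * m t by rewrite ler_wpM2l // m_mono // ltW.
  have cts : `|(c + e) * (t - s)| <= `|c + e| * d.
    by rewrite normrM ler_wpM2l // gtr0_norm // subr_gt0.
  have Fd : `|F t - F s| <= L * d by apply: le_trans Fts _; rewrite ler_wpM2l.
  move: Fd cts; rewrite !ler_norml => /andP[_ F1] /andP[c1 _].
  by move: Gsa; rewrite /G; lra.
- move=> t /andP[at_ tb] Gt.
  have tab : `[a, b]%classic t by rewrite /= in_itv /= at_ ltW.
  case: (UP t tab) => [/PF|Ut].
    rewrite at_ tb => /(_ isT e e0) [d d0 Hd]; exists d => // s /andP[ts std] sb.
    apply: le_trans Gt; have := Hd (s - t); rewrite subr_gt0 ts ltrBlDl std.
    rewrite subrKC => /(_ isT).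
    have : K e * m t <= K e * m s by rewrite ler_wpM2l // m_mono // ltW.
    by rewrite /G; lra.
  have [d /= d0 dU] := (nbhs_ballP t U).1 (open_nbhs_nbhs (conj oU Ut)).
  exists d => // s /andP[ts std] sb; apply: le_trans Gt.
  have mts : s - t <= m s - m t.
    apply: m_open => //; first exact: ltW.
    move=> r /=; rewrite in_itv /= => /andP[tr rs]; apply: dU.
    by rewrite /ball /= distrC ger0_norm ?subr_ge0 // ltrBlDl (le_lt_trans rs).
  have Fst := le_trans (ler_norm _) (lF t s at_ (ltW ts) sb).
  have Km : K e * (s - t) <= K e * (m s - m t) by rewrite ler_wpM2l.
  have cst : - (`|c| * (s - t)) <= c * (s - t).
    by rewrite -mulNr ler_wpM2r ?subr_ge0 ?(ltW ts) // lerNl -normrN ler_norm.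
  have est : 0 <= e * (s - t) by rewrite mulr_ge0 ?subr_ge0 ?(ltW e0) ?(ltW ts).
  by move: Km Fst cst est; rewrite /G /K; lra.
Qed.

End AlmostEverywhereDerivative.

(** * Vector-valued functions *)

Section EuclideanNorm.
Context {R : realType} {n : nat}.
Implicit Types (x y z e v : 'rV[R]_n) (k r : R).

Lemma dotC x y : dot x y = dot y x.
Proof. by apply: eq_bigr => i _; rewrite mulrC. Qed.

Lemma dotDr x y z : dot x (y + z) = dot x y + dot x z.
Proof. by rewrite -big_split; apply: eq_bigr => i _; rewrite mxE mulrDr. Qed.

Lemma dotZr k x y : dot x (k *: y) = k * dot x y.
Proof. by rewrite mulr_sumr; apply: eq_bigr => i _; rewrite mxE mulrCA. Qed.

Lemma dotNr x y : dot x (- y) = - dot x y.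
Proof. by rewrite -scaleN1r dotZr mulN1r. Qed.

Lemma dotBr x y z : dot x (y - z) = dot x y - dot x z.
Proof. by rewrite dotDr dotNr. Qed.

Lemma dot0r x : dot x 0 = 0.
Proof. by rewrite -(scale0r 0) dotZr mul0r. Qed.

Lemma dotBl x y z : dot (x - y) z = dot x z - dot y z.
Proof. by rewrite ![dot _ z]dotC dotBr. Qed.

Lemma dot_sumr (I : Type) (s : seq I) (P : pred I) x (f : I -> 'rV[R]_n) :
  dot x (\sum_(i <- s | P i) f i) = \sum_(i <- s | P i) dot x (f i).
Proof. by apply: big_morph; [exact: dotDr|exact: dot0r]. Qed.

Lemma dotxx_ge0 x : 0 <= dot x x.
Proof. by apply: sumr_ge0 => i _; rewrite -expr2 sqr_ge0. Qed.

Lemma enorm_ge0 x : 0 <= enorm x. Proof. exact: sqrtr_ge0. Qed.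

Lemma enorm2 x : enorm x ^+ 2 = dot x x.
Proof. by rewrite sqr_sqrtr // dotxx_ge0. Qed.

Lemma enorm0 : enorm (0 : 'rV[R]_n) = 0.
Proof. by rewrite /enorm dot0r sqrtr0. Qed.

Lemma enormN x : enorm (- x) = enorm x.
Proof. by rewrite /enorm dotNr dotC dotNr opprK. Qed.

Lemma enormB x y : enorm (x - y) = enorm (y - x).
Proof. by rewrite -enormN opprB. Qed.

Lemma dot_le x y : dot x y <= enorm x * enorm y.
Proof.
have H : 0 <= dot (enorm y *: x - enorm x *: y) (enorm y *: x - enorm x *: y).
  exact: dotxx_ge0.
move: H; rewrite dotBl !dotBr !dotZr ![dot (_ *: _) _]dotC !dotZr.
rewrite -!enorm2 [dot y x]dotC => H.
have [p0|] := ltP 0 (enorm x * enorm y); last first.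
  rewrite le_eqVlt ltNge mulr_ge0 ?enorm_ge0 // orbF mulf_eq0.
  have zero z : enorm z = 0 -> z = 0.
    move=> z0; have : dot z z = 0 by rewrite -enorm2 z0 expr0n.
    move=> /eqP; rewrite psumr_eq0 => [/allP zz|i _]; last by rewrite -expr2 sqr_ge0.
    apply/rowP => i; rewrite mxE; apply/eqP.
    by have := zz i (mem_index_enum _); rewrite mulf_eq0 orbb.
  by case/orP => /eqP /[dup] /zero -> ->; rewrite ?dot0r 1?dotC ?dot0r ?mul0r ?mulr0.
rewrite -(ler_pM2l p0).
by move: H; set a := enorm x; set b := enorm y; set d := dot x y; nra.
Qed.

(** Tested at [e = v]. It lifts linear scalar estimates to vectors without a factor depending on the
    dimension. *)
Lemma enorm_le_dual v r : 0 <= r -> (forall e, dot e v <= r * enorm e) -> enorm v <= r.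
Proof.
move=> r0 H; have [v0|v0] := ltP 0 (enorm v); last exact: le_trans v0 r0.
by rewrite -(ler_pM2r v0) -expr2 enorm2.
Qed.

Lemma enorm_triangle x y : enorm (x + y) <= enorm x + enorm y.
Proof.
apply: enorm_le_dual => [|e]; first by rewrite addr_ge0 ?enorm_ge0.
by rewrite dotDr mulrDl lerD // mulrC dot_le.
Qed.

Lemma coord_le_enorm x i : `|x 0 i| <= enorm x.
Proof.
rewrite -(ler_pXn2r (n := 2)) ?nnegrE ?enorm_ge0 // enorm2.
rewrite real_normK ?num_real // /dot (bigD1 i) //= -expr2 lerDl.
by apply: sumr_ge0 => j _; rewrite -expr2 sqr_ge0.
Qed.

Lemma enorm_le_sum x : enorm x <= \sum_i `|x 0 i|.
Proof.
apply: enorm_le_dual => [|e]; first exact: sumr_ge0.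
rewrite mulr_suml; apply: ler_sum => i _; rewrite mulrC.
apply: le_trans (ler_norm _) _; rewrite normrM ler_wpM2l //.
exact: coord_le_enorm.
Qed.

Lemma enorm_le_coord x r : (forall i, `|x 0 i| <= r) -> enorm x <= n%:R * r.
Proof.
move=> xr; apply: le_trans (enorm_le_sum x) _.
apply: le_trans (ler_sum _ (fun i _ => xr i)) _.
by rewrite sumr_const card_ord mulr_natl.
Qed.

Lemma coord_le_norm x i : `|x 0 i| <= `|x|.
Proof.
rewrite [leRHS]mx_normrE.
exact: (le_bigmax _ (fun ij : 'I_1 * 'I_n => `|x ij.1 ij.2|) (0, i)).
Qed.

Lemma enorm_le_norm x : enorm x <= n%:R * `|x|.
Proof. by apply: enorm_le_coord => i; exact: coord_le_norm. Qed.

Lemma norm_le_enorm x : `|x| <= enorm x.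
Proof.
rewrite [leLHS]mx_normrE; apply: bigmax_le; first exact: enorm_ge0.
by move=> [j i] _ /=; rewrite ord1 coord_le_enorm.
Qed.

End EuclideanNorm.

(** * Discrete fractional integrals and one-sided derivatives of vector functions *)

Section VectorGrunwaldLetnikov.
Context {R : realType} {n : nat}.
Implicit Types (g h t s M T : R) (Y : R -> 'rV[R]_n) (e : 'rV[R]_n) (N K : nat).

Definition glAv g h N Y t : 'rV[R]_n := h `^ (g - 1) *:
  \sum_(j < N) glw g j *: (Y (t - j%:R * h) - Y (t - j.+1%:R * h)).

Definition vcausal Y := forall s, s <= 0 -> Y s = 0.

Definition vlip T M Y := forall s t, s <= t -> t <= T -> enorm (Y t - Y s) <= M * (t - s).

Lemma dot_glAv e g h N Y t :
  dot e (glAv g h N Y t) = glA g h N (fun s => dot e (Y s)) t.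
Proof.
rewrite dotZr dot_sumr; congr (_ * _); apply: eq_bigr => j _.
by rewrite dotZr dotBr.
Qed.

Lemma coord_glAv i g h N Y t :
  glAv g h N Y t 0 i = glA g h N (fun s => Y s 0 i) t.
Proof.
rewrite mxE summxE; congr (_ * _); apply: eq_bigr => j _.
by rewrite !mxE.
Qed.

Lemma vlip_dot T M Y e : vlip T M Y -> lip_upto T (M * enorm e) (fun s => dot e (Y s)).
Proof.
move=> lY s t /andP[st tT]; rewrite -dotBr ler_norml.
have := lY s t st tT; have := dot_le e (Y t - Y s); have := dot_le (- e) (Y t - Y s).
rewrite enormN [dot (- e) _]dotC dotNr [dot (_ - _) e]dotC => d1 d2 H.
have : enorm e * enorm (Y t - Y s) <= enorm e * (M * (t - s)).
  by rewrite ler_wpM2l ?enorm_ge0.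
by move=> ?; apply/andP; split; nra.
Qed.

Lemma vlip_le T T' M Y : T' <= T -> vlip T M Y -> vlip T' M Y.
Proof. by move=> TT lY s t st tT; apply: lY => //; apply: le_trans TT. Qed.

Lemma vcausal_dot Y e : vcausal Y -> causal (fun s => dot e (Y s)).
Proof. by move=> cY s s0; rewrite cY // dot0r. Qed.

Lemma glAv_refine g h K N M Y t : 0 < g < 1 -> 0 < h -> 0 <= M -> (0 < K)%N ->
  vlip t M Y ->
  enorm (glAv g (h / K%:R) (N * K) Y t - glAv g h N Y t) <= (g^-1 + 2) * M * h `^ g.
Proof.
move=> g01 h0 M0 K0 lY; have /andP[g0 g1] := g01.
apply: enorm_le_dual => [|e].
  by rewrite !mulr_ge0 ?powR_ge0 // addr_ge0 // invr_ge0 ltW.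
rewrite dotBr !dot_glAv; apply: le_trans (ler_norm _) _.
apply: le_trans (glA_refine N g01 h0 _ K0 (vlip_dot e lY)) _.
  by rewrite mulr_ge0 ?enorm_ge0.
by rewrite le_eqVlt; apply/orP; left; apply/eqP; ring.
Qed.

Lemma glAv_shift g h M N Y t' t : 0 < g < 1 -> 0 < h -> 0 <= M -> vcausal Y ->
  vlip t M Y -> t' <= t -> t <= N%:R * h ->
  enorm (glAv g h N Y t - glAv g h N Y t') <=
  2 / g * M * (t - t') `^ g + 2 * M * h `^ g.
Proof.
move=> g01 h0 M0 cY lY t't tN; have /andP[g0 g1] := g01.
apply: enorm_le_dual => [|e].
  by rewrite addr_ge0 // ?mulr_ge0 ?powR_ge0 // invr_ge0 ltW.
rewrite dotBr !dot_glAv; apply: le_trans (ler_norm _) _.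
apply: le_trans (glA_shift g01 h0 _ (vcausal_dot e cY) (vlip_dot e lY) t't tN) _.
  by rewrite mulr_ge0 ?enorm_ge0.
by rewrite le_eqVlt; apply/orP; left; apply/eqP; ring.
Qed.

(** The inequality is quadratic, hence out of reach of duality; it is summed over the coordinates
    instead. *)
Lemma glAv_square g h N Y t : 0 < g < 1 -> 0 < h -> vcausal Y -> t <= N%:R * h ->
  enorm (glAv g h N Y t) ^+ 2 <= 2 * (h `^ (g - 1) * \sum_(j < N) glw g j *
    dot (glAv g h N Y (t - j%:R * h)) (Y (t - j%:R * h) - Y (t - j.+1%:R * h))).
Proof.
move=> g01 h0 cY tN.
have cYi i : causal (fun s => Y s 0 i) by move=> s s0; rewrite cY // mxE.
rewrite enorm2 /dot.
apply: (@le_trans _ _ (\sum_(i < n) 2 * (h `^ (g - 1) * \sum_(j < N) glw g j *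
    (glA g h N (fun s => Y s 0 i) (t - j%:R * h) *
     (Y (t - j%:R * h) 0 i - Y (t - j.+1%:R * h) 0 i))))).
  apply: ler_sum => i _; rewrite -expr2 coord_glAv.
  exact: (glA_square g01 h0 (cYi i) tN).
rewrite -!mulr_sumr exchange_big /= le_eqVlt; apply/orP; left; apply/eqP.
congr (_ * (_ * _)); apply: eq_bigr => j _; rewrite mulr_sumr.
by apply: eq_bigr => i _; rewrite coord_glAv !mxE.
Qed.

Lemma glAv_le g h N Y t (b : nat -> R) : 0 < g -> 0 < h ->
  (forall j, (j < N)%N -> enorm (Y (t - j%:R * h) - Y (t - j.+1%:R * h)) <= h * b j) ->
  enorm (glAv g h N Y t) <= h `^ g * \sum_(j < N) glw g j * b j.
Proof.
move=> g0 h0 Yb; have b0 j : (j < N)%N -> 0 <= b j.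
  by move=> /Yb; rewrite -(pmulr_rge0 _ h0); apply: le_trans; exact: enorm_ge0.
have W0 j : 0 <= glw g j by rewrite ltW // glw_gt0.
have S0 : 0 <= \sum_(j < N) glw g j * b j.
  by apply: sumr_ge0 => j _; rewrite mulr_ge0 // b0.
apply: enorm_le_dual => [|e]; first by rewrite mulr_ge0 ?powR_ge0.
rewrite dotZr dot_sumr -(powRB1M g h0) -!mulrA ler_wpM2l ?powR_ge0 //.
rewrite mulrA mulrC !mulr_sumr; apply: ler_sum => j _; rewrite dotZr.
have := dot_le e (Y (t - j%:R * h) - Y (t - j.+1%:R * h)).
have := ler_wpM2l (enorm_ge0 e) (Yb j (ltn_ord j)) => h1 h2.
rewrite (_ : enorm e * _ = glw g j * (enorm e * (h * b j))); last by ring.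
by rewrite ler_wpM2l // (le_trans h2).
Qed.

(** The approximating motion is unconstrained at negative times; cutting it off makes it causal. *)
Definition zext Y s : 'rV[R]_n := if s <= 0 then 0 else Y s.

Lemma zext_causal Y : vcausal (zext Y).
Proof. by move=> s s0; rewrite /zext s0. Qed.

Lemma zextE Y s : 0 <= s -> Y 0 = 0 -> zext Y s = Y s.
Proof.
move=> s0 Y0; rewrite /zext; case: ifP => // s0'.
by rewrite (@le_anti _ _ s 0) ?Y0 // s0 s0'.
Qed.

Lemma zext_lip T M Y : 0 <= T -> 0 <= M -> Y 0 = 0 ->
  (forall s t, 0 <= s -> s <= t -> t <= T -> enorm (Y t - Y s) <= M * (t - s)) ->
  vlip T M (zext Y).
Proof.
move=> T0 M0 Y0 lY s t st tT.
have [t0|t0] := leP t 0.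
  rewrite !zext_causal ?(le_trans st) // subrr enorm0 mulr_ge0 // subr_ge0 //.
rewrite (zextE (ltW t0)) //; have [s0|s0] := leP 0 s; first by rewrite zextE // lY.
rewrite zext_causal ?(ltW s0) // -Y0; apply: le_trans (lY _ _ _ _ _) _ => //.
  exact: ltW.
by rewrite ler_wpM2l // lerD2l lerN2 ltW.
Qed.

(** With [m] the integer part of [t / h], the node [t - m.+1 h] is not positive, so the boundary
    term of the Abel summation vanishes and the [m.+1] terms of the fractional difference remain. *)
Lemma scaled_diffE alpha h N Y t : 0 < h -> 0 <= t -> t <= N%:R * h -> Y 0 = 0 ->
  scaled_diff alpha h Y t = glAv alpha h N (zext Y) t.
Proof.
move=> h0 t0 tN Y0; apply/rowP => i; rewrite coord_glAv.
pose f s := zext Y s 0 i.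
have cf : causal f by move=> s s0; rewrite /f zext_causal // mxE.
set m := Num.truncn (t / h).
have mt : m%:R * h <= t.
  by rewrite -ler_pdivlMr // truncn_le divr_ge0 // ltW.
have tm : t <= m.+1%:R * h by rewrite -ler_pdivrMr // ltW // truncnS_gt.
have -> : glA alpha h N f t = glA alpha h m.+1 f t.
  have := leq_total N m.+1 => /orP[] Nm.
    by rewrite (glA_indep _ h0 cf tN Nm).
  by rewrite -(glA_indep _ h0 cf tm Nm).
rewrite /glA (glw_by_parts _ (fun j => f (t - j%:R * h))) cf; last by rewrite subr_le0.
rewrite mulr0 subr0 mxE; congr (_ * _); rewrite summxE.
apply: eq_bigr => j _; rewrite mxE gbinomE opprB /f zextE // subr_ge0.
apply: le_trans mt; rewrite ler_wpM2r ?(ltW h0) // ler_nat.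
by have := ltn_ord j; rewrite ltnS.
Qed.

(** One-sided on purpose: [zext] may have a kink at 0, and real induction only ever moves to the
    right. *)
Definition rder Y t (d : 'rV[R]_n) := forall q : R, 0 < q -> exists2 r : R, 0 < r &
  forall k, 0 < k < r -> `|Y (t + k) - Y t - k *: d| <= q * k.

Lemma derivable_rder Y t : derivable Y t 1 -> rder Y t (derive1 Y t).
Proof.
move=> dY e e0; rewrite derive1E.
have /cvgrPdist_le /(_ e e0) := dY.
rewrite near_withinE => /nbhs_ballP[r /= r0 Hr]; exists r => // k /andP[k0 kr].
have /= := Hr k; rewrite /ball /= sub0r normrN gtr0_norm // gt_eqF //.
move=> /(_ kr isT); rewrite [k%:A]mulr1 [k + t]addrC => H.
rewrite -[X in X *: _]opprK.
have -> : Y (t + k) - Y t - - - k *: 'D_1 Y t =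
    k *: (k^-1 *: (Y (t + k) - Y t) - 'D_1 Y t).
  by rewrite opprK scalerBr scalerA mulfV ?gt_eqF // scale1r.
by rewrite normrZ gtr0_norm // mulrC ler_wpM2r ?(ltW k0) // distrC.
Qed.

Lemma rder_zext Y t d : 0 <= t -> Y 0 = 0 -> rder Y t d -> rder (zext Y) t d.
Proof.
move=> t0 Y0 dY e e0; have [r r0 Hr] := dY e e0; exists r => // k kr.
have /andP[k0 _] := kr.
by rewrite !zextE ?Hr // addr_ge0 // ltW.
Qed.

Lemma vec_ae_le (Y : R -> 'rV[R]_n) e (L c a b : R) (P : R -> Prop) : a <= b ->
  vlip b L Y -> ae_on `[a, b] P ->
  (forall t, a <= t < b -> P t -> exists2 d, rder Y t d & dot e d <= c) ->
  dot e (Y b - Y a) <= c * (b - a).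
Proof.
move=> ab lY aeP PY; rewrite dotBr.
apply: (@ae_derive_le _ (fun s => dot e (Y s)) (L * enorm e) c a b P) => //.
- by move=> s t as_ st tb; apply: (vlip_dot e lY); rewrite st.
- move=> t tab /(PY t tab)[d dY dc] q q0.
  (* The remainder in [rder] is measured in the sup norm; pairing it with [e] costs the factor
     [enorm e * n], and the 1 keeps the divisor positive. *)
  have C0 : 0 < enorm e * n%:R + 1 by rewrite ltr_wpDl // mulr_ge0 ?enorm_ge0.
  have [r r0 Hr] := dY (q / (enorm e * n%:R + 1)) (divr_gt0 q0 C0).
  exists r => // k kr; have /andP[k0 _] := kr.
  rewrite -dotBr -(subrK (k *: d) (Y (t + k) - Y t)) dotDr dotZr mulrDl addrC.
  apply: lerD; first by rewrite mulrC ler_wpM2r // ltW.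
  apply: le_trans (dot_le _ _) _.
  apply: (@le_trans _ _ (enorm e * (n%:R * (q / (enorm e * n%:R + 1) * k)))).
    rewrite ler_wpM2l ?enorm_ge0 // (le_trans (enorm_le_norm _)) //.
    by rewrite ler_wpM2l // Hr.
  rewrite !mulrA ler_wpM2r ?(ltW k0) // ler_pdivrMr // mulrC ler_wpM2l ?(ltW q0) //.
  by rewrite lerDl.
Qed.

End VectorGrunwaldLetnikov.

(** * Motions of the two systems *)

Section Motions.
Context {R : realType}.
Notation cmu := (@completed_lebesgue_measure R).

(** The density is bounded only almost everywhere; clipping its coordinates to [[- |M|, |M|]]
    changes no integral and gives the pointwise bound that the scalar estimates require. *)
Lemma RLint_bounded_coord n (a T : R) (phi : R -> 'rV[R]_n) : Linfty T phi ->
  exists2 M : R, 0 <= M & exists psi : 'I_n -> R -> R,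
  [/\ forall i, measurable_fun (`[0, T]%classic : set (lebesgueType R))
        (psi i : lebesgueType R -> R),
      forall i s, `|psi i s| <= M &
      forall i t, t <= T -> RLint a phi t 0 i = RLs a (psi i) t].
Proof.
move=> [mphi [M aeM]]; exists `|M| => //.
pose psi i s := Num.max (- `|M|) (Num.min `|M| (phi s 0 i)).
have mpsi i : measurable_fun (`[0, T]%classic : set (lebesgueType R))
    (psi i : lebesgueType R -> R).
  by apply: measurable_maxr; [exact: measurable_cst|apply: measurable_minr;
    [exact: measurable_cst|exact: mphi]].
exists psi; split => // [i s|i t tT].
  rewrite ler_norml /psi le_max lexx /= ge_max ge_min lexx andbT.
  by rewrite -subr_ge0 opprK addr_ge0.
rewrite mxE mxE /RLs; congr (_ * _).
have sub : `[0, t]%classic `<=` `[0, T]%classic.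
  by move=> s /=; rewrite !in_itv /= => /andP[-> /le_trans ->].
have mI : measurable (`[0, t]%classic : set (lebesgueType R)).
  exact: lebesgue_measurable_itv.
have mk : measurable_fun (`[0, t]%classic : set (lebesgueType R))
    ((fun s => (t - s) `^ (a - 1)) : lebesgueType R -> R).
  apply: lebesgue_measurable_fun; first exact: measurable_itv.
  exact: measurable_RLkernel.
have E : \int[cmu]_(s in `[0, t]) (((t - s) `^ (1 - a))^-1 *: phi s) 0 i =
    \int[cmu]_(s in `[0, t]) ((t - s) `^ (a - 1) * phi s 0 i).
  by apply: eq_Rintegral => s _; rewrite mxE -powRN opprB.
have mkf (f : R -> R) : measurable_fun (`[0, T]%classic : set (lebesgueType R))
      (f : lebesgueType R -> R) ->
    measurable_fun (`[0, t]%classic : set (lebesgueType R))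
      ((fun s => ((t - s) `^ (a - 1) * f s)%:E) : lebesgueType R -> \bar R).
  move=> mf; apply/measurable_EFinP; apply: measurable_funM; first exact: mk.
  exact: measurable_funS (lebesgue_measurable_itv _) sub mf.
rewrite E /Rintegral; congr fine.
apply: (ae_eq_integral _ _ mI (mkf _ (mphi i)) (mkf _ (mpsi i))).
case: aeM => A [mA A0 HA]; exists A; split => // s /= Hs; apply: HA => /= HsM.
apply: Hs => /sub /HsM sM; congr (_ * _)%:E.
have := le_trans (coord_le_enorm _ i) (le_trans sM (ler_norm M)).
rewrite ler_norml /psi => /andP[l1 l2].
by rewrite min_r // max_r.
Qed.

(** As [x - x0] is the integral of order [a] of [psi], integrating it to order [1 - a] gives the
    ordinary primitive by the semigroup property. *)
Lemma caputo_primitive_coord n (a T : R) (x0 : 'rV[R]_n) (x : R -> 'rV[R]_n)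
    (i : 'I_n) (psi : R -> R) (M : R) : 0 < a < 1 -> 0 < T -> 0 <= M ->
  measurable_fun (`[0, T]%classic : set (lebesgueType R))
    (psi : lebesgueType R -> R) ->
  (forall s, `|psi s| <= M) -> x 0 = x0 ->
  (forall t, 0 <= t <= T -> x t 0 i = x0 0 i + RLs a psi t) ->
  forall t, 0 <= t <= T -> caputo_primitive a x t 0 i = Gamma (1 - a) * prim psi t.
Proof.
move=> a01 T0 M0 mpsi psiM xx0 xE t /andP[t0 tT].
have b01 : 0 < 1 - a < 1 by have /andP[a0 a1] := a01; rewrite subr_gt0 gtrBl a1.
have psiM' s : 0 <= s <= T -> `|psi s| <= M by [].
rewrite -(RLs_semigroup a01 T0 M0 mpsi psiM') ?t0 //.
rewrite {1}/RLs mulrA mulfV ?mul1r; last by rewrite gt_eqF // Gamma_gt0.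
rewrite mxE; apply: eq_Rintegral => s; rewrite inE /= in_itv /= => /andP[s0 st].
rewrite !mxE xx0 xE ?s0 ?(le_trans st) // -powRN.
by congr (_ `^ _ * _); ring.
Qed.

(* The motion of the fractional system is recovered from the primitive of its
   fractional derivative, which solves an ordinary differential equation. *)
Lemma motion_spec n nu nv (a T : R)
    (g : R -> 'rV[R]_n -> 'rV[R]_nu -> 'rV[R]_nv -> 'rV[R]_n) x0 u v x :
  0 < a < 1 -> 0 < T -> is_motion a T g x0 u v x ->
  exists (Y : R -> 'rV[R]_n) (L C : R), [/\ vcausal Y, 0 <= L /\ 0 <= C, vlip T L Y,
    ae_on `[0, T] (fun t => t < T -> rder Y t (g t (x t) (u t) (v t))) &
    forall h N t, 0 < h -> 0 <= t <= T -> t <= N%:R * h ->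
      enorm (x t - x0 - glAv a h N Y t) <= C * h `^ a].
Proof.
move=> a01 T0 [[phi Lphi xE] xx0 aeg]; have /andP[a0 a1] := a01.
have b01 : 0 < 1 - a < 1 by rewrite subr_gt0 gtrBl a1.
have [M M0 [psi [mpsi psiM psiE]]] := RLint_bounded_coord a Lphi.
pose Y t : 'rV[R]_n := \row_i prim (psi i) t.
have psiM' i s : 0 <= s <= T -> `|psi i s| <= M by [].
have xE' i t : 0 <= t <= T -> x t 0 i = x0 0 i + RLs a (psi i) t.
  by move=> tT; have /andP[_ t2] := tT; rewrite xE ?in_itv //= mxE psiE.
have cY : vcausal Y.
  by move=> s s0; apply/rowP => i; rewrite !mxE prim_causal.
have lY : vlip T (n%:R * M) Y.
  move=> s t st tT; rewrite -mulrA; apply: enorm_le_coord => i; rewrite !mxE.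
  by apply: (prim_lip M0 (mpsi i) (psiM' i)); rewrite st.
exists Y, (n%:R * M), (n%:R * ((a^-1 + 2) * M)); split => //.
- split; first by rewrite mulr_ge0.
  by rewrite !mulr_ge0 // addr_ge0 // invr_ge0 ltW.
- case: aeg => A [mA A0 HA]; exists A; split => // t /= Ht; apply: HA => /= Ht'.
  apply: Ht => t0T tT; have [dx] := Ht' t0T.
  have := t0T; rewrite /= in_itv /= => /andP[t0 _].
  have cE s : 0 <= s <= T -> caputo_primitive a x s = Gamma (1 - a) *: Y s.
    move=> sT; apply/rowP => i; rewrite [RHS]mxE [X in _ * X]mxE.
    exact: (caputo_primitive_coord a01 T0 M0 (mpsi i) (psiM i) xx0 (xE' i) sT).
  have G1 := Gamma_ge1 b01; have G0 := Gamma_gt0 b01.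
  rewrite /caputo => <- q q0.
  have [r r0 Hr] := derivable_rder dx q0.
  (* [cE] holds on [[0, T]] only, so [t + k] must not leave this interval; hence the restriction to
     [t < T]. *)
  exists (Num.min r (T - t)); first by rewrite lt_min r0 subr_gt0.
  move=> k /andP[k0]; rewrite lt_min => /andP[kr kT].
  have := Hr k; rewrite k0 kr => /(_ isT).
  rewrite !cE ?t0 ?(ltW tT) //; last first.
    by rewrite addr_ge0 ?(ltW k0) //= -lerBrDl ltW.
  set d := derive1 _ t => H.
  have -> : Y (t + k) - Y t - k *: ((Gamma (1 - a))^-1 *: d) =
      (Gamma (1 - a))^-1 *: (Gamma (1 - a) *: Y (t + k) - Gamma (1 - a) *: Y t - k *: d).
    rewrite !scalerBr !scalerA mulVf ?gt_eqF // !scale1r.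
    by rewrite [k * _]mulrC.
  rewrite normrZ gtr0_norm ?invr_gt0 // ler_pdivrMl //.
  (* [Gamma (1 - a) >= 1], so dividing by it does not enlarge the remainder. *)
  by apply: (le_trans H); rewrite ler_peMl // mulr_ge0 ?ltW.
- move=> h N t h0 tT tN; rewrite -mulrA; apply: enorm_le_coord => i.
  rewrite mxE [X in _ + X]mxE coord_glAv mxE xE' // mxE [x0 0 i + _]addrC addrK.
  have /andP[_ t2] := tT.
  have := RLs_glA a01 M0 (mpsi i) (psiM' i) h0 t2 tN.
  by rewrite (_ : (fun s => Y s 0 i) = prim (psi i)) //; apply/funext => s; rewrite mxE.
Qed.

Lemma approx_spec n nu nv (a T : R)
    (g : R -> 'rV[R]_n -> 'rV[R]_nu -> 'rV[R]_nv -> 'rV[R]_n) x0 h u v y :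
  0 < T -> is_approx_motion a T g x0 h u v y ->
  exists L : R, [/\ 0 <= L, vlip T L (zext y), y 0 = 0 &
    ae_on `[0, T] (fun t =>
      rder (zext y) t (g t (x0 + scaled_diff a h y t) (u t) (v t)))].
Proof.
move=> T0 [lipy y0 aeg].
have [L L0 HL] := pinfty_ex_gt0 lipy.
exists (n%:R * L); split => //.
- by rewrite mulr_ge0 // ltW.
- apply: zext_lip => //; [exact: ltW|by rewrite mulr_ge0 // ltW|].
  move=> s t s0 st tT; apply: le_trans (enorm_le_norm _) _.
  rewrite -mulrA ler_wpM2l //.
  have := HL (t, s) => /=; rewrite [`|t - s|]ger0_norm ?subr_ge0 //; apply.
  by split; rewrite /= in_itv /= ?s0 ?(le_trans s0 st) ?(le_trans st tT).
- case: aeg => A [mA A0 HA]; exists A; split => // t /= Ht; apply: HA => /= Ht'.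
  apply: Ht => t0T; have [dy <-] := Ht' t0T.
  apply: rder_zext => //; last exact: derivable_rder.
  by move: t0T; rewrite /= in_itv /= => /andP[].
Qed.

End Motions.

(** * Gronwall estimates *)

Section Gronwall.
Context {R : realType}.

(* Weighting by [expR (L * t)] makes the fractional integral a contraction. *)
Lemma gronwall (z : R -> R) (T L B K : R) : 0 < T ->
  (forall s, 0 <= s <= T -> 0 <= z s <= K) -> 0 <= L ->
  (forall S, 0 <= S -> (forall s, 0 <= s <= T -> z s <= S * expR (L * s)) ->
     forall t, 0 <= t <= T -> z t <= (B + S / 2) * expR (L * t)) ->
  forall t, 0 <= t <= T -> z t <= 2 * B * expR (L * t).
Proof.
move=> T0 zK L0 step.
pose A := [set z s * expR (- (L * s)) | s in [set s | 0 <= s <= T]].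
have T00 : (0 : R) <= 0 <= T by rewrite lexx ltW.
have hA : has_sup A.
  split; first by exists (z 0 * expR (- (L * 0))), 0.
  exists K => _ [s sT <-]; have /andP[z0 zs] := zK s sT.
  apply: le_trans zs; rewrite ler_piMr // expR_le1 oppr_le0.
  by rewrite mulr_ge0 //; case/andP: sT.
have zS s : 0 <= s <= T -> z s <= sup A * expR (L * s).
  move=> sT; rewrite -ler_pdivrMr ?expR_gt0 // -expRN.
  by apply: (ub_le_sup hA.2); exists s.
have S0 : 0 <= sup A.
  have := zS 0 T00; rewrite mulr0 expR0 mulr1; apply: le_trans.
  by have /andP[] := zK 0 T00.
have SB : sup A <= 2 * B.
  have : sup A <= B + sup A / 2.
    apply: ge_sup; first exact: hA.1.
    move=> _ [s sT <-]; rewrite expRN ler_pdivrMr ?expR_gt0 //.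
    exact: step.
  by lra.
move=> t tT; apply: le_trans (zS t tT) _.
by rewrite ler_wpM2r // expR_ge0.
Qed.

Lemma ae_onW (D D' : set R) (P P' : R -> Prop) : D' `<=` D ->
  (forall t, D' t -> P t -> P' t) -> ae_on D P -> ae_on D' P'.
Proof.
move=> DD PP [A [mA A0 HA]]; exists A; split => // s /= Hs; apply: HA => /= Ps.
by apply: Hs => D's; apply: PP => //; apply: Ps; apply: DD.
Qed.

Lemma ae_onI (D : set R) (P P' : R -> Prop) : ae_on D P -> ae_on D P' ->
  ae_on D (fun t => P t /\ P' t).
Proof.
move=> aeP aeP'; have := negligibleU aeP aeP'; apply: negligibleS => s /= Hs.
apply: contrapT => /not_orP[/contrapT H1 /contrapT H2]; apply: Hs => Ds.
by split; [exact: H1|exact: H2].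
Qed.

Lemma enorm_ae_le n (Y : R -> 'rV[R]_n) (L c a b : R) (P : R -> Prop) :
  a <= b -> 0 <= c -> vlip b L Y -> ae_on `[a, b] P ->
  (forall t, a <= t < b -> P t -> exists2 d, rder Y t d & enorm d <= c) ->
  enorm (Y b - Y a) <= c * (b - a).
Proof.
move=> ab c0 lY aeP PY; apply: enorm_le_dual => [|e].
  by rewrite mulr_ge0 // subr_ge0.
rewrite mulrAC; apply: (vec_ae_le ab lY aeP) => t tab /(PY t tab)[d dY dc].
exists d => //; apply: le_trans (dot_le _ _) _; rewrite mulrC.
by rewrite ler_wpM2r ?enorm_ge0.
Qed.

Lemma enorm_ae_causal n (Y : R -> 'rV[R]_n) (L c s t : R) (P : R -> Prop) :
  s <= t -> 0 <= c -> vcausal Y -> vlip t L Y -> ae_on `[0, t] P ->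
  (forall r, 0 <= r < t -> P r -> exists2 d, rder Y r d & enorm d <= c) ->
  enorm (Y t - Y s) <= c * (t - s).
Proof.
move=> st c0 cY lY aeP PY; have [t0|t0] := leP t 0.
  by rewrite !cY ?(le_trans st) // subrr enorm0 mulr_ge0 // subr_ge0.
have H r : 0 <= r -> r <= t -> enorm (Y t - Y r) <= c * (t - r).
  move=> r0 rt; apply: (enorm_ae_le rt c0 lY (P := P)).
    by apply: ae_onW aeP => // q /=; rewrite !in_itv /= => /andP[/(le_trans r0) -> ->].
  by move=> q /andP[rq qt]; apply: PY; rewrite (le_trans r0 rq).
have [s0|s0] := leP 0 s; first exact: H.
rewrite (cY s) ?(ltW s0) // -(cY 0 (lexx 0)).
apply: le_trans (H 0 (lexx 0) (ltW t0)) _.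
by rewrite ler_wpM2l // lerD2l lerN2 ltW.
Qed.

(** [Rb] and [h0] are chosen before [Y] and its Lipschitz constant, so they are uniform over all
    motions. Allowing [z] to differ from [glAv] by 1 covers the fractional motion as well as the
    approximating one. *)
Lemma apriori n (a T c b : R) : 0 < a < 1 -> 0 < T -> 0 < c -> 0 <= b ->
  exists Rb h0 : R, [/\ 0 <= Rb, 0 < h0 &
    forall (Y z : R -> 'rV[R]_n) (h L : R) N (P : R -> Prop),
    0 < h <= h0 -> T <= N%:R * h -> N%:R * h <= T + 1 ->
    vcausal Y -> 0 <= L -> vlip T L Y -> ae_on `[0, T] P ->
    (forall t, 0 <= t < T -> P t ->
      exists2 d, rder Y t d & enorm d <= c * (b + enorm (z t))) ->
    (forall t, 0 <= t <= T -> enorm (z t - glAv a h N Y t) <= 1) ->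
    forall t, 0 <= t <= T -> enorm (z t) <= Rb].
Proof.
move=> a01 T0 c0 b0; have /andP[a0 a1] := a01.
(* The velocity bound contributes a factor [c], and [gronwall] wants [S / 2]. *)
have k0 : 0 < (2 * c)^-1 by rewrite invr_gt0 mulr_gt0.
have [L [h0 [L0 h00 Hk]]] := glw_exp_sum_small a01 k0.
pose CT := (T + 1) `^ a / a.
(* The 1 is the distance from [z] to [glAv]; [CT] bounds the total weight, through [N h <= T + 1],
   and multiplies the constant part [c * b] of the velocity. *)
pose B := 1 + c * b * CT.
have CT0 : 0 <= CT by rewrite divr_ge0 ?powR_ge0 // ltW.
have cb0 : 0 <= c * b by rewrite mulr_ge0 ?(ltW c0).
have B0 : 0 <= B by apply: addr_ge0 => //; exact: mulr_ge0.
exists (2 * B * expR (L * T)), h0; split => //.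
  by apply: mulr_ge0; rewrite ?expR_ge0 ?mulr_ge0.
move=> Y z h Lp N P hh0 TN NT cY Lp0 lY aeP PY zA.
have /andP[h_gt0 hle] := hh0.
have sumW : h `^ a * \sum_(j < N) glw a j <= CT.
  apply: le_trans (glw_sum_scaled N a01 (ltW h_gt0)) _.
  rewrite ler_wpM2r ?invr_ge0 ?(ltW a0) //.
  apply: ge0_ler_powR; rewrite ?nnegrE ?(ltW a0) ?mulr_ge0 ?(ltW h_gt0) //.
  by rewrite addr_ge0 // ltW.
have zle t (bb : nat -> R) : 0 <= t <= T ->
    (forall j, (j < N)%N ->
       enorm (Y (t - j%:R * h) - Y (t - j.+1%:R * h)) <= h * bb j) ->
    enorm (z t) <= 1 + h `^ a * \sum_(j < N) glw a j * bb j.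
  move=> tT Hb; rewrite -(subrK (glAv a h N Y t) (z t)).
  apply: le_trans (enorm_triangle _ _) _; apply: lerD; first exact: zA.
  exact: glAv_le.
have th (t : R) j : t - j%:R * h <= t by rewrite gerBl mulr_ge0 ?(ltW h_gt0).
have step (t : R) j : t - j.+1%:R * h <= t - j%:R * h.
  by rewrite lerD2l lerN2 ler_pM2r // ler_nat.
have stepE (t : R) j : t - j%:R * h - (t - j.+1%:R * h) = h.
  by rewrite -natr1; ring.
have main : forall t, 0 <= t <= T -> enorm (z t) <= 2 * B * expR (L * t).
  (* The bound involving [Lp] only makes a supremum finite; it does not enter the conclusion. *)
  apply: (@gronwall (fun t => enorm (z t)) T L B (1 + Lp * CT)) => //.
  - move=> s sT; rewrite enorm_ge0 /=.
    apply: (le_trans (zle s (fun=> Lp) sT _)).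
      move=> j _; have /andP[_ s2] := sT.
      apply: le_trans (lY _ _ (step s j) (le_trans (th s j) s2)) _.
      by rewrite stepE mulrC.
    by rewrite lerD2l -mulr_suml mulrA mulrC ler_wpM2l.
  - exact: ltW.
  - move=> S S0 zS t tT; have /andP[t0 t2] := tT.
    have E1 s : 0 <= s -> 1 <= expR (L * s).
      by move=> s0; rewrite -expR0 ler_expR mulr_ge0 // ltW.
    (* Velocity bound on cell [j], whose times are at most [t - j h]: there [z] is at most
       [S * expR (L * (t - j h))]. *)
    pose bb j := c * (b + S * (expR (L * t) * expR (- (L * (j%:R * h))))).
    have bb0 j : 0 <= bb j.
      apply: mulr_ge0; first exact: ltW.
      by apply: addr_ge0 => //; rewrite !mulr_ge0 ?expR_ge0.
    apply: (le_trans (zle t bb tT _)).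
      move=> j _; set s := t - j%:R * h.
      have sT : s <= T by apply: le_trans t2; exact: th.
      have -> : h * bb j = bb j * (s - (t - j.+1%:R * h)) by rewrite stepE mulrC.
      apply: (@enorm_ae_causal _ Y Lp _ _ _ P) => //.
      - exact: vlip_le lY.
      - by apply: ae_onW aeP => // q /=; rewrite !in_itv /= => /andP[-> /le_trans ->].
      move=> r /andP[r0 rs] Pr.
      have [|d dY dc] := PY r _ Pr; first by rewrite r0 (lt_le_trans rs).
      exists d => //; apply: (le_trans dc); rewrite /bb ler_wpM2l ?(ltW c0) //.
      rewrite lerD2l; apply: le_trans (zS r _) _.
        by rewrite r0 (le_trans (ltW rs)).
      rewrite ler_wpM2l // -expRD ler_expR -mulrN -mulrDr ler_wpM2l ?(ltW L0) //.
      exact: ltW.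
    rewrite /bb [leLHS](_ : _ = 1 + c * b * (h `^ a * \sum_(j < N) glw a j) +
        c * S * expR (L * t) * (h `^ a *
        \sum_(j < N) glw a j * expR (- (L * (j%:R * h))))); last first.
      rewrite -addrA; congr (_ + _); rewrite !(mulrA _ (h `^ a)).
      rewrite !mulr_sumr -big_split; apply: eq_bigr => j _ /=; ring.
    rewrite mulrDl; apply: lerD.
      apply: (@le_trans _ _ B).
        by rewrite lerD2l ler_wpM2l.
      by rewrite ler_peMr // E1.
    have -> : S / 2 * expR (L * t) = c * S * expR (L * t) * (2 * c)^-1.
      by field; rewrite gt_eqF.
    rewrite ler_wpM2l ?mulr_ge0 ?expR_ge0 ?(ltW c0) //.
    exact: Hk.
move=> t tT; apply: (le_trans (main t tT)).
rewrite ler_wpM2l ?mulr_ge0 // ler_expR ler_wpM2l ?(ltW L0) //.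
by case/andP: tT.
Qed.

(* The constant involves the Lipschitz constant of [Y] only, because the
   approximation can be compared with those of steps [h / K], [K -> oo]. *)
Lemma glAv_limit n (a C M h : R) N (Y : R -> 'rV[R]_n) w t : 0 < a < 1 ->
  0 <= M -> vlip t M Y -> 0 <= C ->
  (forall (h : R) N, 0 < h -> t <= N%:R * h ->
     enorm (w - glAv a h N Y t) <= C * h `^ a) ->
  0 < h -> t <= N%:R * h ->
  enorm (w - glAv a h N Y t) <= (a^-1 + 2) * M * h `^ a.
Proof.
move=> a01 M0 lY C0 HC h0 tN; have /andP[a0 a1] := a01.
apply: (le_powR_lim a0 C0) => q /andP[q0 _].
pose K := (Num.truncn (h / q)).+1.
have K0 : 0 < K%:R :> R by rewrite ltr0n.
have hK : h / K%:R <= q.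
  rewrite ler_pdivrMr // mulrC -ler_pdivrMr //; exact/ltW/truncnS_gt.
have hK0 : 0 < h / K%:R by rewrite divr_gt0.
have cov : t <= (N * K)%:R * (h / K%:R).
  by rewrite natrM -mulrA [K%:R * _]mulrC divfK ?gt_eqF.
rewrite -(subrKA (glAv a (h / K%:R) (N * K) Y t)) addrC.
apply: le_trans (enorm_triangle _ _) _; apply: lerD.
  exact: glAv_refine.
apply: (le_trans (HC _ _ hK0 cov)); rewrite ler_wpM2l //.
by apply: ge0_ler_powR; rewrite ?nnegrE ?(ltW a0) ?(ltW hK0) ?(ltW q0).
Qed.

Lemma glAv_causal n (a h : R) N (Y : R -> 'rV[R]_n) : 0 < h -> vcausal Y ->
  vcausal (glAv a h N Y).
Proof.
move=> h0 cY s s0; rewrite /glAv big1 ?scaler0 // => j _.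
have le0 i : s - i%:R * h <= 0.
  by rewrite subr_le0 (le_trans s0) // mulr_ge0 ?(ltW h0).
by rewrite !cY ?subrr ?scaler0.
Qed.

Lemma glAv_bounded n (a h L T : R) N (Y : R -> 'rV[R]_n) t : 0 < a < 1 -> 0 < h ->
  0 <= L -> vlip T L Y -> t <= T ->
  enorm (glAv a h N Y t) <= L * ((N%:R * h) `^ a / a).
Proof.
move=> a01 h0 L0 lY tT; have /andP[a0 _] := a01.
apply: (@le_trans _ _ (h `^ a * \sum_(j < N) glw a j * L)).
  apply: glAv_le => // j _; apply: le_trans (lY _ _ _ _) _.
  - by rewrite lerD2l lerN2 ler_pM2r // ler_nat.
  - by rewrite (le_trans _ tT) // gerBl mulr_ge0 // ltW.
  - by rewrite (_ : _ - _ = h) 1?mulrC // -natr1; ring.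
rewrite -mulr_suml mulrA mulrC.
by rewrite ler_wpM2l // glw_sum_scaled // ltW.
Qed.

(** [K] and [h0] depend on [a], [T] and [lam] alone, which allows the tolerance [eta] to be chosen
    after [K]; the Lipschitz constant only ensures a finite supremum. *)
Lemma square_gronwall n (a T lam : R) : 0 < a < 1 -> 0 < T -> 0 < lam ->
  exists K h0 : R, [/\ 0 <= K, 0 < h0 &
    forall (Y : R -> 'rV[R]_n) (h L eta : R) N,
    0 < h <= h0 -> T <= N%:R * h -> N%:R * h <= T + 1 ->
    vcausal Y -> 0 <= L -> vlip T L Y -> 0 <= eta ->
    (forall s, 0 <= s <= T -> dot (glAv a h N Y s) (Y s - Y (s - h)) <=
       h * (lam * enorm (glAv a h N Y s) ^+ 2 + eta)) ->
    forall t, 0 <= t <= T -> enorm (glAv a h N Y t) ^+ 2 <= K * eta].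
Proof.
move=> a01 T0 lam0; have /andP[a0 a1] := a01.
(* The factor 2 of [glAv_square] and [lam] combine with it to [2 lam S / (4 lam) = S / 2]. *)
have k0 : 0 < (4 * lam)^-1 by rewrite invr_gt0 mulr_gt0.
have [L [h0 [L0 h00 Hk]]] := glw_exp_sum_small a01 k0.
pose CT := (T + 1) `^ a / a.
have CT0 : 0 <= CT by rewrite divr_ge0 ?powR_ge0 // ltW.
exists (4 * CT * expR (L * T)), h0; split => //.
  by apply: mulr_ge0; [exact: mulr_ge0|exact: expR_ge0].
move=> Y h Lp eta N hh0 TN NT cY Lp0 lY eta0 He.
have /andP[h_gt0 hle] := hh0.
have sumW : h `^ a * \sum_(j < N) glw a j <= CT.
  apply: le_trans (glw_sum_scaled N a01 (ltW h_gt0)) _.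
  rewrite ler_wpM2r ?invr_ge0 ?(ltW a0) //.
  apply: ge0_ler_powR; rewrite ?nnegrE ?(ltW a0) ?mulr_ge0 ?(ltW h_gt0) //.
  by rewrite addr_ge0 // ltW.
pose q t := enorm (glAv a h N Y t) ^+ 2.
have q0 t : 0 <= q t by rewrite sqr_ge0.
have W0 j : 0 <= glw a j by rewrite ltW // glw_gt0.
have th (t : R) j : t - j%:R * h <= t by rewrite gerBl mulr_ge0 ?(ltW h_gt0).
have B0 : 0 <= 2 * CT * eta by apply: mulr_ge0 => //; exact: mulr_ge0.
have main : forall t, 0 <= t <= T -> q t <= 2 * (2 * CT * eta) * expR (L * t).
  apply: (@gronwall q T L (2 * CT * eta) ((Lp * ((N%:R * h) `^ a / a)) ^+ 2)) => //.
  - move=> s /andP[_ sT]; rewrite q0 /= /q ler_pXn2r ?nnegrE ?enorm_ge0 //.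
      exact: glAv_bounded lY sT.
    by apply: mulr_ge0 => //; rewrite divr_ge0 ?powR_ge0 // ltW.
  - exact: ltW.
  - move=> S S0 qS t /andP[t0 tT].
    (* The lattice of [t] reaches negative times, where the discrete integral is 0 and the
       inequality is trivial. *)
    have bnd s : s <= T -> dot (glAv a h N Y s) (Y s - Y (s - h)) <=
        h * (lam * (S * expR (L * s)) + eta).
      move=> sT; have [s0|s0] := leP 0 s.
        apply: le_trans (He s _) _; first by rewrite s0.
        rewrite ler_wpM2l ?(ltW h_gt0) // lerD2r ler_wpM2l ?(ltW lam0) //.
        by apply: qS; rewrite s0.
      rewrite (glAv_causal a N h_gt0 cY (ltW s0)) dotC dot0r.
      apply: mulr_ge0; first exact: ltW.
      by apply: addr_ge0 => //; rewrite !mulr_ge0 ?expR_ge0 // ltW.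
    apply: le_trans (glAv_square a01 h_gt0 cY (le_trans tT TN)) _.
    apply: (@le_trans _ _ (2 * (h `^ (a - 1) * \sum_(j < N) glw a j *
        (h * (lam * (S * expR (L * (t - j%:R * h))) + eta))))).
      rewrite ler_wpM2l // ler_wpM2l ?powR_ge0 //.
      apply: ler_sum => j _; rewrite ler_wpM2l //.
      rewrite (_ : t - j.+1%:R * h = t - j%:R * h - h); last by rewrite -natr1; ring.
      by apply: bnd; apply: le_trans tT.
    rewrite [leLHS](_ : _ = 2 * eta * (h `^ a * \sum_(j < N) glw a j) +
        2 * lam * S * expR (L * t) * (h `^ a *
        \sum_(j < N) glw a j * expR (- (L * (j%:R * h))))); last first.
      rewrite -(powRB1M a h_gt0) !(mulrA _ (h `^ (a - 1) * h)) (mulrA 2).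
      rewrite !mulr_sumr -big_split; apply: eq_bigr => j _ /=.
      by rewrite mulrBr expRD; ring.
    rewrite [leRHS]mulrDl; apply: lerD.
      apply: (@le_trans _ _ (2 * CT * eta)).
        by rewrite mulrAC ler_wpM2r // ler_wpM2l.
      by rewrite ler_peMr // -expR0 ler_expR mulr_ge0 // ltW.
    have -> : S / 2 * expR (L * t) = 2 * lam * S * expR (L * t) * (4 * lam)^-1.
      by field; rewrite gt_eqF.
    rewrite ler_wpM2l ?mulr_ge0 ?expR_ge0 ?(ltW lam0) //.
    exact: Hk.
move=> t tT; apply: (le_trans (main t tT)).
rewrite [leRHS](_ : _ = 2 * (2 * CT * eta) * expR (L * T)); last by ring.
apply: ler_wpM2l; first exact: mulr_ge0.
by rewrite ler_expR ler_wpM2l ?(ltW L0) //; case/andP: tT.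
Qed.

End Gronwall.

(** * Aiming *)

Section Compactness.
Context {R : realType}.

(** Only the first point is confined to the compact set. In [unif_cont_control] the second state
    then needs no bound of its own. *)
Lemma compact_unif_within (V : pseudoMetricType R) (W : normedModType R)
    (A K : set V) (f : V -> W) : compact K -> K `<=` A -> {within A, continuous f} ->
  forall e : R, 0 < e -> exists2 r : R, 0 < r & forall z z', K z -> A z' ->
    ball z r z' -> `|f z - f z'| <= e.
Proof.
move=> cK KA cf e e0; have e20 : 0 < e / 2 by rewrite divr_gt0.
pose P (r : R) z := K z -> forall z', A z' -> ball z r z' -> `|f z - f z'| <= e.
have : \forall r \near (0 : R)^'+, K `<=` P r.
  apply: (proj1 (compact_near_coveringP K) cK) => z Kz.
  have := (proj1 (subspace_continuousP _ _) cf) z (KA z Kz).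
  move=> /cvgrPdist_lt /(_ _ e20); rewrite near_withinE => /nbhs_ballP[r /= r0 Hr].
  have r20 : 0 < r / 2 by rewrite divr_gt0.
  exists (ball z (r / 2), [set q | q < r / 2]).
    split; first exact: nbhsx_ballx.
    by rewrite /=; exact: nbhs_right_lt.
  move=> [w q] /= [zw qr] Kw w' Aw' ww'.
  have zw' : ball z r w'.
    have := ball_triangle zw ww'; apply: le_ball.
    by rewrite [leRHS]splitr lerD2l ltW.
  have h1 := Hr _ zw' Aw'.
  have h2 : `|f z - f w| < e / 2.
    by apply: Hr (KA _ Kw); apply: le_ball zw; rewrite ler_piMr ?(ltW r0) ?invf_le1 ?ler1n.
  rewrite -(subrKA (f z)) [leRHS]splitr; apply: le_trans (ler_normD _ _) _.
  by apply: lerD; [rewrite distrC ltW|exact: ltW].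
move=> H; have /nbhs_ballP[r /= r0 Hr] := H.
exists (r / 2); first by rewrite divr_gt0.
move=> z z' Kz; apply: (Hr (r / 2)) => //.
  rewrite /ball /= sub0r normrN gtr0_norm ?divr_gt0 //; lra.
by rewrite divr_gt0.
Qed.

Lemma unif_cont_control n nu nv (T : R) (P : set 'rV[R]_nu) (Q : set 'rV[R]_nv)
    (g : R -> 'rV[R]_n -> 'rV[R]_nu -> 'rV[R]_nv -> 'rV[R]_n) :
  compact P -> compact Q ->
  {within `[0, T] `*` setT `*` P `*` Q,
     continuous (fun z : R * 'rV[R]_n * 'rV[R]_nu * 'rV[R]_nv =>
       g z.1.1.1 z.1.1.2 z.1.2 z.2)} ->
  forall r e : R, 0 < e -> exists2 rho : R, 0 < rho &
    forall t t' x x' u v, 0 <= t <= T -> 0 <= t' <= T -> enorm x <= r ->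
      P u -> Q v -> `|t - t'| <= rho -> enorm (x - x') <= rho ->
      enorm (g t x u v - g t' x' u v) <= e.
Proof.
move=> cP cQ cg r e e0.
pose B := [set x : 'rV[R]_n | `|x| <= r].
have cB : compact B.
  apply: bounded_closed_compact.
    by exists r; split=> [|q rq x /= /le_trans]; [exact: num_real|apply; exact: ltW].
  have -> : B = (fun x => `|x|) @^-1` [set q | q <= r] by [].
  apply: closed_comp; last exact: closed_le.
  by move=> x _; exact: norm_continuous.
have cK : compact (`[0, T] `*` B `*` P `*` Q).
  by do !apply: compact_setX => //; exact: segment_compact.
have n0 : 0 < n%:R + 1 :> R by rewrite ltr_wpDl.
have [|q q0 Hq] := @compact_unif_within _ _ _ _ _ cK _ cg (e / (n%:R + 1)) (divr_gt0 e0 n0).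
  by move=> [[[t x] u] v] /= [[[tT _] Pu] Qv].
exists (q / 2); first by rewrite divr_gt0.
have q2 : q / 2 < q by lra.
move=> t t' x x' u v tT tT' xr Pu Qv tt xx.
have := Hq (t, x, u, v) (t', x', u, v) _ _ _ => H.
apply: le_trans (enorm_le_norm _) _.
apply: (@le_trans _ _ (n%:R * (e / (n%:R + 1)))).
  rewrite ler_wpM2l //; apply: H.
  - split=> //; split=> //; split=> /=; first by rewrite in_itv.
    exact: le_trans (norm_le_enorm _) xr.
  - by split=> //; split=> //; split=> //=; rewrite in_itv.
  - split; last exact: ballxx.
    split; last exact: ballxx.
    split; rewrite /= -ball_normE /=; first exact: le_lt_trans tt q2.
    exact: le_lt_trans (le_trans (norm_le_enorm _) xx) q2.
by rewrite mulrCA ler_piMr ?(ltW e0) // ler_pdivrMr // mul1r lerDl.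
Qed.

Lemma le_max_over (U : Type) (A : set U) (f : U -> R) (K : R) a :
  (forall a, A a -> f a <= K) -> A a -> f a <= max_over A f.
Proof.
move=> fK Aa; apply: ub_le_sup; last by exists a.
by exists K => _ [b Ab <-]; exact: fK.
Qed.

Lemma max_over_le (U : Type) (A : set U) (f : U -> R) (K : R) a :
  A a -> (forall a, A a -> f a <= K) -> max_over A f <= K.
Proof.
by move=> Aa fK; apply: ge_sup => [|_ [b Ab <-]]; [exists (f a), a|exact: fK].
Qed.

Lemma min_over_ge (U : Type) (A : set U) (f : U -> R) (K : R) a :
  (forall a, A a -> K <= f a) -> A a -> min_over A f <= f a.
Proof.
move=> fK Aa; apply: ge_inf; last by exists a.
by exists K => _ [b Ab <-]; exact: fK.
Qed.

Lemma le_min_over (U : Type) (A : set U) (f : U -> R) (K : R) a :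
  A a -> (forall a, A a -> K <= f a) -> K <= min_over A f.
Proof.
by move=> Aa fK; apply: lb_le_inf => [|_ [b Ab <-]]; [exists (f a), a|exact: fK].
Qed.

(* The aiming inequality: [p] is the payoff at the motion's position, [q] at
   the guide's position, and the saddle point condition is needed for [q] only. *)
Lemma aiming_le (U V : Type) (P : set U) (Q : set V) (p q : U -> V -> R) (K d : R)
    u0 v0 u v :
  (forall a b, P a -> Q b -> `|p a b| <= K) ->
  (forall a b, P a -> Q b -> `|q a b| <= K) ->
  (forall a b, P a -> Q b -> p a b - q a b <= d) ->
  min_over P (fun a => max_over Q (q a)) = max_over Q (fun b => min_over P (q ^~ b)) ->
  argmin P (fun a => max_over Q (p a)) u0 ->
  argmax Q (fun b => min_over P (q ^~ b)) v0 ->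
  P u -> Q v -> p u0 v - q u v0 <= d.
Proof.
move=> pK qK pq saddle [Pu0 u0min] [Qv0 v0max] Pu Qv.
have pub a b : P a -> Q b -> p a b <= K by move=> Pa Qb; exact: le_trans (ler_norm _) (pK a b Pa Qb).
have qub a b : P a -> Q b -> q a b <= K by move=> Pa Qb; exact: le_trans (ler_norm _) (qK a b Pa Qb).
have qlb a b : P a -> Q b -> - K <= q a b.
  by move=> Pa Qb; have := qK a b Pa Qb; rewrite ler_norml => /andP[].
have h1 : p u0 v <= max_over Q (p u0).
  by apply: (@le_max_over _ _ _ K) => // b Qb; exact: pub.
have h2 : max_over Q (p u0) - d <= min_over P (fun a => max_over Q (q a)).
  apply: (le_min_over Pu) => a Pa; rewrite lerBlDr.
  apply: (le_trans (u0min a Pa)); apply: (max_over_le Qv) => b Qb.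
  rewrite -lerBlDr; apply: (@le_trans _ _ (q a b)).
    by rewrite lerBlDr addrC -lerBlDr; exact: pq.
  by apply: (@le_max_over _ _ _ K) => // b' Qb'; exact: qub.
have h3 : max_over Q (fun b => min_over P (q ^~ b)) <= min_over P (q ^~ v0).
  by apply: (max_over_le Qv) => b Qb; exact: v0max.
have h4 : min_over P (q ^~ v0) <= q u v0.
  by apply: (@min_over_ge _ _ (q ^~ v0) (- K)) => // a Pa; exact: qlb.
move: saddle h1 h2 h3 h4; set m := min_over P _; set m' := max_over Q _.
set m1 := max_over Q _; set m2 := min_over P _ => ->.
by move=> *; lra.
Qed.

End Compactness.

(** * Cells of a partition and perturbation of the aiming inequality *)

Section MutualAiming.
Context {R : realType}.

Lemma path_cell (d : R) (p : seq R) (a r : R) : path <%R a p -> a <= r < last a p ->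
  exists j : nat, [/\ (j < size p)%N, a <= nth d (a :: p) j &
    nth d (a :: p) j <= r < nth d (a :: p) j.+1].
Proof.
elim: p a => [|q p IHp] a /=.
  by move=> _ /andP[ar ra]; have := le_lt_trans ar ra; rewrite ltxx.
move=> /andP[aq pathp] /andP[ar rT].
have [rq|qr] := ltP r q; first by exists 0%N; split; rewrite /= ?lexx ?ar ?rq.
have [|j [jp j0 jr]] := IHp q pathp; first by rewrite qr.
exists j.+1; split => //=; exact: le_trans (ltW aq) j0.
Qed.

Lemma partition_cell (p : seq R) (T r : R) : itv_partition 0 T p -> 0 <= r < T ->
  exists j : nat, [/\ (j < size p)%N, 0 <= node p j, node p j <= r < node p j.+1 &
    node p j.+1 - node p j <= diam p].
Proof.
move=> [pathp /eqP lastp]; rewrite -{1}lastp => rT.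
have [j [jp j0 jr]] := path_cell 0 pathp rT.
exists j; split => //.
exact: (le_bigmax _ (fun j : 'I_(size p) => node p j.+1 - node p j) (Ordinal jp)).
Qed.

Lemma rderB n (Y Z : R -> 'rV[R]_n) t d d' : rder Y t d -> rder Z t d' ->
  rder (fun s => Y s - Z s) t (d - d').
Proof.
move=> dY dZ q q0; have q20 : 0 < q / 2 by rewrite divr_gt0.
have [r r0 Hr] := dY _ q20; have [r' r'0 Hr'] := dZ _ q20.
exists (Num.min r r'); first by rewrite lt_min r0.
move=> k /andP[k0]; rewrite lt_min => /andP[kr kr'].
have -> : Y (t + k) - Z (t + k) - (Y t - Z t) - k *: (d - d') =
    Y (t + k) - Y t - k *: d - (Z (t + k) - Z t - k *: d').
  by apply/rowP => i; rewrite !mxE; ring.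
apply: le_trans (ler_normB _ _) _; rewrite [q]splitr mulrDl.
by apply: lerD; [apply: Hr|apply: Hr']; rewrite k0.
Qed.

Lemma glAvB n (a h : R) N (Y Z : R -> 'rV[R]_n) t :
  glAv a h N (fun s => Y s - Z s) t = glAv a h N Y t - glAv a h N Z t.
Proof.
rewrite /glAv -scalerBr -sumrB; congr (_ *: _); apply: eq_bigr => j _.
by apply/rowP => i; rewrite !mxE; ring.
Qed.

(** [s], [f], [f'] are the aiming vector and the velocities frozen at a node, [e], [d], [d'] the
    current ones. The product is split as [<e - s, d - d'> + <s, d - f> + <s, f' - d'> + <s, f -
    f'>], and [|s|^2 <= 2 |e|^2 + 2 om^2]. *)
Lemma dot_perturb n (e s d d' f f' : 'rV[R]_n) (om M eta S lam : R) :
  0 <= lam -> 0 <= om -> enorm (e - s) <= om -> enorm d <= M -> enorm d' <= M ->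
  enorm (d - f) <= eta -> enorm (d' - f') <= eta -> enorm s <= S ->
  dot s f - dot s f' <= lam * enorm s ^+ 2 ->
  dot e (d - d') <= 2 * lam * enorm e ^+ 2 +
    (2 * M * om + 2 * eta * S + 2 * lam * om ^+ 2).
Proof.
move=> lam0 om0 es dM dM' df df' sS sf.
have h1 : dot (e - s) (d - d') <= om * (2 * M).
  apply: le_trans (dot_le _ _) _; apply: ler_pM; rewrite ?enorm_ge0 //.
  apply: le_trans (enorm_triangle _ _) _; rewrite enormN; lra.
have h2 : dot s (d - f) <= S * eta by apply: le_trans (dot_le _ _) _; apply: ler_pM; rewrite ?enorm_ge0.
have h3 : dot s (f' - d') <= S * eta.
  by apply: le_trans (dot_le _ _) _; rewrite [enorm (f' - d')]enormB;
    apply: ler_pM; rewrite ?enorm_ge0.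
have h4 : enorm s <= enorm e + om.
  rewrite -(subrK e s) addrC; apply: le_trans (enorm_triangle _ _) _.
  by rewrite lerD2l enormB.
have h5 : lam * enorm s ^+ 2 <= lam * (2 * enorm e ^+ 2 + 2 * om ^+ 2).
  rewrite ler_wpM2l //; apply: (@le_trans _ _ ((enorm e + om) ^+ 2)).
    by rewrite ler_pXn2r ?nnegrE ?addr_ge0 ?enorm_ge0.
  by have := sqr_ge0 (enorm e - om); rewrite !sqrrD sqrrN; lra.
have -> : dot e (d - d') = dot (e - s) (d - d') + dot s (d - f) + dot s (f' - d') +
    (dot s f - dot s f') by rewrite dotBl !dotBr; ring.
by move: h1 h2 h3 sf h5; lra.
Qed.

End MutualAiming.

Theorem theorem3 (R : realType) (alpha T R0 : R) (n nu nv : nat)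
    (P : set 'rV[R]_nu) (Q : set 'rV[R]_nv)
    (g : R -> 'rV[R]_n -> 'rV[R]_nu -> 'rV[R]_nv -> 'rV[R]_n)
    (halpha : 0 < alpha < 1) (hT : 0 < T) (hR0 : 0 < R0)
    (hn : (0 < n)%N) (hnu : (0 < nu)%N) (hnv : (0 < nv)%N)
    (hP : compact P) (hQ : compact Q)
    (g_cont : {within `[0, T] `*` setT `*` P `*` Q,
       continuous (fun z : R * 'rV[R]_n * 'rV[R]_nu * 'rV[R]_nv =>
         g z.1.1.1 z.1.1.2 z.1.2 z.2)})
    (g_lip : forall r : R, 0 <= r -> exists2 lambda : R, 0 < lambda &
       forall t x y u v, t \in `[0, T] -> enorm x <= r -> enorm y <= r ->
         P u -> Q v ->
         enorm (g t x u v - g t y u v) <= lambda * enorm (x - y))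
    (g_growth : exists2 c : R, 0 < c &
       forall t x u v, t \in `[0, T] -> P u -> Q v ->
         enorm (g t x u v) <= (1 + enorm x) * c)
    (g_saddle : forall (t : R) (x s : 'rV[R]_n), t \in `[0, T] ->
       min_over P (fun u => max_over Q (fun v => dot s (g t x u v))) =
       max_over Q (fun v => min_over P (fun u => dot s (g t x u v)))) :
  forall eps : R, 0 < eps ->
  exists hstar deltastar : R, [/\ 0 < hstar, 0 < deltastar &
    forall (x0 : 'rV[R]_n) (h : R) (p : seq R)
           (u ut : R -> 'rV[R]_nu) (v vt : R -> 'rV[R]_nv)
           (x y : R -> 'rV[R]_n),
      enorm x0 <= R0 ->
      0 < h <= hstar ->
      itv_partition 0 T p -> diam p <= deltastar ->
      admissible T P u -> admissible T Q v ->
      admissible T P ut -> admissible T Q vt ->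
      is_motion alpha T g x0 u v x ->
      is_approx_motion alpha T g x0 h ut vt y ->
      mutual_aiming alpha P Q g x0 h p x y u vt ->
      forall t, t \in `[0, T] ->
        enorm (x t - x0 - scaled_diff alpha h y t) <= eps].
Proof.
move=> eps eps0; have /andP[a0 a1] := halpha; pose a := alpha.
have [c c0 gc] := g_growth.
have b0 : 0 <= 1 + R0 by rewrite addr_ge0 // ltW.
have [Rb [h0 [Rb0 h00 bound]]] := @apriori R n a T c (1 + R0) halpha hT c0 b0.
pose Rg := R0 + Rb; have Rg0 : 0 <= Rg by rewrite addr_ge0 // ltW.
pose M := c * (1 + R0 + Rb).
have M0 : 0 <= M by apply: mulr_ge0; [exact: ltW|rewrite addr_ge0].
have [lam lam0 glam] := g_lip Rg Rg0.
have lam20 : 0 < 2 * lam by rewrite mulr_gt0.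
have [K [h1 [K0 h10 sqg]]] := @square_gronwall R n a T (2 * lam) halpha hT lam20.
(* Half of [eps] is kept for [e], half for its distance to the deviation; [K + 1] because [K] may
   vanish. *)
pose eta := (eps / 2) ^+ 2 / (K + 1).
have eta0 : 0 < eta by rewrite divr_gt0 ?exprn_gt0 ?divr_gt0 // ltr_wpDl.
have Keta : K * eta <= (eps / 2) ^+ 2.
  by rewrite mulrCA ler_piMr ?sqr_ge0 // ler_pdivrMr ?mul1r ?lerDl // ltr_wpDl.
(* [om] and [eta1] share [eta] equally in the error term of [dot_perturb]; [om <= 1] makes its
   quadratic part linear. *)
pose om := Num.min 1 (eta / 2 / (2 * M + 2 * lam)).
have ML0 : 0 < 2 * M + 2 * lam by rewrite ltr_wpDl // mulr_ge0.
have om0 : 0 < om by rewrite lt_min ltr01 /=; apply: divr_gt0 => //; exact: divr_gt0.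
pose S := 2 * Rb; have S0 : 0 <= S by rewrite mulr_ge0.
have S10 : 0 < 2 * S + 1 by rewrite ltr_wpDl // mulr_ge0.
pose eta1 := eta / 2 / (2 * S + 1).
have eta10 : 0 < eta1 by apply: divr_gt0 => //; exact: divr_gt0.
have etaE : 2 * M * om + 2 * eta1 * S + 2 * lam * om ^+ 2 <= eta.
  have o1 : om <= 1 by rewrite ge_min lexx.
  have o2 : (2 * M + 2 * lam) * om <= eta / 2.
    by rewrite mulrC -ler_pdivlMr // ge_min lexx orbT.
  have o3 : lam * om ^+ 2 <= lam * om.
    by rewrite ler_wpM2l ?(ltW lam0) // expr2 ler_piMr // ltW.
  have o4 : (2 * S + 1) * eta1 <= eta / 2.
    by rewrite mulrC divfK // gt_eqF.
  by move: eta10 o1 o2 o3 o4; clear; lra.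
have [rho rho0 grho] := unif_cont_control hP hQ g_cont Rg eta10.
pose C1 := a^-1 + 2.
have C10 : 0 <= C1 by rewrite addr_ge0 // invr_ge0 ltW.
(* A single constant for all later errors: shifting the difference of the two primitives, with
   Lipschitz constant [2 * M], costs [(4 / a + 4) * M], and a motion is compared with its discrete
   integral at most twice. *)
pose C3 := (4 / a + 4 + 2 * C1) * M.
have C30 : 0 <= C3.
  apply: mulr_ge0 => //; apply: addr_ge0; last exact: mulr_ge0.
  by apply: addr_ge0 => //; rewrite divr_ge0 // ltW.
pose th := Num.min (Num.min rho om) (eps / 2).
have th0 : 0 < th by rewrite 2!lt_min rho0 om0 divr_gt0.
have [sig /andP[sig0 sig1] sigth] := powR_small a0 C30 th0.
(* A time is at most [h] from the start of its lattice cell and at most the diameter from its node: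
   two halves of [sig]. *)
exists (Num.min (Num.min h0 h1) (sig / 2)), (Num.min (sig / 2) rho).
split; [by rewrite !lt_min h00 h10 divr_gt0|by rewrite lt_min rho0 divr_gt0|].
move=> x0 h p u ut v vt x y x0R /andP[hp].
rewrite !le_min => /andP[/andP[hh0 hh1] hsig] ip /andP[dsig drho].
move=> [_ uP] [_ vQ] [_ utP] [_ vtQ] mx my aim.
have h1' : h <= 1 by move: hsig sig1; clear; lra.
have [Y [L [C [cY [L0 C0] lY aeY xY]]]] := motion_spec halpha hT mx.
have [L' [L'0 lZ y0 aeZ]] := approx_spec hT my.
have cZ : vcausal (zext y) by exact: zext_causal.
set Z := zext y in lZ aeZ cZ.
have [N TN NT] := nat_cover hp (ltW hT).
have NT1 : N%:R * h <= T + 1 by apply: (le_trans NT); rewrite lerD2l.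
have zE t : 0 <= t <= T -> scaled_diff alpha h y t = glAv a h N Z t.
  move=> /andP[t0 tT]; apply: scaled_diffE => //; exact: le_trans TN.
have in0T t : 0 <= t <= T -> t \in `[0, T] by rewrite in_itv.
have inT t : 0 <= t < T -> t \in `[0, T[ by rewrite in_itv.
(* The constant [C] depends on the motion, so the a priori bound is applied with an auxiliary step
   [h'] adapted to it, not with [h]; the resulting [Rb] is uniform all the same. *)
have xb : forall t, 0 <= t <= T -> enorm (x t - x0) <= Rb.
  have [q /andP[q0 q1] qC] := powR_small a0 C0 ltr01.
  pose h' := Num.min q (Num.min h0 1).
  have h'0 : 0 < h' by rewrite !lt_min q0 h00 ltr01.
  have h'q : h' <= q by rewrite ge_min lexx.
  have h'h0 : h' <= h0 by rewrite !ge_min lexx orbT.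
  have h'1 : h' <= 1 by rewrite !ge_min lexx !orbT.
  have [N' TN' NT'] := nat_cover h'0 (ltW hT).
  apply: (bound Y (fun t => x t - x0) h' L N' _ _ TN' _ cY L0 lY aeY).
  - by rewrite h'0.
  - by apply: (le_trans NT'); rewrite lerD2l.
  - move=> t tT /(_ (andP tT).2) dY; eexists; first exact: dY.
    have /andP[t1 t2] := tT.
    apply: le_trans (gc t _ _ _ _ (uP t (inT t tT)) (vQ t (inT t tT))) _.
      by rewrite in0T // t1 ltW.
    rewrite mulrC ler_wpM2l ?(ltW c0) // -addrA lerD2l.
    rewrite -{1}(subrKC x0 (x t)).
    by apply: le_trans (enorm_triangle _ _) _; rewrite lerD2r.
  - move=> t tT; have /andP[_ t2] := tT.
    apply: le_trans (xY h' N' t h'0 tT (le_trans t2 TN')) _.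
    apply: le_trans qC; rewrite ler_wpM2l //.
    by apply: ge0_ler_powR; rewrite ?nnegrE ?(ltW a0) ?(ltW h'0) ?(ltW q0).
have zb : forall t, 0 <= t <= T -> enorm (scaled_diff alpha h y t) <= Rb.
  apply: (bound Z (fun t => scaled_diff alpha h y t) h L' N _ _ TN NT1 cZ L'0 lZ aeZ).
  - by rewrite hp.
  - move=> t tT dZ; eexists; first exact: dZ.
    have /andP[t1 t2] := tT.
    apply: le_trans (gc t _ _ _ _ (utP t (inT t tT)) (vtQ t (inT t tT))) _.
      by rewrite in0T // t1 ltW.
    rewrite mulrC ler_wpM2l ?(ltW c0) // -addrA lerD2l.
    by apply: le_trans (enorm_triangle _ _) _; rewrite lerD2r.
  - by move=> t tT; rewrite zE // subrr enorm0.
have xRg t : 0 <= t <= T -> enorm (x t) <= Rg.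
  move=> /xb xbt; rewrite -(subrKC x0 (x t)).
  by apply: le_trans (enorm_triangle _ _) _; exact: lerD.
have zRg t : 0 <= t <= T -> enorm (x0 + scaled_diff alpha h y t) <= Rg.
  by move=> /zb zbt; apply: le_trans (enorm_triangle _ _) _; exact: lerD.
pose d1 r := g r (x r) (u r) (v r).
pose d2 r := g r (x0 + scaled_diff alpha h y r) (ut r) (vt r).
have d1M r : 0 <= r < T -> enorm (d1 r) <= M.
  move=> rT; have /andP[r1 r2] := rT.
  have rT' : 0 <= r <= T by rewrite r1 ltW.
  apply: le_trans (gc r _ _ _ _ (uP r (inT r rT)) (vQ r (inT r rT))) _.
    by rewrite in0T.
  by rewrite mulrC ler_wpM2l ?(ltW c0) // -addrA lerD2l; exact: xRg.
have d2M r : 0 <= r < T -> enorm (d2 r) <= M.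
  move=> rT; have /andP[r1 r2] := rT.
  have rT' : 0 <= r <= T by rewrite r1 ltW.
  apply: le_trans (gc r _ _ _ _ (utP r (inT r rT)) (vtQ r (inT r rT))) _.
    by rewrite in0T.
  by rewrite mulrC ler_wpM2l ?(ltW c0) // -addrA lerD2l; exact: zRg.
have sub0 (t : R) : t <= T -> `[0, t]%classic `<=` `[0, T]%classic.
  by move=> tT r /=; rewrite !in_itv /= => /andP[-> /le_trans ->].
(* With the states bounded, the velocities are at most [M]; the motion-dependent constants [L], [L']
   and [C] are now replaced by uniform ones. *)
have lYM : vlip T M Y.
  move=> s t st tT.
  apply: (enorm_ae_causal st M0 cY (vlip_le tT lY)
    (ae_onW (sub0 t tT) (fun r _ H => H) aeY)).
  move=> r /andP[r1 r2] dY; have rT := lt_le_trans r2 tT.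
  by exists (d1 r); [exact: dY rT|apply: d1M; rewrite r1].
have lZM : vlip T M Z.
  move=> s t st tT.
  apply: (enorm_ae_causal st M0 cZ (vlip_le tT lZ)
    (ae_onW (sub0 t tT) (fun r _ H => H) aeZ)).
  move=> r /andP[r1 r2] dZ; have rT := lt_le_trans r2 tT.
  by exists (d2 r); [exact: dZ|apply: d2M; rewrite r1].
have xYM t : 0 <= t <= T -> enorm (x t - x0 - glAv a h N Y t) <= C1 * M * h `^ a.
  move=> tT; have /andP[_ t2] := tT.
  apply: (glAv_limit halpha M0 (vlip_le t2 lYM) C0) => //.
    by move=> q N' q0 tN'; exact: xY.
  exact: le_trans TN.
pose D s := Y s - Z s.
have cD : vcausal D by move=> s s0; rewrite /D cY // cZ // subrr.
have lD : vlip T (2 * M) D.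
  move=> s t st tT; rewrite /D.
  have -> : Y t - Z t - (Y s - Z s) = Y t - Y s + (Z s - Z t).
    by apply/rowP => i; rewrite !mxE; ring.
  apply: le_trans (enorm_triangle _ _) _; rewrite [enorm (Z s - _)]enormB.
  by move: (lYM s t st tT) (lZM s t st tT); clear; lra.
pose e := glAv a h N D.
pose s t := x t - x0 - scaled_diff alpha h y t.
have se t : 0 <= t <= T -> enorm (s t - e t) <= C1 * M * h `^ a.
  move=> tT; rewrite /e glAvB /s zE //.
  have -> : x t - x0 - glAv a h N Z t - (glAv a h N Y t - glAv a h N Z t) =
      x t - x0 - glAv a h N Y t by apply/rowP => i; rewrite !mxE; ring.
  exact: xYM.
have hpow (q : R) : 0 <= q -> q <= sig -> q `^ a <= sig `^ a.
  by move=> q0 qs; apply: ge0_ler_powR; rewrite ?nnegrE ?(ltW a0) ?(ltW sig0).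
have sigE : C3 * sig `^ a = 4 / a * M * sig `^ a + 4 * M * sig `^ a +
    2 * (C1 * M * sig `^ a) by rewrite /C3; ring.
have sigrho : C3 * sig `^ a <= rho by apply: (le_trans sigth); rewrite !ge_min lexx.
have sigom : C3 * sig `^ a <= om by apply: (le_trans sigth); rewrite ge_min ge_min lexx orbT.
have sigeps : C3 * sig `^ a <= eps / 2.
  by apply: (le_trans sigth); rewrite ge_min lexx orbT.
have sa0 := powR_ge0 sig a.
have ia0 : 0 <= 2 / a by rewrite divr_ge0 // ltW.
have C1M0 : 0 <= C1 * M by exact: mulr_ge0.
have Ms0 : 0 <= M * sig `^ a by exact: mulr_ge0.
have aM0 : 0 <= 2 / a * M * sig `^ a by apply: mulr_ge0 => //; exact: mulr_ge0.
have CMs0 : 0 <= C1 * M * sig `^ a by exact: mulr_ge0.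
have hsig' : h `^ a <= sig `^ a by apply: hpow; [exact: ltW|move: hsig sig0; clear; lra].
have CMh : C1 * M * h `^ a <= C1 * M * sig `^ a by rewrite ler_wpM2l.
have shift (W : R -> 'rV[R]_n) B t' t : 0 <= B -> vcausal W -> vlip T B W ->
    t' <= t -> t <= T -> t - t' <= sig ->
    enorm (glAv a h N W t - glAv a h N W t') <=
    2 / a * B * sig `^ a + 2 * B * sig `^ a.
  move=> B0 cW lW t't tT tsig.
  apply: le_trans (glAv_shift halpha hp B0 cW (vlip_le tT lW) t't (le_trans tT TN)) _.
  apply: lerD.
    apply: ler_wpM2l; first exact: mulr_ge0.
    by apply: hpow => //; rewrite subr_ge0.
  by apply: ler_wpM2l => //; exact: mulr_ge0.
suff e2 t : 0 <= t <= T -> enorm (e t) ^+ 2 <= K * eta.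
  move=> t tT'; have tT : 0 <= t <= T by move: tT'; rewrite in_itv.
  have et : enorm (e t) <= eps / 2.
    rewrite -(ler_pXn2r (n := 2)) ?nnegrE ?enorm_ge0 ?divr_ge0 ?(ltW eps0) //.
    exact: le_trans (e2 t tT) Keta.
  rewrite -/(s t) -(subrK (e t) (s t)); apply: le_trans (enorm_triangle _ _) _.
  by move: (se t tT) et sigeps CMh; rewrite sigE; move: Ms0 aM0 CMs0; clear; lra.
move=> tT.
apply: (sqg D h (2 * M) eta N _ TN NT1 cD _ lD (ltW eta0) _ t tT) => //.
- by rewrite hp.
- exact: mulr_ge0.
move=> q qT; have /andP[q1 q2] := qT.
(* The differential equations hold on [[0, T]] only; to the left of 0 the function [D] is
   constant. *)
pose q' := Num.max 0 (q - h).
have q'q : q' <= q by rewrite ge_max q1 gerBl ltW.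
have -> : D (q - h) = D q'.
  rewrite /q'; case: (leP 0 (q - h)) => // qh.
  by rewrite !cD // ltW.
have bnd0 : 0 <= 2 * lam * enorm (e q) ^+ 2 + eta.
  apply: addr_ge0; last exact: ltW.
  by apply: mulr_ge0; [exact: ltW|exact: sqr_ge0].
apply: (@le_trans _ _ ((2 * lam * enorm (e q) ^+ 2 + eta) * (q - q'))); last first.
  by rewrite [leRHS]mulrC ler_wpM2l // lerBlDl -lerBlDr le_max lexx orbT.
have q'0 : 0 <= q' by rewrite le_max lexx.
have sub : `[q', q]%classic `<=` `[0, T]%classic.
  move=> r /=; rewrite !in_itv /= => /andP[r1 r2].
  by rewrite (le_trans q'0 r1) (le_trans r2).
have aeD := ae_onW sub (fun r _ H => H) (ae_onI aeY aeZ).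
(* The test vector [e q] is fixed over the whole cell, so the scalar mean value inequality
   applies. *)
apply: (vec_ae_le q'q (vlip_le q2 lD) aeD) => r /andP[r1 r2] [dY dZ].
have rT : 0 <= r < T by rewrite (le_trans q'0 r1) (lt_le_trans r2).
have rT' : 0 <= r <= T by have /andP[-> /ltW] := rT.
have /andP[r0 rltT] := rT.
exists (d1 r - d2 r); first exact: (rderB (dY rltT) dZ).
(* The node is that of [r], not of [q]: a lattice cell may meet several cells of the partition. *)
have [j [jp j0 /andP[jr rj] jd]] := partition_cell ip rT.
have [uj [vj [umin vmax uvE]]] := aim j jp.
set tau := node p j in j0 jr rj jd umin vmax uvE.
have [|ur vr] := uvE r; first by rewrite in_itv /= jr.
have tauT : 0 <= tau <= T by rewrite j0 (le_trans jr (ltW rltT)).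
have rtau : r - tau <= sig / 2 by move: rj jd dsig; clear; lra.
have qr : q - r <= h.
  by have : q - h <= q' by [rewrite le_max lexx orbT]; move: r1; clear; lra.
have qtau : q - tau <= sig by move: rtau qr hsig; clear; lra.
have tauq : tau <= q by move: jr r2; clear; lra.
have etaE' : enorm (e q - s tau) <= om.
  rewrite -(subrKA (e tau)); apply: le_trans (enorm_triangle _ _) _.
  have M20 : 0 <= 2 * M by exact: mulr_ge0.
  have := shift D (2 * M) tau q M20 cD lD tauq q2 qtau.
  rewrite -/(e q) -/(e tau); have := se tau tauT; rewrite enormB.
  by move: sigom CMh; rewrite sigE; move: Ms0 aM0 CMs0; clear; lra.
have taur : `|r - tau| <= rho.
  by rewrite ger0_norm ?subr_ge0 //; move: rj jd drho; clear; lra.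
have xrt : enorm (x r - x tau) <= rho.
  have rts : r - tau <= sig by move: rtau sig0; clear; lra.
  have sh := shift Y M tau r M0 cY lYM jr (ltW rltT) rts.
  have -> : x r - x tau = (x r - x0 - glAv a h N Y r) -
      (x tau - x0 - glAv a h N Y tau) + (glAv a h N Y r - glAv a h N Y tau).
    by apply/rowP => i; rewrite !mxE; ring.
  apply: le_trans (enorm_triangle _ _) _.
  have := enorm_triangle (x r - x0 - glAv a h N Y r) (- (x tau - x0 - glAv a h N Y tau)).
  rewrite enormN; have := xYM r rT'; have := xYM tau tauT.
  by move: sigrho sh CMh; rewrite sigE; move: Ms0 aM0 CMs0; clear; lra.
have zrt : enorm (x0 + scaled_diff alpha h y r - (x0 + scaled_diff alpha h y tau)) <= rho.
  have rts : r - tau <= sig by move: rtau sig0; clear; lra.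
  have sh := shift Z M tau r M0 cZ lZM jr (ltW rltT) rts.
  have -> : x0 + scaled_diff alpha h y r - (x0 + scaled_diff alpha h y tau) =
      glAv a h N Z r - glAv a h N Z tau.
    by rewrite !zE //; apply/rowP => i; rewrite !mxE; ring.
  by move: sigrho sh; rewrite sigE; move: Ms0 aM0 CMs0; clear; lra.
have sS : enorm (s tau) <= S.
  apply: le_trans (enorm_triangle _ _) _; rewrite enormN.
  by move: (xb tau tauT) (zb tau tauT); rewrite /S; clear; lra.
(* Time and state are frozen at the node, but the opposing realizations keep their values at [r]:
   the aiming inequality holds against any of them. *)
pose f1 := g tau (x tau) uj (v r).
pose f2 := g tau (x0 + scaled_diff alpha h y tau) (ut r) vj.
have [Puj _] := umin; have [Qvj _] := vmax.
have Pur := utP r (inT r rT); have Qvr := vQ r (inT r rT).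
have f1E : enorm (d1 r - f1) <= eta1.
  by rewrite /d1 ur; apply: grho => //; exact: xRg.
have f2E : enorm (d2 r - f2) <= eta1.
  by rewrite /d2 vr; apply: grho => //; exact: zRg.
have aimE : dot (s tau) f1 - dot (s tau) f2 <= lam * enorm (s tau) ^+ 2.
  have bd w b b' : enorm w <= Rg -> P b -> Q b' ->
      `|dot (s tau) (g tau w b b')| <= enorm (s tau) * ((1 + Rg) * c).
    move=> wR Pb Qb'.
    have gb : enorm (g tau w b b') <= (1 + Rg) * c.
      apply: le_trans (gc tau w b b' (in0T tau tauT) Pb Qb') _.
      by rewrite ler_wpM2r ?(ltW c0) // lerD2l.
    have n1 := dot_le (s tau) (g tau w b b').
    have n2 := dot_le (s tau) (- g tau w b b').
    rewrite dotNr enormN in n2.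
    have n3 := ler_wpM2l (enorm_ge0 (s tau)) gb.
    by move: n1 n2 n3; rewrite ler_norml; clear => *; apply/andP; split; lra.
  apply: (aiming_le (K := enorm (s tau) * ((1 + Rg) * c))
    (p := fun b b' => dot (s tau) (g tau (x tau) b b'))
    (q := fun b b' => dot (s tau) (g tau (x0 + scaled_diff alpha h y tau) b b'))
    _ _ _ _ umin vmax Pur Qvr).
  - by move=> b b'; apply: bd; exact: xRg.
  - by move=> b b'; apply: bd; exact: zRg.
  (* The two states differ exactly by the aiming vector [s tau], so the Lipschitz condition yields
     its square. *)
  - move=> b b' Pb Qb'; rewrite -dotBr; apply: le_trans (dot_le _ _) _.
    rewrite mulrC expr2 mulrA ler_wpM2r ?enorm_ge0 //.
    apply: le_trans (glam tau _ _ b b' (in0T tau tauT) (xRg tau tauT) (zRg tau tauT) Pb Qb') _.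
    by rewrite opprD addrA.
  - by apply: g_saddle; exact: in0T.
have := dot_perturb (ltW lam0) (ltW om0) etaE' (d1M r rT) (d2M r rT) f1E f2E sS aimE.
by move=> /le_trans; apply; rewrite lerD2l.
Qed.
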